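(* Suppose that $f_0\in X_{A,B}$, where $-\frac52<B<-\frac34<\frac12<A<1$, and let $f(t)=\mathscr F^{-1}\left(e^{t(\gamma+\widehat K)}\widehat f_0\right)$, $t>0$, be the corresponding solution of $\partial_tf=\gamma f+K\ast f$. Then, for every $L\in\mathbb R$, every $t>0$ and every $\sigma>\frac12$ close to $\frac12$, $$\int_{-\infty}^Lf(t,x)e^{\frac x2}dx=\int_{\mathbb R}f(t,x)e^{\frac x2}dx+\frac1{2\pi}\int_{\operatorname{Im}\xi=\sigma}\widehat f_0(\xi)e^{(\gamma+\widehat K(\xi))t}\frac{e^{L\left(i\xi+\frac12\right)}}{i\xi+\frac12}\,d\xi,$$ where all the integrals are absolutely convergent. Moreover, there is a constant $C>0$ such that, as $t\to\infty$ (i.e. for all sufficiently large $t$), $$\left|\int_{\operatorname{Im}\xi=\sigma}\widehat f_0(\xi)e^{(\gamma+\widehat K(\xi))t}\frac{e^{L\left(i\xi+\frac12\right)}}{i\xi+\frac12}\,d\xi\right|\le Ce^{-\nu t}\int_{\mathbb R}|f_0(x)|e^{\frac{3x}4}dx,$$ where $-\nu=\gamma+\widehat K(3i/4)<0$.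
   Context: The function $\mathcal V$ on $(0,1)\cup(1,\infty)$: for $0<p<1$, $$\mathcal V(p)=\frac{2\log p}{1+p^2}-\frac{2}{p\sqrt{1+p^2}}\operatorname{arctanh}\frac{p}{\sqrt{1+p^2}}-\frac{2\log p}{1-p^2}+\frac{2}{p\sqrt{1-p^2}}\arctan\frac{p}{\sqrt{1-p^2}},$$ and for $p>1$, $$\mathcal V(p)=-\frac{2\log p}{p(1+p^2)}-\frac{2}{p\sqrt{1+p^2}}\operatorname{arctanh}\frac{1}{\sqrt{1+p^2}}+\frac{2\log p}{p(p^2-1)}+\frac{2}{p\sqrt{p^2-1}}\arctan\frac{1}{\sqrt{p^2-1}}.$$ $K(x)=\mathcal V(e^{x/2})$ for $x\in\mathbb R\setminus\{0\}$. The constant is $\gamma=2\gamma_N$, where $\gamma_N<0$ is such that $W(s):=\gamma_N+\int_0^\infty\mathcal V(p)p^s\frac{dp}p$ satisfies $W(1)=W(2)=0$, i.e. $\gamma_N=-\int_0^\infty\mathcal V(p)\,dp$. Fourier transform: $\widehat h(\xi)=\int_{\mathbb R}e^{-ix\xi}h(x)dx$ (also for complex $\xi$ when the integral converges), $\mathscr F^{-1}(h)(x)=\frac1{2\pi}\int_{\mathbb R}e^{ix\xi}h(\xi)d\xi$. $\widehat K$ is analytic in the strip $\operatorname{Im}\xi\in(-1,5/2)$. $X_{A,B}=\{f\in L^\infty_{\rm loc}(\mathbb R):\ \|f\|_{X_{A,B}}<\infty\}$ with $\|f\|_{X_{A,B}}=\sup_{x<0}e^{-Ax}|f(x)|+\sup_{x>0}e^{-Bx}|f(x)|$.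 *)

(* Defs.v *)
From HB Require Import structures.
From mathcomp Require Import all_boot all_order all_algebra.
From mathcomp Require Import all_classical all_reals all_analysis.
From mathcomp Require Import ess_sup_inf.
From mathcomp Require Export complex.

Set Implicit Arguments.
Unset Strict Implicit.
Unset Printing Implicit Defensive.
Import Order.TTheory GRing.Theory Num.Theory.
Import numFieldNormedType.Exports.

Local Open Scope classical_set_scope.
Local Open Scope ring_scope.
Local Open Scope complex_scope.

Section ComplexValuedIntegration.
Context {R : realType}.
Local Notation mu := (@lebesgue_measure R).
Local Notation Re := complex.Re.
Local Notation Im := complex.Im.
Implicit Types (D : set R) (g : R -> R[i]) (z : R[i]).

(* The real-valued modulus; [`|z|] itself lives in [R[i]]. *)
Definition cabs z : R := Re `|z|.

Definition cexp z : R[i] := (expR (Re z))%:C * (cos (Im z) +i* sin (Im z)).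

Definition cmeasurable D g : Prop :=
  measurable_fun D (fun x => Re (g x)) /\ measurable_fun D (fun x => Im (g x)).

Definition abs_convergent D g : Prop :=
  cmeasurable D g /\ (\int[mu]_(x in D) (cabs (g x))%:E < +oo)%E.

Definition cintegral D g : R[i] :=
  Rintegral mu D (fun x => Re (g x)) +i* Rintegral mu D (fun x => Im (g x)).

(* int_{Im xi = sigma} g(xi) dxi, the line being parametrized by
   xi = u + i sigma with u increasing over the reals. *)
Definition line_integral (sigma : R) (g : R[i] -> R[i]) : R[i] :=
  cintegral setT (fun u => g (u +i* sigma)).

Definition line_abs_convergent (sigma : R) (g : R[i] -> R[i]) : Prop :=
  abs_convergent setT (fun u => g (u +i* sigma)).

End ComplexValuedIntegration.

Section FourierTransform.
Context {R : realType}.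
Local Notation mu := (@lebesgue_measure R).

Definition fourier (h : R -> R[i]) (xi : R[i]) : R[i] :=
  cintegral setT (fun x => cexp (- 'i * x%:C * xi) * h x).

Definition square_integrable (h : R -> R[i]) : Prop :=
  cmeasurable setT h /\ (\int[mu]_x (cabs (h x) ^+ 2)%:E < +oo)%E.

Definition inv_fourier_trunc (h : R -> R[i]) (r x : R) : R[i] :=
  ((2 * pi)^-1)%:C * cintegral `[- r, r] (fun xi => cexp ('i * x%:C * xi%:C) * h xi).

(* The inverse transform is taken in the L^2 sense of Plancherel's theorem: a
   square-integrable h need not be integrable, so that
   (2 pi)^-1 int e^{i x xi} h(xi) dxi is the limit in L^2 of its truncations to
   [-r, r]. It determines f up to a null set. *)
Definition is_inv_fourier (h f : R -> R[i]) : Prop :=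
  [/\ square_integrable h, square_integrable f &
      (fun r : R => \int[mu]_x (cabs (f x - inv_fourier_trunc h r x) ^+ 2)%:E)%E
        @ +oo --> 0%E].

(* A representative of the inverse transform (0 if there is none). *)
Definition inv_fourier (h : R -> R[i]) : R -> R[i] :=
  xget (fun=> 0) [set f | is_inv_fourier h f].

End FourierTransform.

Section Kernel.
Context {R : realType}.
Local Notation mu := (@lebesgue_measure R).

Definition arctanh (y : R) : R := ln ((1 + y) / (1 - y)) / 2.

(* The value 0 at p = 1 and for p <= 0 is a dummy. *)
Definition V (p : R) : R :=
  if 0 < p < 1 then
    2 * ln p / (1 + p ^+ 2)
    - 2 / (p * Num.sqrt (1 + p ^+ 2)) * arctanh (p / Num.sqrt (1 + p ^+ 2))
    - 2 * ln p / (1 - p ^+ 2)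
    + 2 / (p * Num.sqrt (1 - p ^+ 2)) * atan (p / Num.sqrt (1 - p ^+ 2))
  else if 1 < p then
    - (2 * ln p / (p * (1 + p ^+ 2)))
    - 2 / (p * Num.sqrt (1 + p ^+ 2)) * arctanh (1 / Num.sqrt (1 + p ^+ 2))
    + 2 * ln p / (p * (p ^+ 2 - 1))
    + 2 / (p * Num.sqrt (p ^+ 2 - 1)) * atan (1 / Num.sqrt (p ^+ 2 - 1))
  else 0.

Definition K (x : R) : R := V (expR (x / 2)).

Definition Khat (xi : R[i]) : R[i] := fourier (fun x => (K x)%:C) xi.

Definition gammaN : R := - Rintegral mu `]0, +oo[ V.

Definition gamma : R := 2 * gammaN.

End Kernel.

Section WeightedSpace.
Context {R : realType}.
Local Notation mu := (@lebesgue_measure R).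

Definition Linfty_loc (f : R -> R[i]) : Prop :=
  cmeasurable setT f /\
  forall D : set R, compact D ->
    (ess_sup mu ((fun x : R => (cabs (f x))%:E) \_ D) < +oo)%E.

(* The suprema are essential suprema, elements of L^infty_loc being classes
   modulo null sets; as the functions are nonnegative, extending them by 0
   outside the half-line does not change the essential supremum over it. *)
Definition normX (A B : R) (f : R -> R[i]) : \bar R :=
  (ess_sup mu ((fun x : R => (expR (- A * x) * cabs (f x))%:E) \_ `]-oo, 0%R[) +
   ess_sup mu ((fun x : R => (expR (- B * x) * cabs (f x))%:E) \_ `]0%R, +oo[))%E.

Definition inX (A B : R) (f : R -> R[i]) : Prop :=
  Linfty_loc f /\ (normX A B f < +oo)%E.

End WeightedSpace.

Section Solution.
Context {R : realType}.

(* The value at time t of the solution of d_t f = gamma f + K * f, f(0) = f0. *)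
Definition solution (f0 : R -> R[i]) (t : R) : R -> R[i] :=
  inv_fourier (fun xi : R =>
    cexp (t%:C * (gamma%:C + Khat xi%:C)) * fourier f0 xi%:C).

Definition remainder_integrand (f0 : R -> R[i]) (t L : R) (xi : R[i]) : R[i] :=
  fourier f0 xi * cexp ((gamma%:C + Khat xi) * t%:C)
  * (cexp (L%:C * ('i * xi + (1 / 2)%:C)) / ('i * xi + (1 / 2)%:C)).

End Solution.

(* Main.v *)
Require Import Defs.
From HB Require Import structures.
From mathcomp Require Import all_boot all_order all_algebra.
From mathcomp Require Import all_classical all_reals all_analysis.
From mathcomp Require Import measurable_realfun ess_sup_inf.
From mathcomp Require Import ring lra.
Set Implicit Arguments.
Unset Strict Implicit.
Unset Printing Implicit Defensive.
Import Order.TTheory GRing.Theory Num.Theory.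
Import numFieldNormedType.Exports.
Local Open Scope classical_set_scope.
Local Open Scope ring_scope.

(** The kernel is $K(x)=V(e^{x/2})$. Since $V(1/q)=q^3V(q)$ ([V_inv]), the
    function $k(x)=K(x)e^{3x/4}$ is even ([K_inv]), and it is positive: the
    arctangent and area hyperbolic tangent in $V$ are controlled by their
    slopes at the origin ([V_slopes]). The substitution $p=e^{x/2}$ turns
    $\gamma=-2\int V$ into $-\int K e^{x/2}=-\int k\cosh(x/4)$ ([gammaE]), so
    that $\gamma+\hat K(3i/4)=\int k\,(1-\cosh(x/4))<0$ ([rate_lt0]).

    A datum of $X_{A,B}$ is dominated almost everywhere by a multiple of
    $\min(e^{x/4},e^{-\beta x})$ with $\beta>3/4$ ([inX_representative]). As
    $K\ge 0$ is integrable against $e^{\sigma x}$ for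
    $-1/4\le\sigma\le 7/4$ ([L1_K_exp]), convolution with $K$ preserves this
    class, and the series $f(t)=e^{t\gamma}\sum_n \frac{t^n}{n!}K^{*n}*f_0$
    converges pointwise and with all the weighted integrals at stake ([sol]).
    By Fubini, convolution with $K$ is multiplication by $\hat K$ on each line
    $\mathrm{Im}\,\xi=\sigma$, $0\le\sigma\le 3/4$; summing the series,
    $f(t,x)e^{\sigma x}$ has transform
    $u\mapsto e^{t(\gamma+\hat K)}\hat f_0(u+i\sigma)$ ([sol_transform]).

    The solution is defined as an inverse transform in the sense of $L^2$. That
    it is the series follows from Plancherel's theorem for bounded integrable
    real functions: $\int e^{-\varepsilon|u|}|\hat a(u)|^2\,du$ is the average
    of the autocorrelation of $a$ against the Poisson kernel, and
    $\varepsilon\to 0$ ([plancherel]). Polarization gives Parseval's identity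
    ([parseval]), and expanding the square shows that the truncated inversion
    integral misses $a$ in the mean by the mass of $|\hat a|^2$ outside the
    window ([invT_error], [invT_cvg], [solution_ae]).

    For the formula itself, on $\mathrm{Im}\,\xi=\sigma>1/2$ the factor
    $e^{L(i\xi+1/2)}/(i\xi+1/2)$ is minus the conjugate of the transform of
    $1_{x>L}e^{-(\sigma-1/2)x}$ ([line_kernelE]). By Parseval the line integral
    is therefore $-2\pi\int_L^\infty f(t,x)e^{x/2}dx$ ([remainder_integral]),
    which is the asserted identity and shows that the line integral is the
    same for all $\sigma$.

    Finally, $e^{x/2}\le e^{-L/4}e^{3x/4}$ for $x>L$, and since $K\ge 0$ each
    convolution multiplies the weighted norm $\int|a|e^{3x/4}$ by at most
    $\hat K(3i/4)$, so that this norm of $f(t)$ is at most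
    $e^{t(\gamma+\hat K(3i/4))}$ times that of $f_0$ ([sol_L1_bound]). This
    bounds the line integral for every $t>0$ ([remainder_bound]). *)

(** * Integrals over the real line *)
Section RealIntegrals.
Context {R : realType}.
Local Notation mu := (@lebesgue_measure R).
Implicit Types (f g h : R -> R) (c : R).

Definition L1 f : Prop := mu.-integrable setT (EFin \o f).

Definition Int f : R := Rintegral mu setT f.

Lemma ae_imp (P Q : R -> Prop) : (forall x, P x -> Q x) ->
  {ae mu, forall x, P x} -> {ae mu, forall x, Q x}.
Proof. by move=> PQ; apply: (@filterS _ _ (ae_filter_ringOfSetsType mu)). Qed.

Lemma ae_imp2 (P1 P2 Q : R -> Prop) : (forall x, P1 x -> P2 x -> Q x) ->
  {ae mu, forall x, P1 x} -> {ae mu, forall x, P2 x} -> {ae mu, forall x, Q x}.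
Proof. by move=> PQ; apply: (@filterS2 _ _ (ae_filter_ringOfSetsType mu)). Qed.

Lemma ae_neq2 (p q : R) : {ae mu, forall x : R, x <> p /\ x <> q}.
Proof.
have Nn : mu.-negligible [set p; q : R].
  exists [set p; q]; split => //.
    by apply: measurableU; exact: measurable_set1.
  apply: countable_lebesgue_measure0; exact: finite_set_countable.
by apply: negligibleS Nn => x /=; apply: contra_notP => /not_orP.
Qed.

Lemma L1_meas f : L1 f -> measurable_fun setT f.
Proof. by move=> /integrableP[/measurable_EFinP]. Qed.

Lemma Int_EFin f : L1 f -> (Int f)%:E = (\int[mu]_x (f x)%:E)%E.
Proof. by move=> fi; rewrite /Int /Rintegral fineK//; exact: integrable_fin_num. Qed.

Lemma L1_dom f g : measurable_fun setT f -> L1 g -> (forall x, `|f x| <= g x) ->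
  L1 f.
Proof.
move=> mf gi fg; apply: le_integrable gi => //; first exact/measurable_EFinP.
by move=> x _ /=; rewrite lee_fin (le_trans (fg x))// ler_norm.
Qed.

Lemma L1_0 : L1 (fun=> 0).
Proof. exact: integrable0. Qed.

Lemma L1_D f g : L1 f -> L1 g -> L1 (fun x => f x + g x).
Proof. by move=> fi gi; have := integrableD measurableT fi gi. Qed.

Lemma L1_N f : L1 f -> L1 (fun x => - f x).
Proof. by move=> fi; have := integrableN fi. Qed.

Lemma L1_B f g : L1 f -> L1 g -> L1 (fun x => f x - g x).
Proof. by move=> fi gi; apply: L1_D => //; exact: L1_N. Qed.

Lemma L1_Z c f : L1 f -> L1 (fun x => c * f x).
Proof. by move=> fi; have := integrableZl measurableT c fi. Qed.

Lemma L1_abs f : L1 f -> L1 (fun x => `|f x|).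
Proof. by move=> fi; have := integrable_norm fi. Qed.

Lemma L1_M c f h : L1 f -> measurable_fun setT h -> (forall x, `|h x| <= c) ->
  L1 (fun x => f x * h x).
Proof.
move=> fi mh hc; apply: (@L1_dom _ (fun x => c * `|f x|)).
- by apply: measurable_funM => //; exact: L1_meas.
- by apply: L1_Z; exact: L1_abs.
- by move=> x; rewrite normrM mulrC ler_wpM2r.
Qed.

Lemma ge0_L1 f : measurable_fun setT f -> (forall x, 0 <= f x) ->
  (\int[mu]_x (f x)%:E < +oo)%E -> L1 f.
Proof.
move=> mf f0 foo; apply/integrableP; split; first exact/measurable_EFinP.
by under eq_integral do rewrite /= ger0_norm//.
Qed.

Lemma Int_D f g : L1 f -> L1 g -> Int (fun x => f x + g x) = Int f + Int g.
Proof. exact: RintegralD. Qed.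

Lemma Int_B f g : L1 f -> L1 g -> Int (fun x => f x - g x) = Int f - Int g.
Proof. exact: RintegralB. Qed.

Lemma Int_Z c f : L1 f -> Int (fun x => c * f x) = c * Int f.
Proof. exact: RintegralZl. Qed.

Lemma Int_0 : Int (fun=> 0) = 0.
Proof. by rewrite /Int Rintegral_cst// mul0r. Qed.

Lemma Int_N f : L1 f -> Int (fun x => - f x) = - Int f.
Proof.
move=> fi; rewrite -mulN1r -Int_Z//; congr Int.
by apply/funext => x; rewrite mulN1r.
Qed.

Lemma Int_ge0 f : (forall x, 0 <= f x) -> 0 <= Int f.
Proof. by move=> f0; apply: Rintegral_ge0. Qed.

Lemma Int_le f g : L1 f -> L1 g -> (forall x, f x <= g x) -> Int f <= Int g.
Proof. by move=> fi gi fg; apply: le_Rintegral. Qed.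

Lemma Int_abs f : L1 f -> `|Int f| <= Int (fun x => `|f x|).
Proof. exact: le_normr_Rintegral. Qed.

Lemma Int_abs_le f g : L1 f -> L1 g -> (forall x, `|f x| <= g x) ->
  `|Int f| <= Int g.
Proof.
move=> fi gi fg; apply: (le_trans (Int_abs fi)).
by apply: Int_le => //; exact: L1_abs.
Qed.

Lemma eq_Int f g : f =1 g -> Int f = Int g.
Proof. by move=> /funext ->. Qed.

Lemma eq_L1 f g : f =1 g -> L1 f -> L1 g.
Proof. by move=> /funext ->. Qed.

Lemma ge0_integral_shift c (f : R -> \bar R) : measurable_fun setT f ->
  (forall x, 0 <= f x)%E -> (\int[mu]_x f ((x : R) + c)%R = \int[mu]_x f x)%E.
Proof.
move=> mf f0.
have mshift : measurable_fun setT (fun x : R => (x + c : measurableTypeR R)).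
  apply: continuous_measurable_fun => x.
  by apply: cvgD; [exact: cvg_id|exact: cvg_cst].
pose sh : R -> measurableTypeR R := fun x : R => x + c.
transitivity (\int[pushforward mu sh]_x f x)%E.
  by rewrite ge0_integral_pushforward.
apply: eq_measure_integral => //= A mA _; apply/esym.
apply: lebesgue_measure_unique => // _ [[a b]] _ <-.
have sE : sh @^-1` `]a, b]%classic = `]a - c, b - c]%classic.
  by apply/seteqP; split=> x /=; rewrite !in_itv/= ltrBlDr lerBrDr.
rewrite [RHS](_ : _ = mu (sh @^-1` `]a, b]%classic)) // sE.
rewrite !lebesgue_measure_itv/= !lte_fin ltrD2r.
by case: ifP => // _; rewrite -!EFinB; congr EFin; ring.
Qed.

Lemma ge0_integral_opp (f : R -> \bar R) : measurable_fun setT f ->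
  (forall x, 0 <= f x)%E -> (\int[mu]_x f (- (x : R))%R = \int[mu]_x f x)%E.
Proof.
move=> mf f0.
transitivity (\int[pushforward mu (-%R : _ -> measurableTypeR R)]_x f x)%E.
  by rewrite ge0_integral_pushforward.
by apply: eq_measure_integral => //= A mA _; exact: lebesgue_measureN.
Qed.

Lemma measurable_shift c f : measurable_fun setT f ->
  measurable_fun setT (fun x : R => f (x + c)).
Proof.
move=> mf; apply: (measurableT_comp mf).
apply: continuous_measurable_fun => x.
by apply: cvgD; [exact: cvg_id|exact: cvg_cst].
Qed.

Lemma measurable_opp f : measurable_fun setT f ->
  measurable_fun setT (fun x : R => f (- x)).
Proof. by move=> mf; apply: (measurableT_comp mf); exact: oppr_measurable. Qed.

Lemma L1_shift c f : L1 f -> L1 (fun x => f (x + c)).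
Proof.
move=> fi; have mf := L1_meas fi; apply/integrableP; split.
  by apply/measurable_EFinP; apply: measurable_shift.
rewrite (@ge0_integral_shift c (fun x => `|(f x)%:E|%E)).
- by case/integrableP: fi.
- by apply: measurableT_comp => //; exact/measurable_EFinP.
- by [].
Qed.

Lemma L1_opp f : L1 f -> L1 (fun x => f (- x)).
Proof.
move=> fi; have mf := L1_meas fi; apply/integrableP; split.
  by apply/measurable_EFinP; apply: measurable_opp.
rewrite (@ge0_integral_opp (fun x => `|(f x)%:E|%E)).
- by case/integrableP: fi.
- by apply: measurableT_comp => //; exact/measurable_EFinP.
- by [].
Qed.

Lemma Int_posneg f : L1 f -> Int f = Int f^\+ - Int f^\-.
Proof.
move=> fi; have mf := L1_meas fi.
rewrite -Int_B; first by congr Int; rewrite -[LHS]funrposBneg.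
- by apply: integrable_funrpos.
- by apply: integrable_funrneg.
Qed.

Lemma Int_shift c f : L1 f -> Int (fun x => f (x + c)) = Int f.
Proof.
move=> fi; rewrite (Int_posneg fi) (Int_posneg (L1_shift c fi)).
congr (_ - _).
- rewrite /Int /Rintegral; congr fine.
  apply: (@ge0_integral_shift c (fun x => (f^\+ x)%:E)).
    by apply/measurable_EFinP; apply: measurable_funrpos; exact: L1_meas.
  by move=> x; rewrite lee_fin funrpos_ge0.
- rewrite /Int /Rintegral; congr fine.
  apply: (@ge0_integral_shift c (fun x => (f^\- x)%:E)).
    by apply/measurable_EFinP; apply: measurable_funrneg; exact: L1_meas.
  by move=> x; rewrite lee_fin funrneg_ge0.
Qed.

Lemma Int_opp f : L1 f -> Int (fun x => f (- x)) = Int f.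
Proof.
move=> fi; rewrite (Int_posneg fi) (Int_posneg (L1_opp fi)).
congr (_ - _).
- rewrite /Int /Rintegral; congr fine.
  apply: (@ge0_integral_opp (fun x => (f^\+ x)%:E)).
    by apply/measurable_EFinP; apply: measurable_funrpos; exact: L1_meas.
  by move=> x; rewrite lee_fin funrpos_ge0.
- rewrite /Int /Rintegral; congr fine.
  apply: (@ge0_integral_opp (fun x => (f^\- x)%:E)).
    by apply/measurable_EFinP; apply: measurable_funrneg; exact: L1_meas.
  by move=> x; rewrite lee_fin funrneg_ge0.
Qed.

Lemma Int_odd f : L1 f -> (forall x, f (- x) = - f x) -> Int f = 0.
Proof.
move=> fi fN; have := Int_opp fi; rewrite (eq_Int fN) Int_N//.
by move=> /eqP; rewrite -subr_eq0 => /eqP h; lra.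
Qed.

Lemma Int_dom_cvg (f_ : nat -> R -> R) f g :
    (forall n, measurable_fun setT (f_ n)) -> measurable_fun setT f -> L1 g ->
    {ae mu, forall x : R, f_ ^~ x @ \oo --> f x} ->
    (forall n x, `|f_ n x| <= g x) ->
  L1 f /\ Int (f_ n) @[n --> \oo] --> Int f.
Proof.
move=> mf_ mf gi ff fg.
have ff' : {ae mu, forall x, setT x -> (f_ n x)%:E @[n --> \oo] --> (f x)%:E}.
  by apply: ae_imp ff => x ffx _; apply: cvg_EFin; [exact: nearW|].
have fg' : {ae mu, forall x n, setT x -> (`|(f_ n x)%:E| <= (g x)%:E)%E}.
  by apply: aeW => x n _; rewrite /= lee_fin.
have [fi _ cf] := @dominated_convergence _ _ R mu setT measurableT
  (fun n x => (f_ n x)%:E) (EFin \o f) (EFin \o g)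
  (fun n => (measurable_EFinP _ _).2 (mf_ n)) ((measurable_EFinP _ _).2 mf)
  ff' gi fg'.
split=> //; apply: fine_cvg; rewrite fineK; last exact: integrable_fin_num.
exact: cf.
Qed.

(** Fubini's theorem, with joint integrability supplied by a bound on the
    inner integrals of the absolute value: in the applications that bound is
    an explicit function of the outer variable. *)
Lemma Fubini_real (F : R -> R -> R) (q : R -> R) :
    measurable_fun setT (fun z : R * R => F z.1 z.2) -> L1 q ->
    (forall x, L1 (F x)) -> (forall x, Int (fun y => `|F x y|) <= q x) ->
  [/\ L1 (fun x => Int (F x)), L1 (fun y => Int (F^~ y)) &
      Int (fun x => Int (F x)) = Int (fun y => Int (F^~ y))].
Proof.
move=> mF qi Fi Fq.
pose f (z : R * R) := (F z.1 z.2)%:E.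
have mf : measurable_fun setT f by exact/measurable_EFinP.
have fi : (mu \x mu)%E.-integrable setT f.
  apply: ((integrable12ltyP mu mu mf).2 _).
  apply: (@le_lt_trans _ _ (\int[mu]_x (q x)%:E)%E); last first.
    by rewrite -Int_EFin// ltry.
  apply: ge0_le_integral => //=.
  - by move=> x _; exact: integral_ge0.
  - apply: (@measurable_fun_fubini_tonelli_F _ _ _ _ _ mu (fun z => `|f z|%E)) => //.
    exact: measurableT_comp.
  - by apply/measurable_EFinP; exact: L1_meas.
  - move=> x _; apply: (@le_trans _ _ (Int (fun y => `|F x y|))%:E).
      by rewrite Int_EFin//; exact: L1_abs.
    by rewrite lee_fin.
have F1 : mu.-integrable setT (fun x => \int[mu]_y f (x, y))%E.
  exact: integrable_fubini_F.
have F2 : mu.-integrable setT (fun y => \int[mu]_x f (x, y))%E.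
  pose f' (z : R * R) := f (z.2, z.1).
  have mf' : measurable_fun setT f'.
    apply: (measurableT_comp mf).
    by apply/measurable_fun_pairP; split; [exact: measurable_snd|exact: measurable_fst].
  apply: (@integrable_fubini_F _ _ _ _ _ mu mu f').
  apply: ((integrable12ltyP mu mu mf').2 _).
  exact: ((integrable21ltyP mu mu mf).1 fi).
have L1fine (h : R -> \bar R) : mu.-integrable setT h -> L1 (fine \o h).
  move=> hi; have mh := measurable_int _ hi.
  apply: le_integrable hi => //.
    by apply/measurable_EFinP; exact: measurableT_comp.
  by move=> x _ /=; case: (h x) => //=; rewrite ?normr0 ?leey.
have Intfine (h : R -> \bar R) : mu.-integrable setT h ->
    Int (fine \o h) = fine (\int[mu]_x h x)%E.
  move=> hi; rewrite /Int /Rintegral; congr fine.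
  apply: ae_eq_integral => //.
  - by apply/measurable_EFinP; apply: L1_meas; exact: L1fine.
  - exact: measurable_int hi.
  - have := integrable_ae measurableT hi; apply: ae_imp => x hx _ /=.
    by rewrite fineK//; exact: hx.
split; [exact: (L1fine _ F1) | exact: (L1fine _ F2) |].
transitivity (fine (\int[mu]_x \int[mu]_y f (x, y))%E); first exact: (Intfine _ F1).
rewrite (Fubini fi); apply/esym; exact: (Intfine _ F2).
Qed.

End RealIntegrals.

(** * Exponential weights and the Poisson kernel *)
Section PoissonKernel.
Context {R : realType}.
Local Notation mu := (@lebesgue_measure R).
Implicit Types (a b f g : R -> R) (u x y z e c : R).

Lemma is_derive_scale c x : is_derive x 1 (fun u : R => c * u) c.
Proof.
have := is_deriveM (is_derive_cst c x 1) (is_derive_id x (1 : R)).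
by move=> h; apply: is_derive_eq; rewrite !scaler0 addr0 [_ *: _]mulr1.
Qed.

Lemma is_derive_comp_scale (h : R -> R) c x d : is_derive (c * x) 1 h d ->
  is_derive x 1 (fun u => h (c * u)) (c * d).
Proof.
move=> hd; have := @is_derive1_comp _ h (fun u => c * u) x d c hd (is_derive_scale c x).
by rewrite mulrC.
Qed.

Lemma continuous_scale c : continuous (fun x : R => c * x).
Proof. by move=> x; apply: cvgM; [exact: cvg_cst|exact: cvg_id]. Qed.

Lemma continuous_comp_scale (h : R -> R) c : continuous h ->
  continuous (fun x : R => h (c * x)).
Proof. by move=> ch x; apply: continuous_comp; [exact: continuous_scale|exact: ch]. Qed.

Lemma measurable_cosM u : measurable_fun setT (fun x : R => cos (x * u)).
Proof.
apply: (measurableT_comp (f := @cos R)); last exact: mulrr_measurable.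
by apply: continuous_measurable_fun; exact: continuous_cos.
Qed.

Lemma measurable_sinM u : measurable_fun setT (fun x : R => sin (x * u)).
Proof.
apply: (measurableT_comp (f := @sin R)); last exact: mulrr_measurable.
by apply: continuous_measurable_fun; exact: continuous_sin.
Qed.

Lemma L1_Mcos a u : L1 a -> L1 (fun x => a x * cos (x * u)).
Proof.
move=> ai; apply: (@L1_M _ 1) => //; first exact: measurable_cosM.
by move=> x; exact: cos_max.
Qed.

Lemma L1_Msin a u : L1 a -> L1 (fun x => a x * sin (x * u)).
Proof.
move=> ai; apply: (@L1_M _ 1) => //; first exact: measurable_sinM.
by move=> x; exact: sin_max.
Qed.

Definition pweight e u : R := expR (- e * `|u|).

Definition poisson e z : R := 2 * e / (e ^+ 2 + z ^+ 2).

Lemma continuous_pweight e : continuous (pweight e).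
Proof.
move=> x; apply: (@continuous_comp _ _ _ (Num.norm : R -> R) (fun v => expR (- e * v))).
  exact: norm_continuous.
exact/continuous_comp_scale/continuous_expR.
Qed.

Lemma pweight_ge0 e u : 0 <= pweight e u.
Proof. exact: expR_ge0. Qed.

Lemma cvg_expRNM e : 0 < e -> expR (- e * x) @[x --> +oo] --> (0 : R).
Proof.
move=> e0.
have h : e * x @[x --> +oo] --> +oo by apply: gt0_cvgMry => //; exact: cvg_id.
under eq_fun do rewrite mulNr.
exact: cvg_comp h (@cvgr_expR R).
Qed.

(** Improper integrals by the fundamental theorem of calculus. Nonnegativity
    makes the integral over a half-line the limit of the integrals over
    segments, and evenness doubles it. *)
Lemma Int_even_FTC f (F : R -> R) (l : R) : continuous f ->
    (forall x, 0 <= f x) -> (forall x, f (- x) = f x) ->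
    (forall x, 0 <= x -> is_derive x 1 F (f x)) -> F x @[x --> +oo] --> l ->
  L1 f /\ Int f = 2 * (l - F 0).
Proof.
move=> cf f0 fN dF Fl.
have half : (\int[mu]_(x in `[0%R, +oo[) (f x)%:E = l%:E - (F 0)%:E)%E.
  apply: ge0_continuous_FTC2y => //.
  - exact: continuous_subspaceT.
  - by move=> x /ltW x0; have h := dF x x0; exact: ex_derive.
  - apply: cvg_at_right_filter.
    have h := dF 0 (lexx _).
    by apply: differentiable_continuous; apply/derivable1_diffP; exact: ex_derive.
  - move=> x; rewrite in_itv/= andbT => /ltW x0; have h := dF x x0.
    by rewrite derive1E derive_val.
have full : (\int[mu]_x (f x)%:E = (2 * (l - F 0))%:E)%E.
  rewrite ge0_symfun_integralT//; last by move=> x /=; rewrite fN.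
  by rewrite -set_itvcy half -EFinB -EFinM.
split; last by rewrite /Int /Rintegral full.
by apply: ge0_L1 => //; [exact: continuous_measurable_fun | rewrite full ltry].
Qed.

Section fixed_e.
Variables (e z : R).
Hypothesis e0 : 0 < e.

Let D0 : e ^+ 2 + z ^+ 2 != 0.
Proof. by rewrite gt_eqF// ltr_pwDl ?sqr_ge0// exprn_gt0. Qed.

Let F u : R := expR (- e * u) *
  ((z * sin (z * u) - e * cos (z * u)) / (e ^+ 2 + z ^+ 2) - e^-1).

Let dF u : is_derive u 1 F (expR (- e * u) * (1 + cos (z * u))).
Proof.
have h1 : is_derive u 1 (fun u => expR (- e * u)) (- e * expR (- e * u)).
  exact: is_derive_comp_scale.
have h2 : is_derive u 1 (fun u => sin (z * u)) (z * cos (z * u)).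
  exact: is_derive_comp_scale.
have h3 : is_derive u 1 (fun u => cos (z * u)) (z * - sin (z * u)).
  exact: is_derive_comp_scale.
have e1 : e != 0 by rewrite gt_eqF.
pose k1 := z / (e ^+ 2 + z ^+ 2); pose k2 := - e / (e ^+ 2 + z ^+ 2).
have h4 := is_deriveD (is_deriveD (is_deriveZ k1 h2) (is_deriveZ k2 h3))
  (is_derive_cst (- e^-1) u 1).
have h := is_deriveM h1 h4.
have -> : F = (fun u : R => expR (- e * u)) *
   (k1 *: (fun u : R => sin (z * u)) + k2 *: (fun u : R => cos (z * u)) + cst (- e^-1)).
  apply/funext => v; rewrite /F /k1 /k2 !fctE /= /GRing.scale/=.
  by field; rewrite e1 D0.
apply: is_derive_eq; rewrite /k1 /k2 !fctE /= /GRing.scale/=.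
by field; rewrite e1 D0.
Qed.

Let Fy : F x @[x --> +oo] --> (0 : R).
Proof.
pose C := `|z| / (e ^+ 2 + z ^+ 2) + e / (e ^+ 2 + z ^+ 2) + e^-1.
have D1 : 0 < e ^+ 2 + z ^+ 2 by rewrite ltr_pwDl ?sqr_ge0// exprn_gt0.
have hC x : `|F x| <= expR (- e * x) * C.
  rewrite /F normrM (ger0_norm (expR_ge0 _)) ler_wpM2l ?expR_ge0// /C.
  apply: (le_trans (ler_normB _ _)).
  have Di : 0 <= (e ^+ 2 + z ^+ 2)^-1 by rewrite invr_ge0 ltW.
  have ei : 0 <= e^-1 by rewrite invr_ge0 ltW.
  rewrite (ger0_norm ei) lerD2r normrM (ger0_norm Di) -mulrDl ler_wpM2r//.
  apply: (le_trans (ler_normB _ _)); rewrite !normrM (gtr0_norm e0).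
  by apply: lerD; rewrite ler_piMr// ?sin_max ?cos_max// ltW.
have hE : expR (- e * x) * C @[x --> +oo] --> (0 : R).
  by rewrite -[X in _ --> X](mul0r C); apply: cvgM; [exact: cvg_expRNM|exact: cvg_cst].
apply/norm_cvg0P; apply: (@squeeze_cvgr _ _ _ _ (fun=> 0) (fun x => expR (- e * x) * C)).
- by apply: nearW => x; rewrite normr_ge0 hC.
- exact: cvg_cst.
- exact: hE.
Qed.

(** The transform of [pweight e] with 1 added to the cosine: the integrand
    becomes nonnegative, as the evaluation by primitives requires. The case $z=0$ then removes the constant. *)
Lemma Int_pweight_1Dcos : L1 (fun u => pweight e u * (1 + cos (z * u))) /\
  Int (fun u => pweight e u * (1 + cos (z * u))) = 2 / e + poisson e z.
Proof.
have [||||h1 h2] := @Int_even_FTC (fun u => pweight e u * (1 + cos (z * u))) F 0 _ _ _ _ Fy.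
- move=> x; apply: cvgM; first exact: continuous_pweight.
  by apply: cvgD; [exact: cvg_cst|exact/continuous_comp_scale/continuous_cos].
- move=> x; rewrite mulr_ge0 ?pweight_ge0//.
- by move=> x; rewrite /pweight normrN mulrN cosN.
- by move=> x x0; rewrite /pweight ger0_norm//; exact: dF.
split=> //; rewrite h2 /F !mulr0 sin0 cos0 expR0 /poisson.
have e1 : e != 0 by rewrite gt_eqF.
by field; rewrite e1 D0.
Qed.
End fixed_e.

Lemma pweight_L1 e : 0 < e -> L1 (pweight e) /\ Int (pweight e) = 2 / e.
Proof.
move=> e0; have [h1 h2] := Int_pweight_1Dcos 0 e0.
have E : (fun u => pweight e u * (1 + cos (0 * u))) = fun u => 2 * pweight e u.
  by apply/funext => u; rewrite mul0r cos0; ring.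
have hL : L1 (pweight e).
  apply: (@eq_L1 _ (fun u => 2^-1 * (2 * pweight e u))).
    by move=> u; rewrite mulrA mulVf ?mul1r.
  by apply: L1_Z; rewrite -E.
split=> //; move: h2; rewrite E Int_Z// /poisson expr0n/= addr0.
have e1 : e != 0 by rewrite gt_eqF.
have -> : 2 * e / e ^+ 2 = 2 / e by field.
by move=> h; lra.
Qed.

Lemma Int_pweight_cos e z : 0 < e ->
  Int (fun u => pweight e u * cos (z * u)) = poisson e z.
Proof.
move=> e0; have [h1 h2] := Int_pweight_1Dcos z e0.
have [k1 k2] := pweight_L1 e0.
have -> : Int (fun u => pweight e u * cos (z * u)) =
  Int (fun u => pweight e u * (1 + cos (z * u)) - pweight e u).
  by apply: eq_Int => u; ring.
by rewrite Int_B// h2 k2; ring.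
Qed.

Lemma poisson_ge0 e z : 0 < e -> 0 <= poisson e z.
Proof.
by move=> e0; rewrite divr_ge0 ?mulr_ge0 ?(ltW e0)// addr_ge0 ?sqr_ge0.
Qed.

Lemma poissonN e z : poisson e (- z) = poisson e z.
Proof. by rewrite /poisson sqrrN. Qed.

Lemma continuous_poisson e : 0 < e -> continuous (poisson e).
Proof.
move=> e0 x; apply: cvgM; first exact: cvg_cst.
apply: cvgV; first by rewrite gt_eqF// ltr_pwDl ?sqr_ge0// exprn_gt0.
by apply: cvgD; [exact: cvg_cst|exact: exprn_continuous].
Qed.

Lemma poisson_L1 e : 0 < e -> L1 (poisson e) /\ Int (poisson e) = 2 * pi.
Proof.
move=> e0; have e1 : e != 0 by rewrite gt_eqF.
have [||||| h1 h2] := @Int_even_FTC (poisson e) (fun z => 2 * atan (e^-1 * z)) pi.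
- exact: continuous_poisson.
- by move=> x; exact: poisson_ge0.
- exact: poissonN.
- move=> x x0.
  have h : is_derive x 1 (fun u => atan (e^-1 * u)) (e^-1 * (1 + (e^-1 * x) ^+ 2)^-1).
    exact: is_derive_comp_scale.
  have h' := is_deriveZ 2 h.
  apply: is_derive_eq; rewrite /poisson /GRing.scale/=.
  have : e ^+ 2 + x ^+ 2 != 0 by rewrite gt_eqF// ltr_pwDl ?sqr_ge0// exprn_gt0.
  by move=> D0; field; rewrite D0.
- have -> : pi = 2 * (pi / 2) :> R by field.
  apply: cvgM; first exact: cvg_cst.
  have h : e^-1 * x @[x --> +oo] --> +oo.
    by apply: gt0_cvgMry; [rewrite invr_gt0|exact: cvg_id].
  exact: cvg_comp h (@cvgy_atan R).
by split=> //; rewrite h2 mulr0 atan0 mulr0 subr0.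
Qed.

End PoissonKernel.

(* Unification must compare integrals by their integrands, not unfold them. *)
Opaque Int.

(** * Cosine and sine transforms *)
Section Transforms.
Context {R : realType}.
Local Notation mu := (@lebesgue_measure R).
Implicit Types (a b f g : R -> R) (u x y z e c M : R).

Definition cosT a u : R := Int (fun x => a x * cos (x * u)).
Definition sinT a u : R := Int (fun x => a x * sin (x * u)).

Lemma cosT_even a u : cosT a (- u) = cosT a u.
Proof. by apply: eq_Int => x; rewrite mulrN cosN. Qed.

Lemma sinT_odd a u : L1 a -> sinT a (- u) = - sinT a u.
Proof.
move=> ai; rewrite /sinT -Int_N; last exact: L1_Msin.
by apply: eq_Int => x; rewrite mulrN sinN mulrN.
Qed.

Lemma cosT_le a u : L1 a -> `|cosT a u| <= Int (fun x => `|a x|).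
Proof.
move=> ai; apply: Int_abs_le; [exact: L1_Mcos|exact: L1_abs|].
by move=> x; rewrite normrM ler_piMr// cos_max.
Qed.

Lemma sinT_le a u : L1 a -> `|sinT a u| <= Int (fun x => `|a x|).
Proof.
move=> ai; apply: Int_abs_le; [exact: L1_Msin|exact: L1_abs|].
by move=> x; rewrite normrM ler_piMr// sin_max.
Qed.

Lemma continuous_cosT a : L1 a -> continuous (cosT a).
Proof.
move=> ai u; apply/(@cvg_nbhsP _ R^o) => w wu.
apply: (Int_dom_cvg (g := fun x => `|a x|) _ _ _ _ _).2.
- by move=> n; apply: L1_meas; exact: L1_Mcos.
- by apply: L1_meas; exact: L1_Mcos.
- exact: L1_abs.
- apply: aeW => x; apply: cvgM; first exact: cvg_cst.
  apply: (cvg_comp (fun n => x * w n) cos); last exact: continuous_cos.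
  by apply: cvgM; [exact: cvg_cst|exact: wu].
- by move=> n x; rewrite normrM ler_piMr// cos_max.
Qed.

Lemma continuous_sinT a : L1 a -> continuous (sinT a).
Proof.
move=> ai u; apply/(@cvg_nbhsP _ R^o) => w wu.
apply: (Int_dom_cvg (g := fun x => `|a x|) _ _ _ _ _).2.
- by move=> n; apply: L1_meas; exact: L1_Msin.
- by apply: L1_meas; exact: L1_Msin.
- exact: L1_abs.
- apply: aeW => x; apply: cvgM; first exact: cvg_cst.
  apply: (cvg_comp (fun n => x * w n) sin); last exact: continuous_sin.
  by apply: cvgM; [exact: cvg_cst|exact: wu].
- by move=> n x; rewrite normrM ler_piMr// sin_max.
Qed.

Lemma measurable_cosT a : L1 a -> measurable_fun setT (cosT a).
Proof. by move=> ai; apply: continuous_measurable_fun; exact: continuous_cosT. Qed.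

Lemma measurable_sinT a : L1 a -> measurable_fun setT (sinT a).
Proof. by move=> ai; apply: continuous_measurable_fun; exact: continuous_sinT. Qed.

Lemma measurable_fst_comp f : measurable_fun setT f ->
  measurable_fun setT (fun z : R * R => f z.1).
Proof. by move=> mf; apply: (measurableT_comp mf); exact: measurable_fst. Qed.

Lemma measurable_snd_comp f : measurable_fun setT f ->
  measurable_fun setT (fun z : R * R => f z.2).
Proof. by move=> mf; apply: (measurableT_comp mf); exact: measurable_snd. Qed.

Lemma measurable_sub_comp f : measurable_fun setT f ->
  measurable_fun setT (fun z : R * R => f (z.1 - z.2)).
Proof.
move=> mf; apply: (measurableT_comp mf).
by apply: measurable_funB; [exact: measurable_fst|exact: measurable_snd].
Qed.

(** The form of Fubini's theorem used for transforms: two integrable weights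
    coupled by a bounded kernel. *)
Lemma Fubini_prod (p q : R -> R) (h : R -> R -> R) M : L1 p -> L1 q ->
    measurable_fun setT (fun z : R * R => h z.1 z.2) ->
    (forall x y, `|h x y| <= M) ->
  [/\ L1 (fun x => p x * Int (fun y => q y * h x y)),
      L1 (fun y => q y * Int (fun x => p x * h x y)) &
      Int (fun x => p x * Int (fun y => q y * h x y)) =
      Int (fun y => q y * Int (fun x => p x * h x y))].
Proof.
move=> pi qi mh hM.
have mh1 x : measurable_fun setT (h x) := measurable_fun_pair2 x mh.
have mh2 y : measurable_fun setT (h ^~ y) := measurable_fun_pair1 y mh.
have qh x : L1 (fun y => q y * h x y) by apply: (@L1_M _ M).
have ph y : L1 (fun x => p x * h x y) by apply: (@L1_M _ M).
have [||||h1 h2 h3] := @Fubini_real _ (fun x y => p x * (q y * h x y))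
  (fun x => M * Int (fun y => `|q y|) * `|p x|).
- apply: measurable_funM; first by apply: measurable_fst_comp; apply: L1_meas.
  by apply: measurable_funM mh; apply: measurable_snd_comp; exact: L1_meas.
- by apply: L1_Z; exact: L1_abs.
- by move=> x; apply: L1_Z.
- move=> x.
  have -> : Int (fun y => `|p x * (q y * h x y)|) =
      `|p x| * Int (fun y => `|q y * h x y|).
    by rewrite -Int_Z; [apply: eq_Int => y; rewrite normrM|exact: L1_abs].
  rewrite mulrC ler_wpM2r// -Int_Z; last exact: L1_abs.
  apply: Int_le; [exact: L1_abs|by apply: L1_Z; exact: L1_abs|].
  by move=> y; rewrite normrM mulrC ler_wpM2r.
have E1 : (fun x => Int (fun y => p x * (q y * h x y))) =
   (fun x => p x * Int (fun y => q y * h x y)).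
  by apply/funext => x; rewrite Int_Z.
have E2 : (fun y => Int (fun x => p x * (q y * h x y))) =
   (fun y => q y * Int (fun x => p x * h x y)).
  by apply/funext => y; rewrite -Int_Z//; apply: eq_Int => x; ring.
by split; rewrite -?E1 -?E2.
Qed.

Definition autocorr a z : R := Int (fun x => a x * a (x - z)).

Lemma measurable_cos_prod : measurable_fun setT (fun z : R * R => cos (z.1 * z.2)).
Proof.
apply: (measurableT_comp (f := @cos R)).
  by apply: continuous_measurable_fun; exact: continuous_cos.
by apply: measurable_funM; [exact: measurable_fst|exact: measurable_snd].
Qed.

Lemma measurable_sin_prod : measurable_fun setT (fun z : R * R => sin (z.1 * z.2)).
Proof.
apply: (measurableT_comp (f := @sin R)).
  by apply: continuous_measurable_fun; exact: continuous_sin.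
by apply: measurable_funM; [exact: measurable_fst|exact: measurable_snd].
Qed.

(** The real part of $e^{ixu}\hat a(u)$. *)
Lemma cosT_cos_sinT_sin a x u : L1 a ->
  cos (x * u) * cosT a u + sin (x * u) * sinT a u =
  Int (fun y => a y * cos ((x - y) * u)).
Proof.
move=> ai; rewrite /cosT /sinT -!Int_Z; [|exact: L1_Msin|exact: L1_Mcos].
rewrite -Int_D.
- by apply: eq_Int => y; rewrite mulrBl cosB; ring.
- by apply: L1_Z; exact: L1_Mcos.
- by apply: L1_Z; exact: L1_Msin.
Qed.

(** Writing $|\hat a(u)|^2=\iint a(x)a(y)\cos((x-y)u)$ and integrating in $u$
    first produces the Poisson kernel at $x-y$; the substitution $z=x-y$ then
    produces the autocorrelation. The weight makes all integrals absolutely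
    convergent. *)
Lemma poisson_mean a M e : L1 a -> (forall x, `|a x| <= M) -> 0 < e ->
  L1 (fun u => pweight e u * (cosT a u ^+ 2 + sinT a u ^+ 2)) /\
  Int (fun u => pweight e u * (cosT a u ^+ 2 + sinT a u ^+ 2)) =
  Int (fun z => poisson e z * autocorr a z).
Proof.
move=> ai aM e0; have [wi _] := pweight_L1 e0.
pose A := Int (fun x => `|a x|).
have mcT := measurable_cosT ai; have msT := measurable_sinT ai.
pose h u x := cos (x * u) * cosT a u + sin (x * u) * sinT a u.
have hE u : cosT a u ^+ 2 + sinT a u ^+ 2 = Int (fun x => a x * h u x).
  transitivity (cosT a u * Int (fun x => a x * cos (x * u)) +
                sinT a u * Int (fun x => a x * sin (x * u))).
    by rewrite !expr2.
  rewrite -!Int_Z; [|exact: L1_Msin|exact: L1_Mcos].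
  rewrite -Int_D.
  - by apply: eq_Int => y; rewrite /h; ring.
  - by apply: L1_Z; exact: L1_Mcos.
  - by apply: L1_Z; exact: L1_Msin.
have mcosp : measurable_fun setT (fun z : R * R => cos (z.2 * z.1)).
  by under eq_fun do rewrite mulrC; exact: measurable_cos_prod.
have msinp : measurable_fun setT (fun z : R * R => sin (z.2 * z.1)).
  by under eq_fun do rewrite mulrC; exact: measurable_sin_prod.
have [||h1 h2 h3] := @Fubini_prod (pweight e) a h (A + A) wi ai.
- apply: measurable_funD; apply: measurable_funM => //.
  + exact: (measurable_fst_comp mcT).
  + exact: (measurable_fst_comp msT).
- move=> u x; apply: (le_trans (ler_normD _ _)); rewrite !normrM.
  apply: lerD; rewrite -[leRHS]mul1r; apply: ler_pM => //.
  + exact: cos_max.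
  + exact: cosT_le.
  + exact: sin_max.
  + exact: sinT_le.
have E1 : (fun u => pweight e u * (cosT a u ^+ 2 + sinT a u ^+ 2)) =
  (fun u => pweight e u * Int (fun x => a x * h u x)).
  by apply/funext => u; rewrite hE.
rewrite E1; split; [exact: h1|rewrite h3].
have E2 x : Int (fun u => pweight e u * h u x) = Int (fun z => poisson e z * a (x - z)).
  have [||k1 k2 k3] := @Fubini_prod (pweight e) a (fun u y => cos ((x - y) * u)) 1 wi ai.
  - apply: (measurableT_comp (f := @cos R)).
      by apply: continuous_measurable_fun; exact: continuous_cos.
    apply: measurable_funM; last exact: measurable_fst.
    by apply: measurable_funB; [exact: measurable_cst|exact: measurable_snd].
  - by move=> u y; exact: cos_max.
  transitivity (Int (fun u => pweight e u * Int (fun y => a y * cos ((x - y) * u)))).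
    by apply: eq_Int => u; rewrite /h cosT_cos_sinT_sin.
  have Efun : (fun y => a y * Int (fun u => pweight e u * cos ((x - y) * u))) =
      (fun y => a y * poisson e (x - y)).
    by apply/funext => y; rewrite (Int_pweight_cos (x - y) e0).
  rewrite k3 Efun; rewrite Efun in k2.
  have Pa2 : L1 (fun y => a (y + x) * poisson e (- y)).
    apply: (@eq_L1 _ _ _ _ (L1_shift x k2)) => y.
    by congr (_ * poisson e _); ring.
  transitivity (Int (fun y => a (y + x) * poisson e (- y))).
    rewrite -(Int_shift x k2); apply: eq_Int => y.
    by congr (_ * poisson e _); ring.
  rewrite -(Int_opp Pa2); apply: eq_Int => y.
  by rewrite opprK mulrC addrC.
transitivity (Int (fun x => a x * Int (fun z => poisson e z * a (x - z)))).
  by apply: eq_Int => x; rewrite E2.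
have [Pi _] := poisson_L1 e0.
have ma := L1_meas ai.
have [||k1 k2 k3] := @Fubini_prod a (poisson e) (fun x z => a (x - z)) M ai Pi.
- exact: measurable_sub_comp.
- by move=> x y.
by rewrite k3; apply: eq_Int => z.
Qed.

End Transforms.

(** * Autocorrelation and the Poisson approximate identity *)
Section ApproximateIdentity.
Context {R : realType}.
Local Notation mu := (@lebesgue_measure R).
Implicit Types (a b f g : R -> R) (u x y z e c M : R).

(** A function continuous on a segment and extended by 0 is continuous off the
    two endpoints. This is enough continuity for dominated convergence of its
    translates. *)
Lemma approx_bounded_integrable a eta : L1 a -> 0 < eta ->
  exists g : R -> R, [/\ L1 g, Int (fun x => `|a x - g x|) <= eta,
    exists M, forall x, `|g x| <= M &
    {ae mu, forall x : R, {for x, continuous g}}].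
Proof.
move=> ai eta0; have ma := L1_meas ai.
pose aN (n : nat) x := a x * \1_(`[- n%:R, n%:R]%classic) x.
have maN n : measurable_fun setT (aN n).
  by apply: measurable_funM => //; exact: measurable_indic.
have aNle n x : `|a x - aN n x| <= `|a x|.
  rewrite /aN indicE; case: (_ \in _); first by rewrite mulr1 subrr normr0.
  by rewrite mulr0 subr0.
have [_ cN] : L1 (fun=> 0 : R) /\ Int (fun x => `|a x - aN n x|) @[n --> \oo] --> Int (fun=> 0 : R).
  apply: (Int_dom_cvg (g := fun x => `|a x|)) => //.
  - by move=> n; apply: measurableT_comp => //; exact: measurable_funB.
  - exact: L1_abs.
  - apply: aeW => x; apply: cvg_near_cst; near=> n.
    rewrite /aN indicE mem_set ?mulr1 ?subrr ?normr0//= in_itv/= -ler_norml.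
    near: n; exact: nbhs_infty_ger.
  - by move=> n x; rewrite normr_id.
rewrite Int_0 in cN.
have eta2 : 0 < eta / 2 by rewrite divr_gt0.
have [N _ hN] := (cvgrPdist_lt _ _).1 cN (eta / 2) eta2.
have {hN} := hN N (leqnn N); rewrite /= sub0r normrN => hN.
pose E : set R := `[- N%:R, N%:R]%classic.
have mE : measurable (E : set (measurableTypeR R)) by exact: measurable_itv.
have Efin : (mu E < +oo)%E by rewrite /E lebesgue_measure_itv/=; case: ifP => _; rewrite ltry.
have aE : mu.-integrable E (EFin \o a) by apply: integrableS ai.
have [g_ [cg ig cvg_g]] := approximation_continuous_integrable mE Efin aE.
have iD n : L1 (fun x => (a x - g_ n x) * \1_E x).
  have h : mu.-integrable E (EFin \o (fun x => a x - g_ n x)) by have := integrableB mE aE (ig n).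
  have h2 := (integrable_mkcond _ mE).1 h.
  apply: eq_integrable h2 => // x _.
  rewrite /= patchE indicE; case: ifP => _ /=; by rewrite ?mulr1 ?mulr0.
have cvg_g2 : Int (fun x => `|(a x - g_ n x) * \1_E x|) @[n --> \oo] --> (0 : R).
  apply: fine_cvg.
  rewrite (_ : (fun n => _) = (fun n => \int[mu]_(z in E) `|(a z - g_ n z)%:E|)%E) //.
  apply/funext => n; rewrite [RHS]integral_mkcond; apply: eq_integral => x _.
  rewrite patchE indicE; case: ifP => _ /=; by rewrite ?mulr1 ?mulr0 ?normr0.
have [n _ hn] := (cvgrPdist_lt _ _).1 cvg_g2 (eta / 2) eta2.
have {hn} := hn n (leqnn n); rewrite /= sub0r normrN => hn.
pose g x := g_ n x * \1_E x.
have gi : L1 g.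
  have h2 := (integrable_mkcond _ mE).1 (ig n).
  apply: eq_integrable h2 => // x _.
  rewrite /g /= patchE indicE; case: ifP => _ /=; by rewrite ?mulr1 ?mulr0.
exists g; split => //.
- have h1 : L1 (fun x => `|a x - aN N x|).
    apply/L1_abs/L1_B => //; apply: (@L1_M _ 1) => //.
    by move=> x; rewrite indicE; case: (_ \in _); rewrite ?normr1 ?normr0.
  have h2 := L1_abs (iD n).
  apply: (@le_trans _ _ (Int (fun x => `|a x - aN N x| + `|(a x - g_ n x) * \1_E x|))).
    apply: Int_le; [by apply/L1_abs/L1_B | exact: L1_D |].
    move=> x; apply: le_trans (ler_normD _ _); rewrite le_eqVlt; apply/orP; left.
    by apply/eqP; congr (`| _ |); rewrite /g /aN; ring.
  rewrite Int_D//.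
  have p1 := ler_norm (Int (fun x => `|a x - aN N x|)).
  have p2 := ler_norm (Int (fun x => `|(a x - g_ n x) * \1_E x|)).
  by lra.
- have [M [_ hM]] : bounded_set (g_ n @` E).
    apply: compact_bounded; apply: continuous_compact; last exact: segment_compact.
    exact/continuous_subspaceT/cg.
  exists (`|M| + 1) => x; rewrite /g indicE.
  have [xE|xE] := boolP (x \in E); last by rewrite mulr0 normr0 addr_ge0.
  rewrite mulr1; apply: hM; first by have := ler_norm M; lra.
  by exists x => //; exact: set_mem.
- have near_cont (h : R -> R) (x : R) : continuous h ->
      (\forall y \near x, g y = h y) -> {for x, continuous g}.
    move=> ch hg; rewrite /prop_for /continuous_at (nbhs_singleton hg).
    apply: cvg_trans (ch x); apply: near_eq_cvg.
    by apply: filterS hg => y ->.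
  apply: ae_imp (ae_neq2 (- N%:R) N%:R) => x [x1 x2].
  have [xN|xN] := ltP x (- N%:R).
    apply: (near_cont (fun=> 0)); first by move=> y; exact: cvg_cst.
    have /near_in_itvNyo : x \in `]-oo, (- N%:R)[ by rewrite in_itv.
    apply: filterS => y; rewrite in_itv/= => yN.
    by rewrite /g indicE memNset ?mulr0//= /E/= in_itv/= leNgt yN.
  have [xN'|xN'] := ltP N%:R x.
    apply: (near_cont (fun=> 0)); first by move=> y; exact: cvg_cst.
    have /near_in_itvoy : x \in `]N%:R, +oo[ by rewrite in_itv/= andbT.
    apply: filterS => y; rewrite in_itv/= andbT => yN.
    by rewrite /g indicE memNset ?mulr0//= /E/= in_itv/= (leNgt y) yN andbF.
  have /near_in_itvoo : x \in `](- N%:R), N%:R[.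
    by rewrite in_itv/= !lt_neqAle xN xN' !andbT eq_sym; apply/andP; split; apply/eqP.
  move=> nx; apply: (near_cont (g_ n)) => //.
  apply: filterS nx => y; rewrite in_itv/= => /andP[/ltW y1 /ltW y2].
  by rewrite /g indicE mem_set ?mulr1//= /E/= in_itv/= y1 y2.
Unshelve. all: end_near.
Qed.

(** Continuity of translation. The shift is moved from [a] to the
    approximation $g$, because dominated convergence applies to the translates
    of $g$; the two replacements cost $M\|a-g\|_1$ each. *)
Lemma autocorr_cont a M : L1 a -> (forall x, `|a x| <= M) ->
  {for 0, continuous (autocorr a)}.
Proof.
move=> ai aM; have ma := L1_meas ai.
have M0 : 0 <= M by apply: le_trans (aM 0).
apply/(@cvg_nbhsP _ R^o) => w w0; apply/cvgrPdist_le => eps eps0.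
(* The replacements of a by g cost M eta each, the translation of g costs eta. *)
pose eta := eps / (4 * M + 2).
have D0 : 0 < 4 * M + 2 by lra.
have eta0 : 0 < eta by rewrite divr_gt0.
have [g [gi ag [B gB] cg]] := approx_bounded_integrable ai eta0.
have mg := L1_meas gi.
have B0 : 0 <= B by apply: le_trans (gB 0).
have aas z : L1 (fun x => a x * a (x - z)).
  by apply: (@L1_M _ M) => //; apply: measurable_shift.
have ags z : L1 (fun x => a x * g (x + z)).
  by apply: (@L1_M _ B) => //; apply: measurable_shift.
have gas z : L1 (fun x => g x * a (x - z)).
  by apply: (@L1_M _ M) => //; apply: measurable_shift.
have gasE z : Int (fun x => g x * a (x - z)) = Int (fun x => a x * g (x + z)).
  rewrite -(Int_shift z (gas z)); apply: eq_Int => x.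
  by rewrite addrK mulrC.
have dag z : `|autocorr a z - Int (fun x => a x * g (x + z))| <= M * eta.
  rewrite -gasE /autocorr -Int_B//.
  have h : L1 (fun x => M * `|a x - g x|) by apply/L1_Z/L1_abs/L1_B.
  apply: le_trans (_ : Int (fun x => M * `|a x - g x|) <= _).
    apply: Int_abs_le => //; first exact: L1_B.
    move=> x; rewrite -mulrBl normrM mulrC ler_wpM2r//.
  by rewrite Int_Z ?ler_wpM2l//; apply/L1_abs/L1_B.
have cG : Int (fun x => a x * g (x + w n)) @[n --> \oo] --> Int (fun x => a x * g (x + 0)).
  apply: (Int_dom_cvg (g := fun x => B * `|a x|) _ _ _ _ _).2.
  - by move=> n; exact: L1_meas.
  - exact: L1_meas.
  - by apply/L1_Z/L1_abs.
  - apply: ae_imp cg => x gx; apply: cvgM; first exact: cvg_cst.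
    have xw : x + w n @[n --> \oo] --> x + 0 by apply: cvgD; [exact: cvg_cst|].
    apply: (cvg_comp (fun n => x + w n) g xw).
    by rewrite addr0; exact: gx.
  - by move=> n x; rewrite normrM mulrC ler_wpM2r.
move/cvgrPdist_le : cG => /(_ eta eta0); apply: filterS => n hn.
have d0 := dag 0; have dn := dag (w n).
have E : eta * (4 * M + 2) = eps by rewrite /eta divfK// gt_eqF.
have E' : eps = 4 * (M * eta) + 2 * eta by rewrite -E; ring.
move: d0 dn hn; rewrite !ler_norml => /andP[p1 p2] /andP[q1 q2] /andP[r1 r2].
have Meta : 0 <= M * eta by rewrite mulr_ge0 // ltW.
rewrite -/(autocorr a (w n)); by apply/andP; split; lra.
Qed.

(** Close to 0 the continuity of [f] makes the error small. At distance at
    least $d$ one has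
    $P_\varepsilon(z)\le\varepsilon(1+d^{-2})P_1(z)$, an integrable function
    with a factor tending to 0. *)
Lemma poisson_approx_identity f M : measurable_fun setT f ->
    (forall x, `|f x| <= M) -> {for 0, continuous f} ->
  Int (fun z => poisson n.+1%:R^-1 z * f z) @[n --> \oo] --> 2 * pi * f 0.
Proof.
move=> mf fM cf; apply/cvgrPdist_le => eps eps0.
have M0 : 0 <= M by apply: le_trans (fM 0).
have pi0 := pi_gt0 R.
pose eta := eps / (4 * pi); have eta0 : 0 < eta by rewrite divr_gt0// mulr_gt0.
have /cvgrPdist_le/(_ _ eta0)/nbhs_ballP[d /= d0 hd] := cf.
pose C := 2 * M * (1 + d ^- 2) * (2 * pi).
have n0 (n : nat) : 0 < n.+1%:R^-1 :> R by rewrite invr_gt0.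
have PL n := poisson_L1 (n0 n).
have Pf n c : L1 (fun z => poisson n.+1%:R^-1 z * (f z - c)).
  apply: (@L1_M _ (M + `|c|)); first exact: (PL n).1.
  - by apply: measurable_funB.
  - by move=> x; apply: (le_trans (ler_normB _ _)); rewrite lerD2r.
have bound n : `|2 * pi * f 0 - Int (fun z => poisson n.+1%:R^-1 z * f z)| <=
    eta * (2 * pi) + n.+1%:R^-1 * C.
  have -> : 2 * pi * f 0 - Int (fun z => poisson n.+1%:R^-1 z * f z) =
      - Int (fun z => poisson n.+1%:R^-1 z * (f z - f 0)).
    have -> : 2 * pi * f 0 = Int (fun z => f 0 * poisson n.+1%:R^-1 z).
      by rewrite Int_Z ?(PL n).2 1?mulrC//; exact: (PL n).1.
    have Pf0 := Pf n 0.
    rewrite -Int_B; last first.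
      by apply: eq_L1 Pf0 => z; rewrite subr0.
      by apply: L1_Z; exact: (PL n).1.
    by rewrite -Int_N//; apply: eq_Int => z; ring.
  rewrite normrN.
  pose G z := eta * poisson n.+1%:R^-1 z + n.+1%:R^-1 * (2 * M * (1 + d ^- 2)) * poisson 1 z.
  have [P1 P2] := poisson_L1 (ltr01 : 0 < 1 :> R).
  have Gi : L1 G by apply: L1_D; apply: L1_Z => //; exact: (PL n).1.
  have -> : eta * (2 * pi) + n.+1%:R^-1 * C = Int G.
    have Pn := (PL n).1.
    rewrite /G Int_D; [|exact: L1_Z|exact: L1_Z].
    by rewrite (Int_Z _ Pn) (Int_Z _ P1) (PL n).2 P2 /C; ring.
  apply: Int_abs_le => // z; rewrite normrM ger0_norm; last exact: poisson_ge0.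
  have c0 : 0 <= n.+1%:R^-1 * (2 * M * (1 + d ^- 2)) :> R.
    by rewrite !mulr_ge0 ?(ltW (n0 n))// addr_ge0// invr_ge0 sqr_ge0.
  have [zd|zd] := ltP `|z| d.
    apply: (@le_trans _ _ (eta * poisson n.+1%:R^-1 z)); last first.
      by rewrite lerDl mulr_ge0// poisson_ge0.
    rewrite mulrC ler_wpM2r ?poisson_ge0// distrC; apply: hd.
    by rewrite /ball/= sub0r normrN.
  apply: (@le_trans _ _ (n.+1%:R^-1 * (2 * M * (1 + d ^- 2)) * poisson 1 z)); last first.
    by rewrite lerDr mulr_ge0 ?poisson_ge0// ltW.
  have z2 : d ^+ 2 <= z ^+ 2 by rewrite -(real_normK (num_real z)) lerXn2r ?nnegrE ?(ltW d0).
  have d2 : 0 < d ^+ 2 by rewrite exprn_gt0.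
  have zz : 0 < z ^+ 2 by apply: lt_le_trans z2.
  have h1 : poisson n.+1%:R^-1 z <= n.+1%:R^-1 * ((1 + d ^- 2) * poisson 1 z).
    rewrite /poisson expr1n mulr1.
    rewrite [leRHS](_ : _ = 2 * n.+1%:R^-1 * ((1 + d ^- 2) / (1 + z ^+ 2))); last by ring.
    rewrite ler_wpM2l// ?mulr_ge0 ?(ltW (n0 n))//.
    apply: (@le_trans _ _ (z ^- 2)).
      by rewrite lef_pV2 ?posrE ?ltr_wpDl ?sqr_ge0// lerDr sqr_ge0.
    rewrite ler_pdivlMr ?ltr_pwDl ?sqr_ge0// mulrDr mulr1 mulVf ?gt_eqF// addrC lerD2l.
    by rewrite lef_pV2 ?posrE.
  have h2 : `|f z - f 0| <= 2 * M.
    by apply: (le_trans (ler_normB _ _)); have := fM z; have := fM 0; lra.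
  rewrite [leRHS](_ : _ = n.+1%:R^-1 * ((1 + d ^- 2) * poisson 1 z) * (2 * M)); last by ring.
  by apply: ler_pM => //; exact: poisson_ge0.
have C0 : n.+1%:R^-1 * C @[n --> \oo] --> (0 : R).
  have h : (n.+1%:R^-1 : R) @[n --> \oo] --> (0 : R) by have := @cvg_harmonic R.
  by rewrite -[X in _ --> X](mul0r C); apply: cvgM; [exact: h|exact: cvg_cst].
have eps2 : 0 < eps / 2 by rewrite divr_gt0.
move/cvgrPdist_le : C0 => /(_ _ eps2); apply: filterS => n.
rewrite sub0r normrN => hn; apply: (le_trans (bound n)).
have -> : eta * (2 * pi) = eps / 2.
  rewrite /eta; move: (pi : R) pi0 => p p0.
  by field; exact: lt0r_neq0.
apply: (le_trans (lerD (lexx _) (le_trans (ler_norm _) hn))); lra.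
Qed.

End ApproximateIdentity.

(** * Plancherel, Parseval and inversion in the mean *)
Section PlancherelTheorem.
Context {R : realType}.
Local Notation mu := (@lebesgue_measure R).
Implicit Types (a b f g : R -> R) (u x y z e c M : R).

(** Bounded and integrable: such functions are square integrable and have
    continuous transforms, and the exponentially weighted data and solutions
    are of this kind. *)
Definition L1b a : Prop := L1 a /\ exists M, forall x, `|a x| <= M.

Lemma L1b_D a b : L1b a -> L1b b -> L1b (fun x => a x + b x).
Proof.
move=> [ai [M aM]] [bi [N bN]]; split; first exact: L1_D.
by exists (M + N) => x; rewrite (le_trans (ler_normD _ _))// lerD.
Qed.

Lemma L1b_mul a b : L1b a -> L1b b -> L1 (fun x => a x * b x).
Proof.
by move=> [ai _] [bi [N bN]]; apply: (@L1_M _ N) => //; exact: L1_meas.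
Qed.

(** Fubini yields the measurability of the autocorrelation once it is
    multiplied by an integrable weight; the Poisson kernel, which vanishes
    nowhere, can be divided out afterwards. *)
Lemma measurable_autocorr a : L1b a -> measurable_fun setT (autocorr a).
Proof.
move=> [ai [M aM]]; have [Pi _] := @poisson_L1 R 1 ltr01.
have ma := L1_meas ai.
have [||k1 k2 k3] := @Fubini_prod _ a (poisson 1) (fun x z => a (x - z)) M ai Pi.
- exact: measurable_sub_comp.
- by move=> x y.
have D z : 1 + z ^+ 2 != 0 by rewrite gt_eqF// ltr_pwDl ?sqr_ge0.
rewrite (_ : autocorr a = fun z => (poisson 1 z * autocorr a z) * (2^-1 * (1 + z ^+ 2))).
  apply: measurable_funM; first exact: L1_meas k2.
  by apply: measurable_funM => //; apply: measurable_funD => //; exact: measurable_funX.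
apply/funext => z; rewrite /poisson expr1n mulr1.
by move: (autocorr a z) => A; field; exact: D.
Qed.

(** Both sides of [poisson_mean] converge as $\varepsilon=1/(n+1)\to 0$: the
    left one by monotone convergence, the right one to $2\pi$ times the
    autocorrelation at 0, which is the square norm. *)
Theorem plancherel a : L1b a ->
  L1 (fun u => cosT a u ^+ 2 + sinT a u ^+ 2) /\
  Int (fun u => cosT a u ^+ 2 + sinT a u ^+ 2) = 2 * pi * Int (fun x => a x ^+ 2).
Proof.
move=> ab; have [ai [M aM]] := ab.
pose S u := cosT a u ^+ 2 + sinT a u ^+ 2.
have S0 u : 0 <= S u by rewrite addr_ge0 ?sqr_ge0.
have mS : measurable_fun setT S.
  by apply: measurable_funD; apply: measurable_funX;
    [exact: measurable_cosT|exact: measurable_sinT].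
have n0 (n : nat) : 0 < n.+1%:R^-1 :> R by rewrite invr_gt0.
pose g n u := pweight n.+1%:R^-1 u * S u.
have gL n := poisson_mean ai aM (n0 n).
have mg n : measurable_fun setT (g n) by exact: L1_meas (gL n).1.
have gS u : g n u @[n --> \oo] --> S u.
  have h : (n.+1%:R^-1 : R) @[n --> \oo] --> (0 : R) by have := @cvg_harmonic R.
  have h2 : expR (- (n.+1%:R^-1) * `|u|) @[n --> \oo] --> expR (- 0 * `|u|).
    have h3 : - (n.+1%:R^-1) * `|u| @[n --> \oo] --> - 0 * `|u|.
      by apply: cvgM; [exact: cvgN|exact: cvg_cst].
    exact: cvg_comp h3 (@continuous_expR R _).
  by have := cvgM h2 (@cvg_cst _ (S u) _ _ _); rewrite oppr0 mul0r expR0 mul1r; apply.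
have nd u : nondecreasing_seq (g^~ u).
  move=> m n mn; rewrite ler_wpM2r// ler_expR !mulNr lerN2 ler_wpM2r//.
  by rewrite lef_pV2 ?posrE// ler_nat ltnS.
have c1 : (\int[mu]_u (g n u)%:E)%E @[n --> \oo] --> (\int[mu]_u (S u)%:E)%E.
  have := @cvg_monotone_convergence _ _ R mu setT measurableT (fun n u => (g n u)%:E).
  rewrite (_ : (fun u => limn (fun n => (g n u)%:E)) = EFin \o S); last first.
    apply/funext => u; apply/cvg_lim => //; apply: cvg_EFin; [exact: nearW|exact: gS].
  apply.
  - by move=> n; apply/measurable_EFinP; exact: mg.
  - by move=> n x _; rewrite lee_fin mulr_ge0 ?pweight_ge0.
  - by move=> x _ m n mn; rewrite lee_fin; exact: nd.
have A0 : autocorr a 0 = Int (fun x => a x ^+ 2).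
  by apply: eq_Int => x; rewrite subr0 expr2.
have c2 : (\int[mu]_u (g n u)%:E)%E @[n --> \oo] --> (2 * pi * autocorr a 0)%:E.
  rewrite (_ : (fun n => _) = EFin \o (fun n => Int (fun z => poisson n.+1%:R^-1 z * autocorr a z))); last first.
    by apply/funext => n /=; rewrite -(gL n).2 Int_EFin//; exact: (gL n).1.
  apply: cvg_EFin; first exact: nearW.
  apply: (poisson_approx_identity (M := M * Int (fun x => `|a x|))).
  - exact: measurable_autocorr.
  - move=> z; have aa : L1 (fun x => a x * a (x - z)).
      by apply: (@L1_M _ M) => //; apply: measurable_shift; exact: L1_meas.
    rewrite -Int_Z; last exact: L1_abs.
    apply: Int_abs_le => //; first by apply/L1_Z/L1_abs.
    by move=> x; rewrite normrM mulrC ler_wpM2r.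
  - exact: autocorr_cont ai aM.
have E : (\int[mu]_u (S u)%:E = (2 * pi * autocorr a 0)%:E)%E by exact: cvg_unique c1 c2.
have SL : L1 S by apply: ge0_L1 => //; rewrite E ltry.
split=> //; have := Int_EFin SL; rewrite E A0 => -[]; exact.
Qed.

Lemma cosT_D a b u : L1 a -> L1 b ->
  cosT (fun x => a x + b x) u = cosT a u + cosT b u.
Proof.
move=> ai bi; rewrite /cosT -Int_D; [|exact: L1_Mcos|exact: L1_Mcos].
by apply: eq_Int => x; rewrite mulrDl.
Qed.

Lemma sinT_D a b u : L1 a -> L1 b ->
  sinT (fun x => a x + b x) u = sinT a u + sinT b u.
Proof.
move=> ai bi; rewrite /sinT -Int_D; [|exact: L1_Msin|exact: L1_Msin].
by apply: eq_Int => x; rewrite mulrDl.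
Qed.

(** Products of square integrable functions are integrable: $|fg|\le f^2+g^2$. *)
Lemma L1_sqr_mul f g h : measurable_fun setT f -> measurable_fun setT g ->
  L1 h -> (forall x, f x ^+ 2 + g x ^+ 2 <= h x) -> L1 (fun x => f x * g x).
Proof.
move=> mf mg hi fgh; apply: (L1_dom _ hi); first exact: measurable_funM.
move=> x; apply: le_trans (fgh x); rewrite ler_norml.
have := sqr_ge0 (f x + g x); have := sqr_ge0 (f x - g x).
by rewrite !expr2 => h1 h2; apply/andP; split; nra.
Qed.

Lemma L1b_sqr a : L1b a -> L1 (fun x => a x ^+ 2).
Proof. by move=> ab; apply: eq_L1 (L1b_mul ab ab) => x; rewrite expr2. Qed.

(** Polarization: [plancherel] for $a+b$, minus the cases of $a$ and $b$. *)
Theorem parseval a b : L1b a -> L1b b ->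
  [/\ L1 (fun u => cosT a u * cosT b u), L1 (fun u => sinT a u * sinT b u),
      L1 (fun u => cosT a u * sinT b u) &
  Int (fun u => cosT a u * cosT b u) + Int (fun u => sinT a u * sinT b u) =
    2 * pi * Int (fun x => a x * b x)].
Proof.
move=> ab bb; have [ai _] := ab; have [bi _] := bb.
have [Pa Ea] := plancherel ab; have [Pb Eb] := plancherel bb.
have [Pc Ec] := plancherel (L1b_D ab bb).
have mca := measurable_cosT ai; have mcb := measurable_cosT bi.
have msa := measurable_sinT ai; have msb := measurable_sinT bi.
have Pab := L1_D Pa Pb.
have Lcc : L1 (fun u => cosT a u * cosT b u).
  apply: (L1_sqr_mul mca mcb Pab) => u.
  by rewrite lerD// lerDl sqr_ge0.
have Lss : L1 (fun u => sinT a u * sinT b u).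
  apply: (L1_sqr_mul msa msb Pab) => u.
  by rewrite lerD// lerDr sqr_ge0.
have Lcs : L1 (fun u => cosT a u * sinT b u).
  apply: (L1_sqr_mul mca msb Pab) => u.
  by rewrite lerD// ?lerDl ?lerDr sqr_ge0.
split => //.
have e1 : Int (fun u => cosT (fun x => a x + b x) u ^+ 2 + sinT (fun x => a x + b x) u ^+ 2) =
  Int (fun u => cosT a u ^+ 2 + sinT a u ^+ 2) + Int (fun u => cosT b u ^+ 2 + sinT b u ^+ 2)
  + 2 * (Int (fun u => cosT a u * cosT b u) + Int (fun u => sinT a u * sinT b u)).
  have L12 := L1_D Lcc Lss.
  rewrite -(Int_D Pa Pb) -(Int_D Lcc Lss) -(Int_Z _ L12) -Int_D//; last exact: L1_Z.
  by apply: eq_Int => u; rewrite cosT_D// sinT_D//; ring.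
have e2 : Int (fun x => (a x + b x) ^+ 2) =
   Int (fun x => a x ^+ 2) + Int (fun x => b x ^+ 2) + 2 * Int (fun x => a x * b x).
  have a2 := L1b_sqr ab; have b2 := L1b_sqr bb; have ab2 := L1b_mul ab bb.
  rewrite -(Int_D a2 b2) -(Int_Z _ ab2) -Int_D; [|exact: L1_D|exact: L1_Z].
  by apply: eq_Int => x; ring.
have cancel (p A B X Y : R) : p * A + p * B + 2 * X = p * (A + B + 2 * Y) -> X = p * Y.
  by clear; move=> h; lra.
by move: Ec; rewrite e1 e2 Ea Eb; exact: cancel.
Qed.

(** This is the imaginary part of Parseval's identity for real functions; the
    integrand is odd. *)
Lemma parseval_odd a b : L1b a -> L1b b -> Int (fun u => cosT a u * sinT b u) = 0.
Proof.
move=> ab bb; have [_ _ h _] := parseval ab bb.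
by apply: Int_odd => // u; rewrite cosT_even sinT_odd ?mulrN//; exact: bb.1.
Qed.

(** ** Inversion in the mean *)

Definition window r f x : R := f x * \1_(`[- r, r]%classic) x.

(** The inversion integral of the real function [a] restricted to
    frequencies in $[-r,r]$; its sine and cosine cross terms are odd in the
    frequency and drop out. *)
Definition invT a r x : R :=
  (2 * pi)^-1 * (cosT (window r (cosT a)) x + sinT (window r (sinT a)) x).

Lemma L1_window r f : measurable_fun setT f -> (exists M, forall x, `|f x| <= M) -> L1b (window r f).
Proof.
move=> mf [M fM]; split; last first.
  exists M => x; rewrite /window indicE; case: (_ \in _); first by rewrite mulr1.
  by rewrite mulr0 normr0; apply: le_trans (fM x).
have h : L1 (\1_(`[- r, r]%classic) : R -> R) by exact: integrable_indic_itv.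
rewrite (_ : window r f = fun x => \1_(`[- r, r]%classic) x * f x).
  exact: (L1_M h mf fM).
by apply/funext => x; rewrite /window mulrC.
Qed.

Lemma indic_sym r x : \1_(`[- r, r]%classic) (- x) = \1_(`[- r, r]%classic) x :> R.
Proof.
rewrite !indicE; congr (nat_of_bool _)%:R; apply/idP/idP => /set_mem/=;
  rewrite in_itv/= => h; apply/mem_set => /=; rewrite in_itv/=; lra.
Qed.

(** Let $S$ be the truncated inversion integral. Fubini gives
    $\langle a,S\rangle$ and [plancherel] gives $\|S\|^2$; both equal
    $(2\pi)^{-1}\int_{-r}^r|\hat a|^2$, so that
    $\|a-S\|^2=\|a\|^2-(2\pi)^{-1}\int_{-r}^r|\hat a|^2$. *)
Lemma invT_error a r : L1b a ->
  [/\ measurable_fun setT (invT a r), L1 (fun x => (a x - invT a r x) ^+ 2) &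
  Int (fun x => (a x - invT a r x) ^+ 2) <=
  Int (fun x => a x ^+ 2) - (2 * pi)^-1 *
   Int (fun u => (cosT a u ^+ 2 + sinT a u ^+ 2) * \1_(`[- r, r]%classic) u)].
Proof.
move=> ab; have [ai _] := ab.
pose D := window r (cosT a); pose E := window r (sinT a).
have Db : L1b D.
  apply: L1_window; first exact: measurable_cosT.
  by exists (Int (fun x => `|a x|)) => u; exact: cosT_le.
have Eb : L1b E.
  apply: L1_window; first exact: measurable_sinT.
  by exists (Int (fun x => `|a x|)) => u; exact: sinT_le.
have [Di _] := Db; have [Ei _] := Eb.
have sD x : sinT D x = 0.
  apply: Int_odd; first exact: L1_Msin.
  by move=> u; rewrite /D /window cosT_even indic_sym mulNr sinN mulrN.
have cE x : cosT E x = 0.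
  apply: Int_odd; first exact: L1_Mcos.
  by move=> u; rewrite /E /window sinT_odd// indic_sym !mulNr cosN.
have [PD ED] := plancherel Db; have [PE EE] := plancherel Eb.
have [_ _ DE _] := parseval Db Eb.
have DE0 := parseval_odd Db Eb.
have m1 := measurable_cosT Di; have m2 := measurable_sinT Ei.
have mI : measurable_fun setT (invT a r).
  by apply: measurable_funM => //; exact: measurable_funD.
pose T x := cosT D x + sinT E x.
have T2 : L1 (fun x => T x ^+ 2) /\
    Int (fun x => T x ^+ 2) = 2 * pi * (Int (fun u => D u ^+ 2) + Int (fun u => E u ^+ 2)).
  have ET x : T x ^+ 2 = (cosT D x ^+ 2 + sinT D x ^+ 2) + (cosT E x ^+ 2 + sinT E x ^+ 2)
      + 2 * (cosT D x * sinT E x).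
    by rewrite /T sD cE; ring.
  have h1 := L1_D PD PE; have h2 := L1_Z 2 DE.
  split; first by apply: eq_L1 (L1_D h1 h2) => x; rewrite ET.
  by rewrite (eq_Int ET) (Int_D h1 h2) (Int_D PD PE) (Int_Z _ DE) DE0 ED EE mulr0 addr0 -mulrDr.
pose Q := Int (fun u => (cosT a u ^+ 2 + sinT a u ^+ 2) * \1_(`[- r, r]%classic) u).
have D2i := L1b_sqr Db; have E2i := L1b_sqr Eb.
have QE : Int (fun u => D u ^+ 2) + Int (fun u => E u ^+ 2) = Q.
  rewrite -(Int_D D2i E2i); apply: eq_Int => u; rewrite /D /E /window indicE.
  by case: (_ \in _); rewrite ?mulr1// !mulr0 expr0n/= addr0.
rewrite QE in T2; have [T2i T2E] := T2.
have aT : L1 (fun x => a x * T x) /\ Int (fun x => a x * T x) = Q.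
  have [||c1 c2 c3] := @Fubini_prod _ a D (fun x u => cos (u * x)) 1 ai Di.
  - by under eq_fun do rewrite mulrC; exact: measurable_cos_prod.
  - by move=> x u; exact: cos_max.
  have [||s1 s2 s3] := @Fubini_prod _ a E (fun x u => sin (u * x)) 1 ai Ei.
  - by under eq_fun do rewrite mulrC; exact: measurable_sin_prod.
  - by move=> x u; exact: sin_max.
  have E1 x : a x * T x = a x * Int (fun u => D u * cos (u * x)) +
     a x * Int (fun u => E u * sin (u * x)) by rewrite -mulrDr.
  split; first by apply: eq_L1 (L1_D c1 s1) => x; rewrite E1.
  rewrite (eq_Int E1) (Int_D c1 s1) c3 s3 -(Int_D c2 s2); apply: eq_Int => u.
  have -> : Int (fun x => a x * cos (u * x)) = cosT a u.
    by apply: eq_Int => x; rewrite mulrC [u * x]mulrC mulrC.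
  have -> : Int (fun x => a x * sin (u * x)) = sinT a u.
    by apply: eq_Int => x; rewrite [u * x]mulrC.
  by rewrite /D /E /window; ring.
have [aTi aTE] := aT.
have a2 := L1b_sqr ab.
have EI x : (a x - invT a r x) ^+ 2 =
   a x ^+ 2 + (- (2 * (2 * pi)^-1)) * (a x * T x) + ((2 * pi)^-1) ^+ 2 * T x ^+ 2.
  by rewrite /invT -/D -/E -/(T x); move: (_^-1) => p; ring.
have L := L1_D (L1_D a2 (L1_Z (- (2 * (2 * pi)^-1)) aTi)) (L1_Z (((2 * pi)^-1) ^+ 2) T2i).
split => //; first by apply: eq_L1 L => x; rewrite EI.
rewrite (eq_Int EI) Int_D; [|exact: L1_D a2 (L1_Z _ aTi)|exact: L1_Z].
rewrite (Int_D a2 (L1_Z _ aTi)) (Int_Z _ aTi) (Int_Z _ T2i) aTE T2E -/Q.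
have p0 : 2 * (pi : R) != 0 by rewrite gt_eqF// mulr_gt0 ?pi_gt0.
rewrite le_eqVlt; apply/orP; left; apply/eqP.
by move: (2 * pi) p0 => p p0; field.
Qed.

Lemma invT_cvg a : L1b a -> forall eps, 0 < eps -> exists r0,
  forall r, r0 <= r -> Int (fun x => (a x - invT a r x) ^+ 2) <= eps.
Proof.
move=> ab eps eps0; have [ai _] := ab; have [Pa Ea] := plancherel ab.
pose S u := cosT a u ^+ 2 + sinT a u ^+ 2.
have S0 u : 0 <= S u by rewrite addr_ge0 ?sqr_ge0.
have Li r : L1 (fun u => S u * \1_(`[- r, r]%classic) u).
  apply: (@L1_M _ 1); [exact: Pa| |]. by apply: measurable_indic; exact: measurable_itv.
  by move=> x; rewrite indicE; case: (_ \in _); rewrite ?normr1 ?normr0.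
have cN : Int (fun u => S u * \1_(`[- n%:R, n%:R]%classic) u) @[n --> \oo] --> Int S.
  apply: (Int_dom_cvg (g := S) _ _ _ _ _).2 => //.
  - by move=> n; exact: L1_meas.
  - exact: L1_meas.
  - apply: aeW => x; apply: cvg_near_cst; near=> n.
    rewrite indicE mem_set ?mulr1//= in_itv/= -ler_norml.
    near: n; exact: nbhs_infty_ger.
  - move=> n x; rewrite normrM ger0_norm// ler_piMr// indicE.
    by case: (_ \in _); rewrite ?normr1 ?normr0.
have pi2 : 0 < 2 * (pi : R) by rewrite mulr_gt0// pi_gt0.
have eps1 : 0 < 2 * pi * eps by rewrite mulr_gt0.
have [N _ hN] := (cvgrPdist_le _ _).1 cN _ eps1.
have {hN} := hN N (leqnn N); rewrite /= => hN.
exists N%:R => r Nr; have [_ _ h] := invT_error r ab.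
apply: (le_trans h); rewrite -/S.
have mono : Int (fun u => S u * \1_(`[- N%:R, N%:R]%classic) u) <= Int (fun u => S u * \1_(`[- r, r]%classic) u).
  apply: Int_le => // x; rewrite ler_wpM2l// !indicE.
  case: (boolP (x \in `[- N%:R, N%:R]%classic)) => [/set_mem/=|_]; last by rewrite ler0n.
  rewrite in_itv/= => /andP[x1 x2]; rewrite mem_set//= in_itv/=; lra.
have := ler_norm (Int S - Int (fun u => S u * \1_(`[- N%:R, N%:R]%classic) u)).
rewrite Ea in hN *; move: mono hN.
move: (Int (fun u => S u * _)) (Int (fun u => S u * _)) (Int (fun x => a x ^+ 2)) => p q s.
move=> qp h1 h2; rewrite -(ler_pM2l pi2) mulrBr (mulrA (2 * pi)) mulfV ?gt_eqF//.
by rewrite mul1r; lra.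
Unshelve. all: end_near.
Qed.

End PlancherelTheorem.

(** * The function V *)
Section KernelV.
Context {R : realType}.
Local Notation mu := (@lebesgue_measure R).
Implicit Types (u x y z e c M p q : R).

Lemma atan_slope y : 0 < y -> exists2 al : R,
  (1 + y ^+ 2)^-1 <= al <= 1 & atan y = y * al.
Proof.
move=> y0; have ca : {within `[0, y], continuous (@atan R)}.
  by apply: continuous_subspaceT => x; exact: continuous_atan.
have [c c0y E] := MVT y0 (fun x _ => is_derive1_atan x) ca.
move: c0y; rewrite in_itv/= => /andP[c0 cy].
have c2 : 0 <= c ^+ 2 by exact: sqr_ge0.
exists ((1 + c ^+ 2)^-1); last by move: E; rewrite atan0 !subr0 mulrC.
apply/andP; split; last by rewrite invf_le1 ?lerDl ?ltr_pwDl.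
rewrite lef_pV2 ?posrE ?ltr_pwDl ?sqr_ge0// lerD2l.
by rewrite lerXn2r ?nnegrE ?ltW.
Qed.

Let lnquot x : R := 2^-1 * (ln (1 + x) - ln (1 - x)).

Let arctanhE x : -1 < x < 1 -> arctanh x = lnquot x.
Proof.
move=> /andP[x1 x2]; rewrite /arctanh ln_div ?posrE; [|lra|lra].
by rewrite /lnquot mulrC.
Qed.

Let is_derive_lnquot x : -1 < x < 1 -> is_derive x 1 lnquot ((1 - x ^+ 2)^-1).
Proof.
move=> /andP[x1 x2].
have a1 : 0 < 1 + x by lra.
have a2 : 0 < 1 - x by lra.
have d1 : is_derive x 1 (fun y : R => 1 + y) 1.
  have h := is_deriveD (is_derive_cst (1 : R) x 1) (is_derive_id x (1 : R)).
  by apply: is_derive_eq; rewrite add0r.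
have d2 : is_derive x 1 (fun y : R => 1 - y) (-1).
  have h := is_deriveB (is_derive_cst (1 : R) x 1) (is_derive_id x (1 : R)).
  by apply: is_derive_eq; rewrite sub0r.
have e1 : is_derive x 1 (@ln R \o (fun y : R => 1 + y)) ((1 + x)^-1 * 1).
  exact: (is_derive1_comp (is_derive1_ln a1) d1).
have e2 : is_derive x 1 (@ln R \o (fun y : R => 1 - y)) ((1 - x)^-1 * -1).
  exact: (@is_derive1_comp _ (@ln R) (fun y : R => 1 - y) x _ _ (is_derive1_ln a2) d2).
have h := is_deriveZ 2^-1 (is_deriveB e1 e2).
apply: is_derive_eq; rewrite /GRing.scale/=.
have b1 : 1 + x != 0 by rewrite gt_eqF.
have b2 : 1 - x != 0 by rewrite gt_eqF.
have b3 : 1 - x ^+ 2 != 0 by rewrite (_ : _ - _ = (1 + x) * (1 - x)) ?mulf_neq0//; ring.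
by field; rewrite b1 b2 b3.
Qed.

Lemma arctanh_slope z : 0 < z -> z < 1 -> exists2 be : R,
  1 <= be <= (1 - z ^+ 2)^-1 & arctanh z = z * be.
Proof.
move=> z0 z1.
have dL x : x \in `[0, z] -> is_derive x 1 lnquot ((1 - x ^+ 2)^-1).
  by rewrite in_itv/= => /andP[x0 xz]; apply: is_derive_lnquot; lra.
have cL : {within `[0, z], continuous lnquot}.
  by apply: derivable_within_continuous => x /dL h; exact: ex_derive.
have [c] := MVT z0 (fun x (xz : x \in `]0, z[) => dL x (subset_itv_oo_cc xz)) cL.
rewrite in_itv/= => /andP[c0 cz] E.
exists ((1 - c ^+ 2)^-1); last first.
  rewrite arctanhE; last by lra.
  by move: E; rewrite [lnquot 0]/lnquot addr0 subr0 subrr mulr0 !subr0 mulrC.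
have cz2 : c ^+ 2 <= z ^+ 2 by rewrite lerXn2r ?nnegrE ?ltW.
have z2 : z ^+ 2 < 1 by rewrite expr_lt1// ltW.
have c2 : 0 <= c ^+ 2 by exact: sqr_ge0.
apply/andP; split; first by rewrite invf_ge1; lra.
by rewrite lef_pV2 ?posrE; lra.
Qed.

(** With $\arctan y=\alpha y$ and $\mathrm{arctanh}\,z=\beta z$ at the two
    arguments in [V], all square roots cancel, and the mean value theorem
    confines both slopes to intervals that close up at 1 as $p\to 0$. *)
Lemma V_slopes p : 0 < p -> p < 1 -> exists al be : R,
  [/\ 1 - p ^+ 2 <= al <= 1, 1 <= be <= 1 + p ^+ 2,
   atan (p / Num.sqrt (1 - p ^+ 2)) = p / Num.sqrt (1 - p ^+ 2) * al &
   V p = - ln p * (4 * p ^+ 2 / (1 - p ^+ 4)) + 2 * al / (1 - p ^+ 2)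
      - 2 * be / (1 + p ^+ 2)].
Proof.
move=> p0 p1.
have p21 : p ^+ 2 < 1 by rewrite expr_lt1// ltW.
have p2 : 0 < p ^+ 2 by rewrite exprn_gt0.
have s1 : 0 < Num.sqrt (1 - p ^+ 2) by rewrite sqrtr_gt0; lra.
have s2 : 0 < Num.sqrt (1 + p ^+ 2) by rewrite sqrtr_gt0; lra.
have q1 : Num.sqrt (1 - p ^+ 2) ^+ 2 = 1 - p ^+ 2 by rewrite sqr_sqrtr; lra.
have q2 : Num.sqrt (1 + p ^+ 2) ^+ 2 = 1 + p ^+ 2 by rewrite sqr_sqrtr; lra.
have [al al1 alE] := atan_slope (divr_gt0 p0 s1).
have z1 : p / Num.sqrt (1 + p ^+ 2) < 1.
  rewrite ltr_pdivrMr// mul1r -(@ltr_pXn2r _ 2)// ?nnegrE ?(ltW p0) ?(ltW s2)//.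
  by rewrite q2; lra.
have [be be1 beE] := arctanh_slope (divr_gt0 p0 s2) z1.
have n1 : 1 - p ^+ 2 != 0 by rewrite gt_eqF; lra.
have n2 : 1 + p ^+ 2 != 0 by rewrite gt_eqF; lra.
have p0' : p != 0 by rewrite gt_eqF.
have n4 : 1 - p ^+ 4 != 0.
  by rewrite (_ : _ - _ = (1 - p ^+ 2) * (1 + p ^+ 2)) ?mulf_neq0//; ring.
exists al, be; split.
- move: al1; rewrite exprMn exprVn q1 [X in X^-1](_ : _ = (1 - p ^+ 2)^-1) ?invrK//.
  by field.
- move: be1; rewrite exprMn exprVn q2 [X in X^-1](_ : _ = (1 + p ^+ 2)^-1) ?invrK//.
  by field.
- exact: alE.
rewrite /V p0 p1/= alE beE.
have e1 : 2 / (p * Num.sqrt (1 - p ^+ 2)) * (p / Num.sqrt (1 - p ^+ 2) * al) = 2 * al / (1 - p ^+ 2).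
  rewrite -[X in _ = _ / X]q1; move: (Num.sqrt _) s1 => s s0.
  by field; rewrite p0' gt_eqF.
have e2 : 2 / (p * Num.sqrt (1 + p ^+ 2)) * (p / Num.sqrt (1 + p ^+ 2) * be) = 2 * be / (1 + p ^+ 2).
  rewrite -[X in _ = _ / X]q2; move: (Num.sqrt (1 + _)) s2 => s s0.
  by field; rewrite p0' gt_eqF.
rewrite e1 e2; move: (ln p) => l; field.
by rewrite n1 n2 n4.
Qed.

Lemma V_pos01 p : 0 < p -> p < 1 -> 0 < V p.
Proof.
move=> p0 p1; have [al [be [/andP[al1 _] /andP[_ be1] _ ->]]] := V_slopes p0 p1.
have p21 : p ^+ 2 < 1 by rewrite expr_lt1// ltW.
have p2 : 0 < p ^+ 2 by rewrite exprn_gt0.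
have p4 : p ^+ 4 < 1 by rewrite expr_lt1// ltW.
have lp : ln p < 0 by apply: ln_lt0; rewrite p0.
have h1 : 0 < - ln p * (4 * p ^+ 2 / (1 - p ^+ 4)).
  by rewrite mulr_gt0 ?oppr_gt0// divr_gt0 ?mulr_gt0// subr_gt0.
have h2 : 2 <= 2 * al / (1 - p ^+ 2) by rewrite ler_pdivlMr; lra.
have h3 : 2 * be / (1 + p ^+ 2) <= 2 by rewrite ler_pdivrMr; lra.
by lra.
Qed.

Let pow_le p n : 0 < p -> p < 1 -> p ^+ n.+1 <= p.
Proof.
by move=> p0 p1; rewrite exprS ler_piMr ?(ltW p0)// exprn_ile1 ?ltW.
Qed.

(** Near $p=0$ the two slope terms cancel to order $p^2$ and the logarithmic
    term is $O(p^2|\log p|)$, which the power $p^{3/2}$ absorbs. Near $p=1$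
    the arctangent is bounded by $\pi/2$, which leaves the singularity
    $(1-p^2)^{-1/2}$. The constant is 8 for the logarithm plus 32 for the rest. *)
Lemma V_bound01 p : 0 < p -> p < 1 ->
  V p <= 40 * Num.sqrt p ^+ 3 / Num.sqrt (1 - p).
Proof.
move=> p0 p1; have [al [be [/andP[al1 al2] /andP[be1 be2] alE ->]]] := V_slopes p0 p1.
pose q := Num.sqrt p; have q0 : 0 < q by rewrite sqrtr_gt0.
have qE : p = q ^+ 2 by rewrite sqr_sqrtr// ltW.
have q1 : q < 1.
  by rewrite -(@ltr_pXn2r _ 2)// ?nnegrE ?(ltW q0)// -qE expr1n.
have p21 : p ^+ 2 < 1 by rewrite expr_lt1// ltW.
have p2 : 0 < p ^+ 2 by rewrite exprn_gt0.
have p4 : p ^+ 4 < 1 by rewrite expr_lt1// ltW.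
have p4p : p ^+ 4 <= p by exact: pow_le.
pose s := Num.sqrt (1 - p).
have s0 : 0 < s by rewrite sqrtr_gt0 subr_gt0.
have sE : s ^+ 2 = 1 - p by rewrite sqr_sqrtr// subr_ge0 ltW.
have s1 : s <= 1.
  by rewrite -(@ler_pXn2r _ 2)// ?nnegrE ?(ltW s0)// sE expr1n; lra.
rewrite -/q -/s.
have L : - ln p * (4 * p ^+ 2 / (1 - p ^+ 4)) <= 8 * q ^+ 3.
  (* This is - ln p = - 2 ln q and - ln q <= 1/q - 1. *)
  have lq : - ln p <= 2 * ((1 - q) / q).
    rewrite qE lnXn// -[X in _ <= X]opprK lerN2 -mulNr mulr2n.
    have : - ln q <= q^-1 - 1.
      rewrite -lnV ?posrE//; have := @le_ln1Dx R (q^-1 - 1).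
      rewrite addrCA subrr addr0; apply.
      by rewrite ltrBrDr addNr invr_gt0.
    have -> : (1 - q) / q = q^-1 - 1 by field; rewrite gt_eqF.
    by lra.
  have c0 : 0 <= 4 * p ^+ 2 / (1 - p ^+ 4) by rewrite divr_ge0 ?mulr_ge0 ?subr_ge0// ltW.
  apply: (le_trans (ler_wpM2r c0 lq)).
  have -> : 2 * ((1 - q) / q) * (4 * p ^+ 2 / (1 - p ^+ 4)) =
     8 * q ^+ 3 * ((1 - q) / (1 - p ^+ 4)).
    have : 1 - p ^+ 4 != 0 by rewrite gt_eqF// subr_gt0.
    by move: (1 - p ^+ 4) => d d0; rewrite qE; field; rewrite d0 gt_eqF.
  rewrite ler_piMr// ?mulr_ge0 ?exprn_ge0 ?(ltW q0)//.
  rewrite ler_pdivrMr ?subr_gt0// mul1r lerD2l lerN2.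
  apply: (le_trans p4p); rewrite {1}qE; exact: pow_le.
have q3 : 0 < q ^+ 3 by rewrite exprn_gt0.
have si : 1 <= s^-1 by rewrite invf_ge1.
have main : 2 * al / (1 - p ^+ 2) - 2 * be / (1 + p ^+ 2) <= 32 * q ^+ 3 / s.
  have bel : 2 / (1 + p ^+ 2) <= 2 * be / (1 + p ^+ 2).
    by rewrite ler_wpM2r ?invr_ge0; lra.
  (* Up to 1/2 the slopes are close to 1; beyond 1/2 the slope of the
     arctangent is controlled by its bound pi/2 < 2. *)
  have [ph|ph] := leP p (2^-1).
    have all : 2 * al / (1 - p ^+ 2) <= 2 / (1 - p ^+ 2).
      by rewrite ler_wpM2r ?invr_ge0; lra.
    have e : 2 / (1 - p ^+ 2) - 2 / (1 + p ^+ 2) = 4 * p ^+ 2 / (1 - p ^+ 4).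
      have n1 : 1 - p ^+ 2 != 0 by rewrite gt_eqF; lra.
      have n2 : 1 + p ^+ 2 != 0 by rewrite gt_eqF; lra.
      have n4 : 1 - p ^+ 4 != 0 by rewrite gt_eqF; lra.
      by field; rewrite n1 n2 n4.
    have e2 : 4 * p ^+ 2 / (1 - p ^+ 4) <= 8 * p ^+ 2.
      rewrite ler_pdivrMr; last by lra.
      have : p ^+ 4 <= 2^-1 by lra.
      by move: (p ^+ 2) (p ^+ 4) p2 => a b a0 b0; nra.
    have e3 : p ^+ 2 <= q ^+ 3.
      by rewrite qE -exprM (_ : (2 * 2 = 1 + 3)%N)// exprD ler_piMl ?(ltW q3)// expr1 ltW.
    have e4 : 32 * q ^+ 3 <= 32 * q ^+ 3 / s by rewrite ler_peMr//; lra.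
    by lra.
  have q12 : 2^-1 <= q.
    by apply: (le_trans (ltW ph)); rewrite {1}qE; exact: pow_le.
  have h0 : 0 <= 2 * be / (1 + p ^+ 2) by rewrite divr_ge0; lra.
  suff : 2 * al / (1 - p ^+ 2) <= 32 * q ^+ 3 / s by lra.
  pose r := Num.sqrt (1 - p ^+ 2).
  have r0 : 0 < r by rewrite sqrtr_gt0 subr_gt0.
  have rE : r ^+ 2 = 1 - p ^+ 2 by rewrite sqr_sqrtr// subr_ge0 ltW.
  have sr : s <= r by rewrite ler_wsqrtr// lerD2l lerN2 pow_le.
  have ale : p / r * al <= 2.
    rewrite -alE; apply: ltW; apply: (lt_le_trans (atan_ltpi2 _)).
    by apply: ltW; exact: pihalf_lt2.
  have alr : al <= 2 * r / p by rewrite ler_pdivlMr//; move: ale; rewrite mulrAC ler_pdivrMr// mulrC.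
  apply: (@le_trans _ _ (4 / (p * r))).
    rewrite -rE ler_pdivrMr ?exprn_gt0//.
    apply: (le_trans (ler_wpM2l _ alr)) => //.
    by rewrite le_eqVlt; apply/orP; left; apply/eqP; field; rewrite !gt_eqF.
  have p3 : 1 <= 8 * (p * q ^+ 3).
    have -> : q ^+ 3 = p * q by rewrite qE; ring.
    have pp : 1 <= 8 * (p * p * p).
      rewrite (_ : 8 * (p * p * p) = (2 * p) ^+ 3); last by ring.
      by rewrite exprn_ege1//; lra.
    apply: (le_trans pp); rewrite ler_pM2l// -mulrA ler_pM2l// ler_pM2l//.
    by rewrite {1}qE; exact: pow_le.
  rewrite ler_pdivrMr ?mulr_gt0//.
  rewrite (_ : _ / s * (p * r) = 32 * q ^+ 3 * p * (r / s)); last by ring.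
  have rs : 1 <= r / s by rewrite ler_pdivlMr// mul1r.
  have h4 : 4 <= 32 * q ^+ 3 * p by lra.
  by apply: (le_trans h4); rewrite ler_peMr//; lra.
have e4 : 8 * q ^+ 3 <= 8 * q ^+ 3 / s by rewrite ler_peMr//; lra.
have -> : 40 * q ^+ 3 / s = 8 * q ^+ 3 / s + 32 * q ^+ 3 / s by rewrite -mulrDl -mulrDl -natrD.
by lra.
Qed.

(** The two branches of the definition are exchanged by $p\mapsto 1/p$; hence
    only $0<p<1$ needs estimates. *)
Lemma V_inv p : 1 < p -> V p = p ^- 3 * V p^-1.
Proof.
move=> p1; have p0 : 0 < p by lra.
have i0 : 0 < p^-1 by rewrite invr_gt0.
have i1 : p^-1 < 1 by rewrite invf_lt1.
have p2 : 1 < p ^+ 2 by rewrite expr_gt1// ltW.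
rewrite /V i0 i1 p1/= (_ : p < 1 = false) ?andbF; last by apply/negbTE; rewrite -leNgt ltW.
have s1 : Num.sqrt (1 + p^-1 ^+ 2) = Num.sqrt (1 + p ^+ 2) / p.
  rewrite (_ : 1 + p^-1 ^+ 2 = (1 + p ^+ 2) / p ^+ 2); last by field; rewrite gt_eqF.
  by rewrite sqrtrM ?sqrtrV ?sqrtr_sqr ?gtr0_norm ?sqr_ge0//; lra.
have s2 : Num.sqrt (1 - p^-1 ^+ 2) = Num.sqrt (p ^+ 2 - 1) / p.
  rewrite (_ : 1 - p^-1 ^+ 2 = (p ^+ 2 - 1) / p ^+ 2); last by field; rewrite gt_eqF.
  by rewrite sqrtrM ?sqrtrV ?sqrtr_sqr ?gtr0_norm ?sqr_ge0//; lra.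
have r1 : 0 < Num.sqrt (1 + p ^+ 2) by rewrite sqrtr_gt0; lra.
have r2 : 0 < Num.sqrt (p ^+ 2 - 1) by rewrite sqrtr_gt0; lra.
rewrite s1 s2 lnV ?posrE//.
have a1 : p^-1 / (Num.sqrt (1 + p ^+ 2) / p) = 1 / Num.sqrt (1 + p ^+ 2).
  by field; rewrite !gt_eqF.
have a2 : p^-1 / (Num.sqrt (p ^+ 2 - 1) / p) = 1 / Num.sqrt (p ^+ 2 - 1).
  by field; rewrite !gt_eqF.
rewrite a1 a2.
move: (ln p) (arctanh _) (atan _) => l A B.
move: (Num.sqrt (1 + p ^+ 2)) (Num.sqrt (p ^+ 2 - 1)) r1 r2 => r r' h1 h2.
have n1 : p ^+ 2 - 1 != 0 by rewrite gt_eqF; lra.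
have n2 : 1 + p ^+ 2 != 0 by rewrite gt_eqF; lra.
field.
by rewrite n1 [p ^+ 2 + 1]addrC n2 !gt_eqF.
Qed.
End KernelV.

(** * The kernel K *)
Section KernelK.
Context {R : realType}.
Local Notation mu := (@lebesgue_measure R).
Implicit Types (u x y z e c M p q a b : R).

Lemma continuous_arctanh z : -1 < z < 1 -> {for z, continuous arctanh}.
Proof.
move=> /andP[z1 z2]; apply: cvgM; last exact: cvg_cst.
have h : (1 + y) / (1 - y) @[y --> z] --> (1 + z) / (1 - z).
  apply: cvgM; first by apply: cvgD; [exact: cvg_cst|exact: cvg_id].
  apply: cvgV; first by rewrite gt_eqF// subr_gt0.
  by apply: cvgB; [exact: cvg_cst|exact: cvg_id].
apply: (cvg_comp _ _ h); apply: continuous_ln.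
by rewrite divr_gt0//; lra.
Qed.

Lemma continuous_V01 p : 0 < p -> p < 1 -> {for p, continuous V}.
Proof.
move=> p0 p1.
have p21 : p ^+ 2 < 1 by rewrite expr_lt1// ltW.
have p2 : 0 < p ^+ 2 by rewrite exprn_gt0.
pose r := Num.sqrt (1 - p ^+ 2); pose s := Num.sqrt (1 + p ^+ 2).
have r0 : 0 < r by rewrite sqrtr_gt0; lra.
have s0 : 0 < s by rewrite sqrtr_gt0; lra.
have sE : s ^+ 2 = 1 + p ^+ 2 by rewrite sqr_sqrtr; lra.
have cid : q @[q --> p] --> p by exact: cvg_id.
have c2 : q ^+ 2 @[q --> p] --> p ^+ 2 by exact: exprn_continuous.
have cD : 1 + q ^+ 2 @[q --> p] --> 1 + p ^+ 2 by apply: cvgD => //; exact: cvg_cst.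
have cB : 1 - q ^+ 2 @[q --> p] --> 1 - p ^+ 2 by apply: cvgB => //; exact: cvg_cst.
have cr : Num.sqrt (1 - q ^+ 2) @[q --> p] --> r := cvg_comp _ _ cB (@sqrt_continuous R _).
have cs : Num.sqrt (1 + q ^+ 2) @[q --> p] --> s := cvg_comp _ _ cD (@sqrt_continuous R _).
have cl : ln q @[q --> p] --> ln p by exact: continuous_ln.
have cpr : q / Num.sqrt (1 - q ^+ 2) @[q --> p] --> p / r.
  by apply: cvgM => //; apply: cvgV => //; rewrite gt_eqF.
have cps : q / Num.sqrt (1 + q ^+ 2) @[q --> p] --> p / s.
  by apply: cvgM => //; apply: cvgV => //; rewrite gt_eqF.
have ps1 : -1 < p / s < 1.
  have : 0 < p / s by rewrite divr_gt0.
  have : p / s < 1.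
    rewrite ltr_pdivrMr// mul1r -(@ltr_pXn2r _ 2)// ?nnegrE ?(ltW p0) ?(ltW s0)//.
    by rewrite sE; lra.
  by lra.
have ca := cvg_comp _ _ cpr (@continuous_atan R _).
have ct := cvg_comp _ _ cps (continuous_arctanh ps1).
pose W (q : R) := 2 * ln q / (1 + q ^+ 2)
    - 2 / (q * Num.sqrt (1 + q ^+ 2)) * arctanh (q / Num.sqrt (1 + q ^+ 2))
    - 2 * ln q / (1 - q ^+ 2)
    + 2 / (q * Num.sqrt (1 - q ^+ 2)) * atan (q / Num.sqrt (1 - q ^+ 2)).
have cW : W q @[q --> p] --> W p.
  apply: cvgD; [apply: cvgB; [apply: cvgB|]|].
  - apply: cvgM; first by apply: cvgM => //; exact: cvg_cst.
    by apply: cvgV => //; rewrite gt_eqF//; lra.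
  - apply: cvgM; last exact: ct.
    apply: cvgM; first exact: cvg_cst.
    apply: cvgV; first by rewrite mulf_neq0// gt_eqF.
    exact: cvgM.
  - apply: cvgM; first by apply: cvgM => //; exact: cvg_cst.
    by apply: cvgV => //; rewrite gt_eqF//; lra.
  - apply: cvgM; last exact: ca.
    apply: cvgM; first exact: cvg_cst.
    apply: cvgV; first by rewrite mulf_neq0// gt_eqF.
    exact: cvgM.
have VW q : 0 < q < 1 -> V q = W q by rewrite /V => ->.
rewrite /prop_for /continuous_at VW ?p0//; apply: cvg_trans cW.
apply: near_eq_cvg; have /near_in_itvoo : p \in `]0, 1[ by rewrite in_itv/= p0.
by apply: filterS => q; rewrite in_itv/= => /VW.
Qed.

Lemma continuous_V p : 0 < p -> p != 1 -> {for p, continuous V}.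
Proof.
move=> p0; have [p1|p1|//] := ltgtP p 1; first by move=> _; exact: continuous_V01.
move=> _; rewrite /prop_for /continuous_at V_inv//.
have ip : 0 < p^-1 by rewrite invr_gt0.
have ip1 : p^-1 < 1 by rewrite invf_lt1.
have ci : q^-1 @[q --> p] --> p^-1 by apply: cvgV; [rewrite gt_eqF|exact: cvg_id].
have c : q ^- 3 * V q^-1 @[q --> p] --> p ^- 3 * V p^-1.
  apply: cvgM; last exact: (cvg_comp _ _ ci (continuous_V01 ip ip1)).
  apply: cvgV; first by rewrite gt_eqF// exprn_gt0.
  exact: exprn_continuous.
apply: cvg_trans c; apply: near_eq_cvg.
have /near_in_itvoy : p \in `]1, +oo[ by rewrite in_itv/= p1.
by apply: filterS => q; rewrite in_itv/= andbT => /V_inv.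
Qed.

Lemma V_out p : ~~ (0 < p < 1) -> ~~ (1 < p) -> V p = 0.
Proof. by rewrite /V => /negbTE -> /negbTE ->. Qed.

Lemma V_ge0 p : 0 <= V p.
Proof.
have [/andP[p0 p1]|n1] := boolP (0 < p < 1); first by apply/ltW/V_pos01.
have [p1|n2] := boolP (1 < p); last by rewrite V_out.
have ip : 0 < p^-1 by rewrite invr_gt0; lra.
rewrite V_inv// mulr_ge0 ?invr_ge0 ?exprn_ge0//; first by lra.
by apply/ltW/V_pos01 => //; rewrite invf_lt1//; lra.
Qed.

Lemma measurable_V : measurable_fun setT (@V R).
Proof.
pose D : set R := `]0, 1[%classic `|` `]1, +oo[%classic.
have oD : open D by apply: openU; [exact: interval_open|exact: interval_open].
have mD : measurable D by exact: open_measurable.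
have -> : @V R = V \_ D.
  apply/funext => p; rewrite patchE; case: ifPn => // /negP; rewrite inE => nD.
  apply: V_out; apply/negP => h; apply: nD; [left|right];
   by rewrite /= in_itv/= ?andbT.
apply/(measurable_restrictT _ mD).
apply: open_continuous_measurable_fun => // p /set_mem[]; rewrite /= in_itv/=.
  by move=> /andP[p0 p1]; apply: continuous_V01.
by rewrite andbT => p1; apply: continuous_V; [lra|rewrite gt_eqF].
Qed.

Lemma measurable_K : measurable_fun setT (@K R).
Proof.
apply: (measurableT_comp measurable_V).
apply: (measurableT_comp (@measurable_expR R)).
exact: mulrr_measurable.
Qed.

Lemma K_ge0 x : 0 <= K x. Proof. exact: V_ge0. Qed.

Lemma K_neg x : x < 0 -> 0 < K x.
Proof. by move=> x0; apply: V_pos01; [exact: expR_gt0|rewrite expR_lt1; lra]. Qed.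

(** Evenness of $K(x)e^{3x/4}$: this is [V_inv] at $q=e^{x/2}$, whose cube
    is split evenly between the two sides. *)
Lemma K_inv x : K x * expR (3 / 4 * x) = K (- x) * expR (3 / 4 * - x).
Proof.
have main y : 0 < y -> K y * expR (3 / 4 * y) = K (- y) * expR (3 / 4 * - y).
  move=> y0; rewrite /K V_inv; last by rewrite expR_gt1; lra.
  rewrite -expRM_natl -!expRN mulNr mulrAC mulrC.
  by rewrite -expRD; congr (_ * expR _); field.
have [x0|x0|->] := ltgtP x 0; last by rewrite oppr0.
  by rewrite [RHS]main ?oppr_gt0// !opprK.
exact: main.
Qed.

Lemma K_pos x : x != 0 -> 0 < K x.
Proof.
have [x0 _|x0 _|//] := ltgtP x 0; first exact: K_neg.
rewrite -(pmulr_lgt0 _ (expR_gt0 (3 / 4 * x))) K_inv mulr_gt0 ?expR_gt0//.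
by apply: K_neg; lra.
Qed.

(** ** Integrability of the kernel against exponentials *)

(** With $p=e^{-y/2}$ this is $p/\sqrt{1-p}$, and it is the derivative of
    $4\sqrt{1-e^{-y/2}}$. *)
Definition kmajor y : R := expR (- y / 2) / Num.sqrt (1 - expR (- y / 2)).

Lemma K_le_kmajor_neg x : x < 0 -> K x * expR (3 / 4 * x) * expR `|x| <= 40 * kmajor `|x|.
Proof.
move=> x0; have e0 : 0 < expR (x / 2) by exact: expR_gt0.
have e1 : expR (x / 2) < 1 by rewrite expR_lt1; lra.
have h := V_bound01 e0 e1.
have sq : Num.sqrt (expR (x / 2)) = expR (x / 4).
  rewrite (_ : expR (x / 2) = expR (x / 4) ^+ 2); last first.
    by rewrite -expRM_natl; congr expR; field.
  by rewrite sqrtr_sqr ger0_norm ?expR_ge0.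
rewrite ltr0_norm// /kmajor opprK.
have E : expR (3 / 4 * x) * expR (- x) * expR (x / 4) ^+ 3 = expR (x / 2).
  by rewrite -expRM_natl -!expRD; congr expR; field.
rewrite /K -mulrA; apply: (le_trans (ler_wpM2r _ h)); first by rewrite mulr_ge0 ?expR_ge0.
rewrite sq le_eqVlt; apply/orP; left; apply/eqP.
by rewrite -[X in _ = 40 * (X / _)]E; ring.
Qed.

(** The factor $e^{|x|}$ records the decay of the even function
    $K(x)e^{3x/4}$: it allows weights $e^{\sigma x}$ with
    $|\sigma-3/4|\le 1$. *)
Lemma K_le_kmajor x : K x * expR (3 / 4 * x) * expR `|x| <= 40 * kmajor `|x|.
Proof.
have [x0|x0|->] := ltgtP x 0; first exact: K_le_kmajor_neg.
  by rewrite K_inv -(normrN x); apply: K_le_kmajor_neg; lra.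
have -> : K (0 : R) = 0.
  by rewrite /K mul0r expR0 V_out ?ltxx ?andbF.
by rewrite !mul0r mulr_ge0 ?divr_ge0 ?expR_ge0 ?sqrtr_ge0.
Qed.

Lemma kmajor_ge0 y : 0 <= kmajor y.
Proof. by rewrite divr_ge0 ?expR_ge0 ?sqrtr_ge0. Qed.

Let dexp x : is_derive x 1 (fun u : R => expR (- u / 2)) (- (expR (- x / 2) / 2)).
Proof.
rewrite (_ : (fun u : R => expR (- u / 2)) = (fun u => expR (- 2^-1 * u))); last first.
  by apply/funext => u; congr expR; field.
rewrite (_ : - (expR (- x / 2) / 2) = - 2^-1 * expR (- 2^-1 * x)); last first.
  by rewrite [RHS]mulNr [2^-1 * _]mulrC; congr (- (expR _ / _)); field.
exact: is_derive_comp_scale.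
Qed.

Lemma integral_kmajor a : 0 < a ->
  (\int[mu]_(x in `[a, +oo[) (kmajor x)%:E <= 4%:E)%E.
Proof.
move=> a0; pose F (y : R) := 4 * Num.sqrt (1 - expR (- y / 2)).
have lt1 y : 0 < y -> 0 < 1 - expR (- y / 2).
  by move=> y0; rewrite subr_gt0 expR_lt1; lra.
have dF y : 0 < y -> is_derive y 1 F (kmajor y).
  move=> y0; have h0 := is_deriveB (is_derive_cst (1 : R) y 1) (dexp y).
  have h1 := @is_derive1_comp R (@Num.sqrt R) (fun u : R => 1 - expR (- u / 2)) y _ _
    (is_derive1_sqrt (lt1 y y0)) h0.
  have h2 := is_deriveZ 4 h1.
  apply: is_derive_eq; rewrite /GRing.scale/= /kmajor.
  have : Num.sqrt (1 - expR (- y / 2)) != 0 by rewrite gt_eqF// sqrtr_gt0 lt1.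
  move: (expR (- y / 2)) => t; move: (Num.sqrt (1 - t)) => s s0.
  by field; rewrite s0.
have cF y : 0 < y -> {for y, continuous F}.
  move=> y0; have h := dF y y0.
  by apply: differentiable_continuous; apply/derivable1_diffP; exact: ex_derive.
have ck y : 0 < y -> {for y, continuous kmajor}.
  move=> y0; have cE : {for y, continuous (fun u : R => expR (- u / 2))}.
    have h := dexp y.
    by apply: differentiable_continuous; apply/derivable1_diffP; exact: ex_derive.
  apply: cvgM => //; apply: cvgV; first by rewrite gt_eqF// sqrtr_gt0 lt1.
  have h : 1 - expR (- u / 2) @[u --> y] --> 1 - expR (- y / 2).
    by apply: cvgB => //; exact: cvg_cst.
  exact: (cvg_comp _ _ h (@sqrt_continuous R _)).
have Fy : F x @[x --> +oo] --> (4 : R).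
  have h1 : expR (- x / 2) @[x --> +oo] --> (0 : R).
    rewrite (_ : (fun u : R => expR (- u / 2)) = (fun u => expR (- 2^-1 * u))); last first.
      by apply/funext => u; congr expR; field.
    by apply: cvg_expRNM; rewrite invr_gt0.
  have h2 : 1 - expR (- x / 2) @[x --> +oo] --> 1 - (0 : R).
    by apply: cvgB => //; exact: cvg_cst.
  have h3 := cvg_comp _ _ h2 (@sqrt_continuous R _).
  have := cvgM (@cvg_cst _ (4 : R) _ _ _) h3.
  by rewrite subr0 sqrtr1 mulr1; apply.
rewrite (@ge0_continuous_FTC2y R kmajor F a 4).
- rewrite -EFinB lee_fin lerBlDr lerDl /F mulr_ge0// sqrtr_ge0//.
- by move=> x _; exact: kmajor_ge0.
- apply: continuous_in_subspaceT => x /set_mem/=; rewrite in_itv/= andbT => ax.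
  by apply: ck; lra.
- exact: Fy.
- by move=> x ax; have h := dF x ltac:(lra); exact: ex_derive.
- by apply: cvg_at_right_filter; exact: cF.
- move=> x; rewrite in_itv/= andbT => ax; have h := dF x ltac:(lra).
  by rewrite derive1E derive_val.
Qed.

End KernelK.

(** * Integrals of the kernel and the constant gamma *)
Section KernelIntegrals.
Context {R : realType}.
Local Notation mu := (@lebesgue_measure R).
Implicit Types (u x y z e c M p q a b : R).

Lemma measurable_kmajor : measurable_fun setT (@kmajor R).
Proof.
have -> : @kmajor R = (fun x => expR (- x / 2)) \* (fun x => (Num.sqrt (1 - expR (- x / 2)))^-1).
  by [].
have mE : measurable_fun setT (fun x : R => expR (- x / 2)).
  apply: (measurableT_comp (@measurable_expR R)).
  by apply: measurable_funM => //; exact: oppr_measurable.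
apply: measurable_funM => //.
rewrite (_ : (fun x => _) = (fun x : R => (Num.sqrt (1 - expR (- x / 2))) `^ (-1))); last first.
  by apply/funext => x; rewrite powR_inv1 ?sqrtr_ge0.
apply: (measurableT_comp (measurable_powR _)).
apply: (measurableT_comp (f := @Num.sqrt R)).
  by apply: continuous_measurable_fun; exact: sqrt_continuous.
exact: measurable_funB.
Qed.

(** The singularity of [kmajor] at 0 is reached by exhausting the half-line by
    $[1/(n+1),\infty)$, on which the integrals are bounded by 4. *)
Lemma L1_kmajor_pos : L1 (fun x : R => kmajor x * \1_(`]0, +oo[%classic) x).
Proof.
have m0 := measurable_kmajor.
pose F (n : nat) : set R := `[n.+1%:R^-1, +oo[%classic.
have UF : \bigcup_n F n = `]0, +oo[%classic.
  apply/seteqP; split=> [x [n _]|x]; rewrite /F/= !in_itv/= !andbT.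
    by apply: lt_le_trans; rewrite invr_gt0.
  move=> x0; have [n nx] := ltr_add_invr x0.
  by exists n => //=; rewrite in_itv/= andbT; move: nx; rewrite add0r => /ltW.
have mk : measurable_fun setT (fun x : R => kmajor x * \1_(`]0, +oo[%classic) x).
  by apply: measurable_funM => //; exact: measurable_indic.
apply: ge0_L1 => //.
  by move=> x; rewrite mulr_ge0 ?kmajor_ge0.
rewrite (_ : (\int[mu]_x _)%E = (\int[mu]_(x in \bigcup_n F n) (kmajor x)%:E)%E); last first.
  rewrite UF [RHS]integral_mkcond; apply: eq_integral => x _.
  by rewrite patchE indicE; case: ifP => _; rewrite ?mulr1 ?mulr0.
apply: (@le_lt_trans _ _ 4%:E); last exact: ltry.
have cv : (\int[mu]_(x in F n) (kmajor x)%:E)%E @[n --> \oo] -->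
    (\int[mu]_(x in \bigcup_n F n) (kmajor x)%:E)%E.
  apply: ge0_nondecreasing_set_cvg_integral.
  - apply/nondecreasing_seqP => n; rewrite subsetEset => x; rewrite /F/= !in_itv/= !andbT.
    by apply: le_trans; rewrite lef_pV2 ?posrE// ler_nat.
  - by move=> i; exact: measurable_itv.
  - by move=> i; apply/measurable_EFinP; exact: measurable_funTS.
  - by move=> i x _; rewrite lee_fin kmajor_ge0.
rewrite -(cvg_lim _ cv)//; apply: lime_le; first by apply/cvg_ex; eexists; exact: cv.
by apply: nearW => n; apply: integral_kmajor; rewrite invr_gt0.
Qed.

Lemma L1_kmajor_abs : L1 (fun x : R => kmajor `|x|).
Proof.
have I0 (y : R) : \1_(`]0%R, +oo[%classic : set R) y = (0 < y)%R%:R :> R.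
  rewrite indicE; congr (nat_of_bool _)%:R; apply/idP/idP => [/set_mem|y0].
    by rewrite /= in_itv/= andbT.
  by apply/mem_set; rewrite /= in_itv/= y0.
have h := L1_D L1_kmajor_pos (L1_opp L1_kmajor_pos).
apply: eq_L1 h => x; rewrite !I0 oppr_gt0.
have [x0|x0|->] := ltgtP x 0.
- by rewrite mulr0 mulr1 add0r ltr0_norm.
- by rewrite mulr0 mulr1 addr0 gtr0_norm.
- by rewrite !mulr0 addr0 /kmajor normr0 oppr0 mul0r expR0 subrr sqrtr0 invr0 mulr0.
Qed.

Lemma L1_K_exp e : - (1 / 4) <= e -> e <= 7 / 4 -> L1 (fun x : R => K x * expR (e * x)).
Proof.
move=> e1 e2; apply: (L1_dom (g := fun x => 40 * kmajor `|x|)).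
- apply: measurable_funM; first exact: measurable_K.
  by apply: (measurableT_comp (@measurable_expR R)); exact: mulrl_measurable.
- by apply: L1_Z; exact: L1_kmajor_abs.
- move=> x; rewrite ger0_norm ?mulr_ge0 ?K_ge0 ?expR_ge0//.
  apply: le_trans (K_le_kmajor x); rewrite -mulrA ler_wpM2l ?K_ge0// -expRD ler_expR.
  have [x0|x0] := leP 0 x.
    by rewrite ger0_norm//; nra.
  by rewrite ltr0_norm//; nra.
Qed.

(** ** The change of variables p = exp(x/2) *)

Let F (x : R) := expR (x / 2).

Let dF x : is_derive x 1 F (F x / 2).
Proof.
rewrite (_ : F = (fun u => expR (2^-1 * u))); last first.
  by apply/funext => u; rewrite /F mulrC.
by rewrite mulrC; exact: is_derive_comp_scale.
Qed.

Let F1E : (derive1 F) = (fun x => F x / 2).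
Proof. by apply/funext => x; have h := dF x; rewrite derive1E derive_val. Qed.

Let cF : continuous F.
Proof.
move=> x; have h := dF x.
by apply: differentiable_continuous; apply/derivable1_diffP; exact: ex_derive.
Qed.

Lemma substitution_segment a b : a <= b -> 0 < a \/ b < 0 ->
  (\int[mu]_(p in `[expR (a / 2), expR (b / 2)]) (V p)%:E =
   \int[mu]_(x in `[a, b]) (K x * (expR (x / 2) / 2))%:E)%E.
Proof.
move=> ab sgn.
have cF1 : continuous (fun x : R => F x / 2).
  by move=> x; apply: cvgM; [exact: cF|exact: cvg_cst].
rewrite (@integration_by_substitution_increasing _ F) //.
- by apply: eq_integral => x _; rewrite fctE /= F1E.
- by move=> x y _ _ xy; rewrite ltr_expR ltr_pM2r// invr_gt0.
- by rewrite F1E => x _; exact: cF1.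
- by rewrite F1E; apply/cvg_ex; exists (F a / 2); apply: cvg_at_right_filter; exact: cF1.
- by rewrite F1E; apply/cvg_ex; exists (F b / 2); apply: cvg_at_left_filter; exact: cF1.
- split.
  + by move=> x _; have h := dF x; exact: ex_derive.
  + by apply: cvg_at_right_filter; exact: cF.
  + by apply: cvg_at_left_filter; exact: cF.
- apply: continuous_in_subspaceT => p /set_mem/=; rewrite in_itv/= => /andP[p1 p2].
  have e0 := expR_gt0 (a / 2).
  apply: continuous_V; first by apply: lt_le_trans p1.
  case: sgn => s.
    by rewrite gt_eqF//; apply: lt_le_trans p1; rewrite expR_gt1; lra.
  by rewrite lt_eqF//; apply: (le_lt_trans p2); rewrite expR_lt1; lra.
Qed.

(** The substitution rule concerns continuous functions on segments, whereas
    [V] is singular at $p=1$ and the domain is unbounded in $x$. Both sides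
    are nonnegative, hence limits over an increasing sequence of segments that
    avoid $x=0$. *)
Lemma substitution_bigcup (a_ b_ : nat -> R) (I J : set R) :
    (forall n, a_ n <= b_ n) -> (forall n, 0 < a_ n \/ b_ n < 0) ->
    (forall n, a_ n.+1 <= a_ n) -> (forall n, b_ n <= b_ n.+1) ->
    I = \bigcup_n `[a_ n, b_ n]%classic ->
    J = [set p | 0 < p /\ I (2 * ln p)] ->
  (\int[mu]_(p in J) (V p)%:E = \int[mu]_(x in I) (K x * (expR (x / 2) / 2))%:E)%E.
Proof.
move=> ab sgn da ib IE JE.
have JU : J = \bigcup_n `[expR (a_ n / 2), expR (b_ n / 2)]%classic.
  rewrite JE IE; apply/seteqP; split => [p [p0 [n _]]|p [n _]]; rewrite /= !in_itv/= => /andP[h1 h2].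
    exists n => //=; rewrite in_itv/= -(lnK p0) !ler_expR; lra.
  have p0 : 0 < p by apply: lt_le_trans h1; exact: expR_gt0.
  split => //; exists n => //=; rewrite in_itv/=.
  by move: h1 h2; rewrite -{1 2}(lnK p0) !ler_expR; lra.
have mV := @measurable_V R.
have mK : measurable_fun setT (fun x : R => K x * (expR (x / 2) / 2)).
  apply: measurable_funM; first exact: measurable_K.
  apply: measurable_funM => //; apply: (measurableT_comp (@measurable_expR R)).
  exact: mulrr_measurable.
have c1 : (\int[mu]_(p in `[expR (a_ n / 2), expR (b_ n / 2)]) (V p)%:E)%E @[n --> \oo]
   --> (\int[mu]_(p in J) (V p)%:E)%E.
  rewrite JU; apply: ge0_nondecreasing_set_cvg_integral.
  - apply/nondecreasing_seqP => n; rewrite subsetEset => x; rewrite /= !in_itv/=.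
    move=> /andP[h1 h2]; apply/andP; split.
      by apply: le_trans h1; rewrite ler_expR ler_pM2r// invr_gt0.
    by apply: (le_trans h2); rewrite ler_expR ler_pM2r// invr_gt0.
  - by move=> i; exact: measurable_itv.
  - by move=> i; apply/measurable_EFinP; exact: measurable_funTS.
  - by move=> i x _; rewrite lee_fin V_ge0.
have c2 : (\int[mu]_(x in `[a_ n, b_ n]) (K x * (expR (x / 2) / 2))%:E)%E @[n --> \oo]
   --> (\int[mu]_(x in I) (K x * (expR (x / 2) / 2))%:E)%E.
  rewrite IE; apply: ge0_nondecreasing_set_cvg_integral.
  - apply/nondecreasing_seqP => n; rewrite subsetEset => x; rewrite /= !in_itv/=.
    move=> /andP[h1 h2]; apply/andP; split; first exact: le_trans h1.
    exact: (le_trans h2).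
  - by move=> i; exact: measurable_itv.
  - by move=> i; apply/measurable_EFinP; exact: measurable_funTS.
  - by move=> i x _; rewrite lee_fin mulr_ge0 ?K_ge0// divr_ge0 ?expR_ge0.
apply: cvg_unique c1 _ => //.
rewrite (_ : (fun n => _) = (fun n => \int[mu]_(x in `[a_ n, b_ n]) (K x * (expR (x / 2) / 2))%:E)%E) //.
by apply/funext => n; exact: substitution_segment.
Qed.

Lemma integral_V_neg :
  (\int[mu]_(p in `]0%R, 1%R[) (V p)%:E =
   \int[mu]_(x in `]-oo, 0%R[) (K x * (expR (x / 2) / 2))%:E)%E.
Proof.
apply: (@substitution_bigcup (fun n => - n.+1%:R) (fun n => - n.+1%:R^-1)).
- by move=> n; rewrite lerN2; apply: (@le_trans _ _ 1); rewrite ?invf_le1// ?ler1n.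
- by move=> n; right; rewrite oppr_lt0 invr_gt0.
- by move=> n; rewrite lerN2 ler_nat.
- by move=> n; rewrite lerN2 lef_pV2 ?posrE// ler_nat.
- apply/seteqP; split=> [x|x [n _]]; rewrite /= !in_itv/=.
    move=> x0; have nx0 : 0 < - x by lra.
    have [n nx] := ltr_add_invr nx0.
    pose m := maxn n (Num.truncn (- x)).
    exists m => //=; rewrite in_itv/=; apply/andP; split.
      rewrite lerNl; apply: ltW; apply: lt_le_trans (truncnS_gt _) _.
      by rewrite ler_nat ltnS leq_maxr.
    rewrite lerNr; move: nx; rewrite add0r => /ltW; apply: le_trans.
    by rewrite lef_pV2 ?posrE// ler_nat ltnS leq_maxl.
  by move=> /andP[_]; move/le_lt_trans; apply; rewrite oppr_lt0 invr_gt0.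
- apply/seteqP; split=> [p|p [p0]]; rewrite /= !in_itv/=.
    by move=> /andP[p0 p1]; split=> //; have := @ln_lt0 R p; rewrite p0 p1 => /(_ isT); lra.
  rewrite p0/= ltNge => h; rewrite ltNge; apply: contra h => /ln_ge0; lra.
Qed.

Lemma integral_V_pos :
  (\int[mu]_(p in `]1%R, +oo[) (V p)%:E =
   \int[mu]_(x in `]0%R, +oo[) (K x * (expR (x / 2) / 2))%:E)%E.
Proof.
apply: (@substitution_bigcup (fun n => n.+1%:R^-1) (fun n => n.+1%:R)).
- by move=> n; apply: (@le_trans _ _ 1); rewrite ?invf_le1// ?ler1n.
- by move=> n; left; rewrite invr_gt0.
- by move=> n; rewrite lef_pV2 ?posrE// ler_nat.
- by move=> n; rewrite ler_nat.
- apply/seteqP; split=> [x|x [n _]]; rewrite /= !in_itv/= ?andbT.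
    move=> x0; have [n nx] := ltr_add_invr x0.
    pose m := maxn n (Num.truncn x).
    exists m => //=; rewrite in_itv/=; apply/andP; split; last first.
      apply: ltW; apply: lt_le_trans (truncnS_gt _) _.
      by rewrite ler_nat ltnS leq_maxr.
    move: nx; rewrite add0r => /ltW; apply: le_trans.
    by rewrite lef_pV2 ?posrE// ler_nat ltnS leq_maxl.
  by move=> /andP[h _]; apply: lt_le_trans h; rewrite invr_gt0.
- apply/seteqP; split=> [p|p [p0]]; rewrite /= !in_itv/= !andbT.
    by move=> p1; split; [lra|have := ln_gt0 p1; lra].
  move=> h; rewrite ltNge; apply/negP => /ln_le0; lra.
Qed.

Lemma gammaE : gamma = - Int (fun x : R => K x * expR (1 / 2 * x)).
Proof.
have mV := @measurable_V R.
have V1 : V (1 : R) = 0 by rewrite V_out ?ltxx ?andbF.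
pose G x : R := K x * (expR (x / 2) / 2).
have GL : L1 G.
  have h := L1_Z 2^-1 (@L1_K_exp (1 / 2) ltac:(lra) ltac:(lra)).
  by apply: eq_L1 h => x; rewrite /G (_ : 1 / 2 * x = x / 2); [ring|ring].
have mG := L1_meas GL.
have mr (f : R -> R) (D : set R) : measurable D -> measurable_fun setT f ->
    measurable_fun setT ((fun x => (f x)%:E) \_ D).
  move=> mD mf; apply/(measurable_restrictT _ mD).
  by apply/measurable_EFinP; exact: measurable_funTS.
have E : (\int[mu]_(p in `]0%R, +oo[) (V p)%:E = \int[mu]_x (G x)%:E)%E.
  transitivity (\int[mu]_(p in `]0%R, 1%R[) (V p)%:E + \int[mu]_(p in `]1%R, +oo[) (V p)%:E)%E.
    rewrite integral_mkcond [X in (_ = X + _)%E]integral_mkcond [X in (_ = _ + X)%E]integral_mkcond.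
    rewrite -ge0_integralD//=.
    - apply: eq_integral => p _; rewrite !patchE !mem_setE !in_itv/= !andbT.
      have [p1|p1|->] := ltgtP (p : R) 1.
      + by rewrite andbT adde0.
      + by rewrite andbF add0e (lt_trans ltr01 p1).
      + by rewrite V1 ltr01 andbF adde0.
    - by move=> x _; apply: erestrict_ge0 => y _; rewrite lee_fin V_ge0.
    - by apply: mr.
    - by move=> x _; apply: erestrict_ge0 => y _; rewrite lee_fin V_ge0.
    - by apply: mr.
  rewrite integral_V_neg integral_V_pos.
  rewrite [X in (X + _ = _)%E]integral_mkcond [X in (_ + X = _)%E]integral_mkcond.
  rewrite -ge0_integralD//=.
  - apply: eq_integral => x _; rewrite !patchE !mem_setE !in_itv/= !andbT.
    have [p1|p1|->] := ltgtP (x : R) 0.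
    + by rewrite adde0.
    + by rewrite add0e.
    + by rewrite /G (_ : K (0 : R) = 0) ?mul0r ?adde0// /K mul0r expR0.
  - by move=> x _; apply: erestrict_ge0 => y _; rewrite lee_fin mulr_ge0 ?K_ge0// divr_ge0 ?expR_ge0.
  - by apply: mr.
  - by move=> x _; apply: erestrict_ge0 => y _; rewrite lee_fin mulr_ge0 ?K_ge0// divr_ge0 ?expR_ge0.
  - by apply: mr.
rewrite /gamma /gammaN /Rintegral E -Int_EFin//= mulrN -Int_Z//; congr (- _).
by apply: eq_Int => x; rewrite /G (_ : 1 / 2 * x = x / 2); [field|ring].
Qed.

Lemma Int_gt0 (f : R -> R) : L1 f -> (forall x, 0 <= f x) ->
  (forall x, x != 0 -> 0 < f x) -> 0 < Int f.
Proof.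
move=> fi f0 fpos; rewrite lt_neqAle Int_ge0// andbT eq_sym; apply/eqP => I0.
have I1 : (\int[mu]_(x in setT) `|(EFin \o f) x| = 0)%E.
  by under eq_integral do rewrite /= ger0_norm//; rewrite -Int_EFin// I0.
have h := (ae_eq_integral_abs mu measurableT ((measurable_EFinP _ _).2 (L1_meas fi))).1 I1.
have : {ae mu, forall x : R, False}.
  apply: ae_imp2 h (ae_neq2 0 0) => x /= /(_ I)[fx] [x0 _].
  by move/eqP: x0 => /fpos; rewrite fx ltxx.
move=> [A [mA A0 sub]].
have AT : A = setT by apply/seteqP; split=> // x _; apply: sub.
have : (mu (`[0%R, 1%R]%classic : set R) <= mu A)%E by apply: le_measure; rewrite ?inE// AT.
by rewrite A0 lebesgue_measure_itv/= lte_fin ltr01 oppr0 adde0 lee_fin ler10.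
Qed.

(** The number $\gamma+\hat K(3i/4)$. *)
Definition rate : R := gamma + Int (fun x : R => K x * expR (3 / 4 * x)).

(** Put $k(x)=K(x)e^{3x/4}$. Evenness of $k$ gives
    $-2\gamma=\int k\,(e^{x/4}+e^{-x/4})$, so that $-2$ times the rate is
    $\int k\,(e^{x/8}-e^{-x/8})^2$. *)
Lemma rate_lt0 : rate < 0.
Proof.
pose k x : R := K x * expR (3 / 4 * x).
have kL : L1 k by apply: L1_K_exp; lra.
have h1 : L1 (fun x => k x * expR (- (1 / 4) * x)).
  have h := @L1_K_exp (1 / 2) ltac:(lra) ltac:(lra).
  by apply: eq_L1 h => x; rewrite /k -[RHS]mulrA -expRD; congr (_ * expR _); field.
have h2 : L1 (fun x => k x * expR (1 / 4 * x)).
  have h := @L1_K_exp 1 ltac:(lra) ltac:(lra).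
  by apply: eq_L1 h => x; rewrite /k -[RHS]mulrA -expRD; congr (_ * expR _); field.
have e1 : gamma = - Int (fun x => k x * expR (- (1 / 4) * x)).
  rewrite gammaE; congr (- _); apply: eq_Int => x.
  by rewrite /k -[RHS]mulrA -expRD; congr (_ * expR _); field.
have e2 : Int (fun x => k x * expR (- (1 / 4) * x)) = Int (fun x => k x * expR (1 / 4 * x)).
  rewrite -(Int_opp h2); apply: eq_Int => x.
  by rewrite /k -K_inv mulrN mulNr.
have P : 0 < Int (fun x => k x * expR (- (1 / 4) * x) + k x * expR (1 / 4 * x) - 2 * k x).
  have E x : k x * expR (- (1 / 4) * x) + k x * expR (1 / 4 * x) - 2 * k x =
     k x * (expR (x / 8) - expR (- x / 8)) ^+ 2.
    have -> : expR (- (1 / 4) * x) = expR (- x / 8) ^+ 2.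
      by rewrite -expRM_natl; congr expR; field.
    have -> : expR (1 / 4 * x) = expR (x / 8) ^+ 2.
      by rewrite -expRM_natl; congr expR; field.
    have : expR (x / 8) * expR (- x / 8) = 1 by rewrite -expRD -mulrDl subrr mul0r expR0.
    move: (expR (x / 8)) (expR (- x / 8)) => s t st.
    by rewrite sqrrB st; ring.
  apply: Int_gt0.
  - by apply: L1_B; [exact: L1_D|exact: L1_Z].
  - by move=> x; rewrite E mulr_ge0 ?sqr_ge0// mulr_ge0 ?K_ge0 ?expR_ge0.
  - move=> x x0; rewrite E mulr_gt0//.
      by rewrite mulr_gt0 ?expR_gt0// K_pos.
    rewrite lt_neqAle sqr_ge0 andbT eq_sym sqrf_eq0 subr_eq0.
    by apply: contra x0 => /eqP/expR_inj h; apply/eqP; lra.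
move: P; rewrite Int_B; [|exact: L1_D|exact: L1_Z].
rewrite (Int_D h1 h2) (Int_Z _ kL) -e2 /rate -/k e1.
by move: (Int _) (Int _) => s t; lra.
Qed.

End KernelIntegrals.

(** * The complex exponential series in real form *)
Section PlanarExp.
Context {R : realType}.
Implicit Types (A B : nat -> R) (c s t r M : R).

(** Exponential generating function of the sequence [A]. *)
Definition egf A t : R := limn (series (fun n => t ^+ n / n`!%:R * A n)).

Lemma pseries_egf A t : pseries (fun n => A n / n`!%:R) t =
  series (fun n => t ^+ n / n`!%:R * A n).
Proof.
by rewrite /pseries; congr series; apply/funext => n /=; rewrite mulrAC [A n * _]mulrC mulrAC.
Qed.

Lemma egf_cvg A M r t : 0 <= r -> (forall n, `|A n| <= M * r ^+ n) ->
  cvgn (series (fun n => t ^+ n / n`!%:R * A n)).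
Proof.
move=> r0 AM; apply: normed_cvg.
have M0 : 0 <= M by have := AM 0%N; rewrite expr0 mulr1; apply: le_trans.
apply: (@series_le_cvg _ _ (fun n => M * exp_coeff (r * `|t|) n)).
- by move=> n /=.
- by move=> n; rewrite mulr_ge0// exp_coeff_ge0// mulr_ge0.
- move=> n /=; rewrite /exp_coeff /= exprMn !normrM normrX normfV normr_nat.
  rewrite [leRHS](_ : _ = `|t| ^+ n / n`!%:R * (M * r ^+ n)); last by ring.
  by rewrite ler_wpM2l// divr_ge0// exprn_ge0.
- by apply: is_cvg_seriesZ; exact: is_cvg_series_exp_coeff.
Qed.

Lemma pseries_diffs_fact A :
  pseries_diffs (fun n => A n / n`!%:R) = (fun n => A n.+1 / n`!%:R).
Proof.
apply/funext => n; rewrite /pseries_diffs factS natrM invfM.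
by rewrite mulrCA mulrA mulrA mulfK// mulrC.
Qed.

Lemma is_derive_egf A M r t : 0 <= r -> (forall n, `|A n| <= M * r ^+ n) ->
  is_derive t 1 (egf A) (egf (fun n => A n.+1) t).
Proof.
move=> r0 AM.
have AM1 n : `|A n.+1| <= (M * r) * r ^+ n by rewrite -mulrA -exprS.
have AM2 n : `|A n.+2| <= (M * r * r) * r ^+ n by rewrite -mulrA -exprS.
have E B : egf B = (fun x => limn (pseries (fun n => B n / n`!%:R) x)).
  by apply/funext => x; rewrite pseries_egf.
rewrite !E -(pseries_diffs_fact A).
apply: (@pseries_snd_diffs _ _ (`|t| + 1)).
- by rewrite pseries_egf; exact: egf_cvg AM.
- by rewrite pseries_diffs_fact pseries_egf; exact: egf_cvg AM1.
- by rewrite !pseries_diffs_fact pseries_egf; exact: egf_cvg AM2.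
- by rewrite [ltRHS]ger0_norm ?addr_ge0// ltrDl.
Qed.

Lemma egf0 A : egf A 0 = A 0%N.
Proof.
apply/cvg_lim => //; rewrite -cvg_shiftS /=.
apply: cvg_near_cst; apply: nearW => n; rewrite /series/=.
rewrite big_nat_recl//= expr0 fact0 divr1 mul1r big1 ?addr0// => i _.
by rewrite expr0n/= mul0r mul0r.
Qed.

Lemma is_derive_1_cst (f df : R -> R) : (forall x : R, is_derive x 1 f (df x)) ->
  (forall x, df x = 0) -> forall x y, f x = f y.
Proof.
move=> fd df0 x y; apply: is_derive_0_is_cst => z.
by have := fd z; rewrite df0.
Qed.

(** The recursion says $A_n+iB_n=(c+is)^n(A_0+iB_0)$. The generating functions
    then solve $X'+iY'=(c+is)(X+iY)$, and multiplying by $e^{-(c+is)t}$ shows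
    that they are $e^{(c+is)t}(A_0+iB_0)$. *)
Section spiral.
Variables (A B : nat -> R) (c s : R).
Hypothesis AS : forall n, A n.+1 = c * A n - s * B n.
Hypothesis BS : forall n, B n.+1 = s * A n + c * B n.

Let r := `|c| + `|s|.
Let M := `|A 0%N| + `|B 0%N|.
Let r0 : 0 <= r. Proof. by rewrite addr_ge0. Qed.

Let AB_le n : `|A n| <= M * r ^+ n /\ `|B n| <= M * r ^+ n.
Proof.
elim: n => [|n [IA IB]]; first by rewrite expr0 mulr1 /M lerDl lerDr.
rewrite AS BS exprS mulrCA /r mulrDl; split.
  by apply: (le_trans (ler_normB _ _)); rewrite !normrM lerD// ler_wpM2l.
by apply: (le_trans (ler_normD _ _)); rewrite !normrM addrC lerD// ler_wpM2l.
Qed.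

Let AM n := (AB_le n).1.
Let BM n := (AB_le n).2.

Let X := egf A.
Let Y := egf B.

Let cA t : cvgn (series (fun n => t ^+ n / n`!%:R * A n)).
Proof. exact: egf_cvg AM. Qed.
Let cB t : cvgn (series (fun n => t ^+ n / n`!%:R * B n)).
Proof. exact: egf_cvg BM. Qed.

Let dX t : is_derive t 1 X (c * X t - s * Y t).
Proof.
have -> : c * X t - s * Y t = egf (fun n => A n.+1) t; last exact: is_derive_egf AM.
apply/esym/cvg_lim => //.
rewrite (_ : series _ = (fun n => c * series (fun n => t ^+ n / n`!%:R * A n) n -
   s * series (fun n => t ^+ n / n`!%:R * B n) n)).
  by apply: cvgB; (apply: cvgM; first exact: cvg_cst); [exact: cA|exact: cB].
apply/funext => n; rewrite /series/= !big_distrr/= -sumrB; apply: eq_bigr => i _.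
by rewrite AS; ring.
Qed.

Let dY t : is_derive t 1 Y (s * X t + c * Y t).
Proof.
have -> : s * X t + c * Y t = egf (fun n => B n.+1) t; last exact: is_derive_egf BM.
apply/esym/cvg_lim => //.
rewrite (_ : series _ = (fun n => s * series (fun n => t ^+ n / n`!%:R * A n) n +
   c * series (fun n => t ^+ n / n`!%:R * B n) n)).
  by apply: cvgD; (apply: cvgM; first exact: cvg_cst); [exact: cA|exact: cB].
apply/funext => n; rewrite /series/= !big_distrr/= -big_split/=; apply: eq_bigr => i _.
by rewrite BS; ring.
Qed.

Let dE t : is_derive t 1 (fun t => expR (- c * t)) (- c * expR (- c * t)).
Proof. exact: is_derive_comp_scale. Qed.
Let dC t : is_derive t 1 (fun t => cos (s * t)) (s * - sin (s * t)).
Proof. exact: is_derive_comp_scale. Qed.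
Let dS t : is_derive t 1 (fun t => sin (s * t)) (s * cos (s * t)).
Proof. exact: is_derive_comp_scale. Qed.

Let Z1 t : expR (- c * t) * (X t * cos (s * t) + Y t * sin (s * t)) = A 0%N.
Proof.
have h1 u := is_deriveD (is_deriveM (dX u) (dC u)) (is_deriveM (dY u) (dS u)).
have h2 u := is_deriveM (dE u) (h1 u).
have := is_derive_1_cst h2 _ t 0; rewrite !fctE /= => -> .
  by rewrite !mulr0 expR0 cos0 sin0 mulr0 addr0 mulr1 mul1r /X egf0.
by move=> x; rewrite /GRing.scale/=; ring.
Qed.

Let Z2 t : expR (- c * t) * (Y t * cos (s * t) - X t * sin (s * t)) = B 0%N.
Proof.
have h1 u := is_deriveB (is_deriveM (dY u) (dC u)) (is_deriveM (dX u) (dS u)).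
have h2 u := is_deriveM (dE u) (h1 u).
have := is_derive_1_cst h2 _ t 0; rewrite !fctE /= => -> .
  by rewrite !mulr0 expR0 cos0 sin0 mulr0 subr0 mulr1 mul1r /Y egf0.
by move=> x; rewrite /GRing.scale/=; ring.
Qed.

Theorem egf_spiral t :
  series (fun n => t ^+ n / n`!%:R * A n) @ \oo -->
    expR (t * c) * (cos (t * s) * A 0%N - sin (t * s) * B 0%N) /\
  series (fun n => t ^+ n / n`!%:R * B n) @ \oo -->
    expR (t * c) * (sin (t * s) * A 0%N + cos (t * s) * B 0%N).
Proof.
have e1 : expR (t * c) * expR (- c * t) = 1.
  by rewrite -expRD (_ : t * c + - c * t = 0) ?expR0//; ring.
have cs := cos2Dsin2 (s * t).
have XE : X t = expR (t * c) * (cos (t * s) * A 0%N - sin (t * s) * B 0%N).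
  rewrite -(Z1 t) -(Z2 t) [t * s]mulrC.
  transitivity (X t * (expR (t * c) * expR (- c * t)) * (cos (s * t) ^+ 2 + sin (s * t) ^+ 2)).
    by rewrite e1 cs !mulr1.
  by ring.
have YE : Y t = expR (t * c) * (sin (t * s) * A 0%N + cos (t * s) * B 0%N).
  rewrite -(Z1 t) -(Z2 t) [t * s]mulrC.
  transitivity (Y t * (expR (t * c) * expR (- c * t)) * (cos (s * t) ^+ 2 + sin (s * t) ^+ 2)).
    by rewrite e1 cs !mulr1.
  by ring.
by split; [rewrite -XE; exact: cA|rewrite -YE; exact: cB].
Qed.

End spiral.
End PlanarExp.

(** * Convolution with the kernel on exponentially bounded functions *)
Section Convolution.
Context {R : realType}.
Local Notation mu := (@lebesgue_measure R).
Variable beta : R.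
Hypothesis beta1 : 3 / 4 < beta.
Hypothesis beta2 : beta <= 7 / 4.
Implicit Types (a b f g phi : R -> R) (u x y z c s t sg C : R).

(** A minimum of two pure exponentials $e^{-\sigma x}$, with $\sigma=-1/4$ and
    $\sigma=\beta$: convolution with [K] multiplies each of them by a constant,
    so it preserves the bound by their minimum up to a constant. The two
    exponents are within the range of [L1_K_exp]. *)
Definition envelope x : R := Num.min (expR (- (- (1 / 4)) * x)) (expR (- beta * x)).

Lemma envelope_ge0 x : 0 <= envelope x.
Proof. by rewrite le_min !expR_ge0. Qed.

Let rate0 : R := Num.min (1 / 4) (beta - 3 / 4).

Let rate0_gt0 : 0 < rate0.
Proof. by rewrite /rate0 lt_min subr_gt0 beta1 divr_gt0. Qed.

(** As $\beta>3/4$, all the weights $e^{\sigma x}$ with $0\le\sigma\le 3/4$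
    leave exponential decay on both sides. *)
Lemma envelope_tilt_le sg x : 0 <= sg -> sg <= 3 / 4 ->
  envelope x * expR (sg * x) <= pweight rate0 x.
Proof.
move=> s0 s1; have [x0|x0] := leP 0 x.
  apply: (@le_trans _ _ (expR (- beta * x) * expR (sg * x))).
    by rewrite ler_wpM2r ?expR_ge0// ge_min lexx orbT.
  rewrite -expRD /pweight ler_expR ger0_norm//.
  have : rate0 <= beta - 3 / 4 by rewrite ge_min lexx orbT.
  by nra.
apply: (@le_trans _ _ (expR (- (- (1 / 4)) * x) * expR (sg * x))).
  by rewrite ler_wpM2r ?expR_ge0// ge_min lexx.
rewrite -expRD /pweight ler_expR ltr0_norm//.
have : rate0 <= 1 / 4 by rewrite ge_min lexx.
by nra.
Qed.

(** The bound holds at every point, not just almost everywhere, so that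
    convolutions and series of such functions are defined everywhere. *)
Definition enveloped a C : Prop :=
  measurable_fun setT a /\ forall x, `|a x| <= C * envelope x.

(** The transform of [tilt sg a] at $u$ is the transform of [a] at
    $u+i\sigma$. *)
Definition tilt sg a x : R := a x * expR (sg * x).

Lemma measurable_tilt sg a : measurable_fun setT a -> measurable_fun setT (tilt sg a).
Proof.
move=> ma; apply: measurable_funM => //.
by apply: (measurableT_comp (@measurable_expR R)); exact: mulrl_measurable.
Qed.

Lemma env_C0 a C : enveloped a C -> 0 <= C.
Proof.
move=> [_ /(_ 0)]; rewrite /envelope !mulr0 expR0 minxx mulr1.
by apply: le_trans.
Qed.

Lemma tilt_L1b a C sg : enveloped a C -> 0 <= sg -> sg <= 3 / 4 -> L1b (tilt sg a).
Proof.
move=> aE s0 s1; have C0 := env_C0 aE; have [ma aC] := aE.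
have h x : `|tilt sg a x| <= C * pweight rate0 x.
  rewrite /tilt normrM (ger0_norm (expR_ge0 _)).
  apply: (@le_trans _ _ (C * envelope x * expR (sg * x))).
    by rewrite ler_wpM2r ?expR_ge0.
  by rewrite -mulrA ler_wpM2l// envelope_tilt_le.
split.
  apply: (L1_dom (measurable_tilt sg ma) _ h).
  exact: L1_Z (pweight_L1 rate0_gt0).1.
exists C => x; apply: (le_trans (h x)); rewrite ler_piMr// /pweight.
by rewrite expR_le1 mulNr oppr_le0 mulr_ge0// ltW.
Qed.

Lemma env_L1 a C : enveloped a C -> L1 a.
Proof.
move=> aE; have [h _] := @tilt_L1b a C 0 aE (lexx _) ltac:(lra).
by apply: eq_L1 h => x; rewrite /tilt mul0r expR0 mulr1.
Qed.

Lemma tilt_abs sg a x : tilt sg (fun x => `|a x|) x = `|tilt sg a x|.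
Proof. by rewrite /tilt normrM (ger0_norm (expR_ge0 _)). Qed.

Lemma env_abs a C : enveloped a C -> enveloped (fun x => `|a x|) C.
Proof.
move=> [ma aC]; split; first exact: measurableT_comp.
by move=> x; rewrite normr_id.
Qed.

Lemma env_envelope : enveloped envelope 1.
Proof.
split; last by move=> x; rewrite mul1r ger0_norm ?envelope_ge0.
apply: measurable_minr;
  by apply: (measurableT_comp (@measurable_expR R)); exact: mulrl_measurable.
Qed.

Lemma envelope_L1 : L1 envelope.
Proof. exact: env_L1 env_envelope. Qed.

(** ** The convolution operator *)

(** Convolution with [K] multiplies $e^{-\sigma x}$ by [Kint sg], which is
    $\hat K(i\sigma)$. *)
Definition Kint sg : R := Int (fun y => K y * expR (sg * y)).

Definition conv_gain : R := Num.max (Kint (- (1 / 4))) (Kint beta).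

Definition conv a x : R := Int (fun y => K y * a (x - y)).

Let KL sg : - (1 / 4) <= sg -> sg <= 7 / 4 -> L1 (fun y : R => K y * expR (sg * y)).
Proof. exact: L1_K_exp. Qed.

Let L1K : L1 (@K R).
Proof.
by apply: eq_L1 (KL _ _ : L1 (fun y : R => K y * expR (0 * y))) => [x||]; rewrite ?mul0r ?expR0 ?mulr1//; lra.
Qed.

Lemma envelope_le1 x : envelope x <= 1.
Proof.
have b1 := beta1; rewrite ge_min; have [x0|x0] := leP 0 x; apply/orP; [right|left];
  rewrite expR_le1.
  by rewrite mulNr oppr_le0 mulr_ge0//; lra.
by rewrite opprK; lra.
Qed.

Lemma env_bdd a C : enveloped a C -> forall x, `|a x| <= C.
Proof.
move=> aE x; apply: (le_trans (aE.2 x)); rewrite ler_piMr ?envelope_le1//.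
exact: env_C0 aE.
Qed.

Lemma L1_conv_int a C x : enveloped a C -> L1 (fun y => K y * a (x - y)).
Proof.
move=> aE; apply: (@L1_M _ C) => //; last by move=> y; exact: env_bdd aE _.
have -> : (fun y => a (x - y)) = (fun y => (fun z => a (z + x)) (- y)).
  by apply/funext => y; rewrite addrC.
by apply: (@measurable_opp R (fun z => a (z + x))); apply: measurable_shift; exact: aE.1.
Qed.

Lemma conv_le_exp a C sg D : enveloped a C -> - (1 / 4) <= sg -> sg <= 7 / 4 ->
    (forall x, `|a x| <= D * expR (- sg * x)) ->
  forall x, Int (fun y => `|K y * a (x - y)|) <= D * Kint sg * expR (- sg * x).
Proof.
move=> aE s1 s2 aD x.
have -> : D * Kint sg * expR (- sg * x) =
    Int (fun y => D * expR (- sg * x) * (K y * expR (sg * y))).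
  by rewrite Int_Z; [rewrite /Kint; ring|exact: KL].
apply: Int_le; [exact: L1_abs (L1_conv_int x aE)|by apply: L1_Z; exact: KL|].
move=> y; rewrite normrM ger0_norm ?K_ge0//.
rewrite [leRHS](_ : _ = K y * (D * (expR (- sg * x) * expR (sg * y)))); last by ring.
rewrite ler_wpM2l ?K_ge0// -expRD; apply: (le_trans (aD _)).
by rewrite le_eqVlt; apply/orP; left; apply/eqP; congr (_ * expR _); ring.
Qed.

Lemma conv_abs_le a C x : enveloped a C ->
  Int (fun y => `|K y * a (x - y)|) <= C * conv_gain * envelope x.
Proof.
have b1 := beta1; have b2 := beta2.
move=> aE; have C0 := env_C0 aE; have [_ aC] := aE.
have K0 sg : 0 <= Kint sg by apply: Int_ge0 => y; rewrite mulr_ge0 ?K_ge0 ?expR_ge0.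
have Ck sg : Kint sg <= conv_gain -> forall e, 0 <= e -> C * Kint sg * e <= C * conv_gain * e.
  by move=> h e e0; rewrite ler_wpM2r// ler_wpM2l.
rewrite /envelope [C * conv_gain * _]mulrC minr_pMl; last first.
  by rewrite mulr_ge0// le_max K0.
rewrite le_min ![expR _ * (C * conv_gain)]mulrC; apply/andP; split.
  apply: le_trans (_ : C * Kint (- (1 / 4)) * expR (- - (1 / 4) * x) <= _).
    apply: (conv_le_exp aE) => [||z]; [lra|lra|].
    by apply: (le_trans (aC z)); rewrite ler_wpM2l// ge_min lexx.
  by apply: Ck; rewrite ?expR_ge0// le_max lexx.
apply: le_trans (_ : C * Kint beta * expR (- beta * x) <= _).
  apply: (conv_le_exp aE) => [||z]; [lra|lra|].
  by apply: (le_trans (aC z)); rewrite ler_wpM2l// ge_min lexx orbT.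
by apply: Ck; rewrite ?expR_ge0// le_max lexx orbT.
Qed.

Lemma measurable_conv_kernel a : measurable_fun setT a ->
  measurable_fun setT (fun z : R * R => K z.2 * a (z.1 - z.2)).
Proof.
move=> ma; apply: measurable_funM; first exact: measurable_snd_comp (@measurable_K R).
exact: measurable_sub_comp.
Qed.

Lemma env_conv a C : enveloped a C -> enveloped (conv a) (C * conv_gain).
Proof.
move=> aE; have [ma aC] := aE; split; last first.
  move=> x; apply: le_trans (Int_abs (L1_conv_int x aE)) _; exact: conv_abs_le.
have [||||h _ _] := @Fubini_real R (fun x y => K y * a (x - y)) (fun x => C * conv_gain * envelope x).
- exact: measurable_conv_kernel.
- by apply: L1_Z; exact: envelope_L1.
- by move=> x; exact: L1_conv_int aE.
- by move=> x; exact: conv_abs_le.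
exact: L1_meas h.
Qed.

(** Fubini and translation. Choosing for [phi] a cosine, a sine or 1 gives the
    action of the convolution on transforms and on weighted norms. *)
Lemma Int_conv a C sg phi : enveloped a C -> 0 <= sg -> sg <= 3 / 4 ->
    measurable_fun setT phi -> (forall x, `|phi x| <= 1) ->
  Int (fun x => tilt sg (conv a) x * phi x) =
  Int (fun y => tilt sg K y * Int (fun z => tilt sg a z * phi (z + y))).
Proof.
move=> aE s0 s1 mphi phi1; have [ma aC] := aE.
have C0 := env_C0 aE.
have caE := env_conv aE.
have [taL _] := tilt_L1b aE s0 s1.
pose F x y := K y * a (x - y) * (expR (sg * x) * phi x).
have wsL : L1 (fun x => C * conv_gain * (envelope x * expR (sg * x))).
  have wE := env_envelope.
  by apply: L1_Z; exact: (tilt_L1b wE s0 s1).1.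
have FL x : L1 (F x).
  have h := L1_Z (expR (sg * x) * phi x) (L1_conv_int x aE).
  by apply: eq_L1 h => y; rewrite /F mulrC.
have [||h1 h2 h3] := @Fubini_real R F (fun x => C * conv_gain * (envelope x * expR (sg * x))) _ wsL FL.
- apply: measurable_funM; first exact: measurable_conv_kernel.
  apply: (@measurable_fst_comp R (fun x => expR (sg * x) * phi x)).
  apply: measurable_funM => //; apply: (measurableT_comp (@measurable_expR R)).
  exact: mulrl_measurable.
- move=> x; have -> : Int (fun y => `|F x y|) =
      `|expR (sg * x) * phi x| * Int (fun y => `|K y * a (x - y)|).
    rewrite -Int_Z; last exact: L1_abs (L1_conv_int x aE).
    by apply: eq_Int => y; rewrite /F normrM mulrC.
  rewrite mulrA; rewrite mulrC; apply: ler_pM => //.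
  + by apply: Int_ge0.
  + exact: conv_abs_le.
  + by rewrite normrM (ger0_norm (expR_ge0 _)) ler_piMr ?expR_ge0.
transitivity (Int (fun x => Int (F x))).
  apply: eq_Int => x; rewrite /tilt /conv -mulrA mulrC -Int_Z; last exact: L1_conv_int aE.
  by apply: eq_Int => y; rewrite /F mulrC.
rewrite h3; apply: eq_Int => y.
have Gm : L1 (fun z => tilt sg a z * phi (z + y)).
  by apply: (@L1_M _ 1) => //; apply: measurable_shift.
rewrite -Int_Z//.
have Gm2 := L1_Z (tilt sg K y) Gm.
rewrite -(Int_shift (- y) Gm2); apply: eq_Int => x.
rewrite /F /tilt subrK.
have -> : expR (sg * x) = expR (sg * y) * expR (sg * (x - y)).
  by rewrite -expRD -mulrDr addrC subrK.
by ring.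
Qed.

Lemma tilt_K_L1 sg : 0 <= sg -> sg <= 3 / 4 -> L1 (tilt sg (@K R)).
Proof. by move=> s0 s1; apply: KL; lra. Qed.

(** This lemma and the next are the real and imaginary parts of the
    multiplication of transforms. *)
Lemma cosT_conv a C sg u : enveloped a C -> 0 <= sg -> sg <= 3 / 4 ->
  cosT (tilt sg (conv a)) u = cosT (tilt sg K) u * cosT (tilt sg a) u
     - sinT (tilt sg K) u * sinT (tilt sg a) u.
Proof.
move=> aE s0 s1; have kL := tilt_K_L1 s0 s1; have [aL _] := tilt_L1b aE s0 s1.
have mc := @measurable_cosM R u.
rewrite {1}/cosT (Int_conv aE s0 s1 mc); last by move=> x; exact: cos_max.
have E y : Int (fun z => tilt sg a z * cos ((z + y) * u)) =
   cos (y * u) * cosT (tilt sg a) u - sin (y * u) * sinT (tilt sg a) u.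
  rewrite /cosT /sinT -(Int_Z _ (L1_Mcos u aL)) -(Int_Z _ (L1_Msin u aL)).
  rewrite -Int_B; [|by apply: L1_Z; exact: L1_Mcos|by apply: L1_Z; exact: L1_Msin].
  by apply: eq_Int => z; rewrite mulrDl cosD; ring.
transitivity (Int (fun y => cosT (tilt sg a) u * (tilt sg K y * cos (y * u))
   - sinT (tilt sg a) u * (tilt sg K y * sin (y * u)))).
  by apply: eq_Int => y; rewrite E; ring.
rewrite Int_B; [|by apply: L1_Z; exact: L1_Mcos|by apply: L1_Z; exact: L1_Msin].
rewrite (Int_Z _ (L1_Mcos u kL)) (Int_Z _ (L1_Msin u kL)).
by rewrite mulrC [X in _ - X]mulrC.
Qed.

Lemma sinT_conv a C sg u : enveloped a C -> 0 <= sg -> sg <= 3 / 4 ->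
  sinT (tilt sg (conv a)) u = sinT (tilt sg K) u * cosT (tilt sg a) u
     + cosT (tilt sg K) u * sinT (tilt sg a) u.
Proof.
move=> aE s0 s1; have kL := tilt_K_L1 s0 s1; have [aL _] := tilt_L1b aE s0 s1.
have mc := @measurable_sinM R u.
rewrite {1}/sinT (Int_conv aE s0 s1 mc); last by move=> x; exact: sin_max.
have E y : Int (fun z => tilt sg a z * sin ((z + y) * u)) =
   cos (y * u) * sinT (tilt sg a) u + sin (y * u) * cosT (tilt sg a) u.
  rewrite /cosT /sinT -(Int_Z _ (L1_Mcos u aL)) -(Int_Z _ (L1_Msin u aL)).
  rewrite -Int_D; [|by apply: L1_Z; exact: L1_Msin|by apply: L1_Z; exact: L1_Mcos].
  by apply: eq_Int => z; rewrite mulrDl sinD; ring.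
transitivity (Int (fun y => sinT (tilt sg a) u * (tilt sg K y * cos (y * u))
   + cosT (tilt sg a) u * (tilt sg K y * sin (y * u)))).
  by apply: eq_Int => y; rewrite E; ring.
rewrite Int_D; [|by apply: L1_Z; exact: L1_Mcos|by apply: L1_Z; exact: L1_Msin].
rewrite (Int_Z _ (L1_Mcos u kL)) (Int_Z _ (L1_Msin u kL)).
by rewrite -/(cosT (tilt sg K) u) -/(sinT (tilt sg K) u); ring.
Qed.

(** Since $K\ge 0$, convolving $|a|$ gives equality, and convolving $a$ gives
    at most that. *)
Lemma Int_abs_conv a C sg : enveloped a C -> 0 <= sg -> sg <= 3 / 4 ->
  Int (fun x => `|tilt sg (conv a) x|) <= Kint sg * Int (fun x => `|tilt sg a x|).
Proof.
move=> aE s0 s1; have aaE := env_abs aE.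
have [aL _] := tilt_L1b aaE s0 s1.
have -> : Kint sg * Int (fun x => `|tilt sg a x|) =
    Int (fun x => tilt sg (conv (fun x => `|a x|)) x * 1).
  rewrite (@Int_conv _ _ _ (fun=> 1) aaE s0 s1) ?normr1//.
  transitivity (Int (fun y => Int (fun x => `|tilt sg a x|) * tilt sg K y)).
    by rewrite Int_Z; [rewrite mulrC|exact: tilt_K_L1].
  apply: eq_Int => y; rewrite mulrC; congr (_ * _); apply: eq_Int => x.
  by rewrite tilt_abs mulr1.
have [cL _] := tilt_L1b (env_conv aE) s0 s1.
have [caL _] := tilt_L1b (env_conv aaE) s0 s1.
apply: Int_le; [exact: L1_abs|by apply: eq_L1 caL => x; rewrite mulr1|].
move=> x; rewrite mulr1 -tilt_abs /tilt ler_wpM2r ?expR_ge0//.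
apply: le_trans (Int_abs (L1_conv_int x aE)) _; rewrite le_eqVlt; apply/orP; left.
by apply/eqP; apply: eq_Int => y; rewrite normrM ger0_norm ?K_ge0.
Qed.

(** ** The exponential of the convolution operator *)

Definition convn n a : R -> R := iter n conv a.

Lemma env_convn n a C : enveloped a C -> enveloped (convn n a) (C * conv_gain ^+ n).
Proof.
move=> aE; elim: n => [|n IH]; first by rewrite expr0 mulr1.
by rewrite exprSr mulrA; exact: env_conv IH.
Qed.

(** Partial sums of $e^{tK*}a$; [sol] restores the factor $e^{t\gamma}$. *)
Definition sol_partial t a N x : R := series (fun n => t ^+ n / n`!%:R * convn n a x) N.

Definition sol_sum t a x : R := limn (sol_partial t a ^~ x).

Definition sol t a x : R := expR (t * gamma) * sol_sum t a x.

Section solution.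
Variables (t : R) (a : R -> R) (C : R).
Hypothesis t0 : 0 <= t.
Hypothesis aE : enveloped a C.

Let C0 : 0 <= C := env_C0 aE.

Let gain_ge0 : 0 <= conv_gain.
Proof.
by rewrite le_max; apply/orP; left; apply: Int_ge0 => y; rewrite mulr_ge0 ?K_ge0 ?expR_ge0.
Qed.

Lemma partial_exp_le c N : 0 <= c -> series (fun n => t ^+ n / n`!%:R * c ^+ n) N <= expR (t * c).
Proof.
move=> c0; rewrite (_ : (fun n => _) = exp_coeff (t * c)); last first.
  by apply/funext => n; rewrite /exp_coeff/= exprMn mulrAC.
apply: nondecreasing_cvgn_le; last exact: is_cvg_series_exp_coeff.
apply/nondecreasing_seqP => n; rewrite seriesSr lerDl exp_coeff_ge0// mulr_ge0//.
Qed.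

Lemma sol_partial_cvg x : sol_partial t a ^~ x @ \oo --> sol_sum t a x.
Proof.
apply: (egf_cvg (M := C * envelope x) (r := conv_gain)) => // n.
by have [_ h] := env_convn n aE; rewrite mulrAC; exact: h.
Qed.

Lemma env_sol_partial N : enveloped (sol_partial t a N) (C * expR (t * conv_gain)).
Proof.
split.
  apply: measurable_sum => n; apply: measurable_funM => //.
  exact: (env_convn n aE).1.
move=> x; apply: (@le_trans _ _ (C * envelope x * series (fun n => t ^+ n / n`!%:R * conv_gain ^+ n) N)).
  rewrite /sol_partial /series/= mulr_sumr.
  apply: (le_trans (ler_norm_sum _ _ _)); apply: ler_sum => n _.
  rewrite normrM ger0_norm; last by rewrite divr_ge0// exprn_ge0.
  rewrite mulrCA ler_wpM2l ?divr_ge0 ?exprn_ge0//.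
  by have [_ h] := env_convn n aE; rewrite mulrAC; exact: h.
rewrite mulrAC ler_wpM2r ?envelope_ge0// ler_wpM2l//; exact: partial_exp_le.
Qed.

Lemma env_sol_sum : enveloped (sol_sum t a) (C * expR (t * conv_gain)).
Proof.
split.
  apply: (measurable_fun_cvg (h := sol_partial t a)).
    by move=> N; exact: (env_sol_partial N).1.
  by move=> x _; exact: sol_partial_cvg.
move=> x; have h : `|sol_partial t a N x| @[N --> \oo] --> `|sol_sum t a x|.
  by apply: cvg_norm; exact: sol_partial_cvg.
rewrite -(cvg_lim _ h)//; apply: limr_le; first by apply/cvg_ex; eexists; exact: h.
by apply: nearW => N; exact: (env_sol_partial N).2.
Qed.

(** The partial sums share one envelope, so weighted integrals may be taken
    term by term. *)
Lemma Int_sol_sum_cvg sg phi : 0 <= sg -> sg <= 3 / 4 -> measurable_fun setT phi ->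
    (forall x, `|phi x| <= 1) ->
  series (fun n => t ^+ n / n`!%:R * Int (fun x => tilt sg (convn n a) x * phi x)) @ \oo
  --> Int (fun x => tilt sg (sol_sum t a) x * phi x).
Proof.
move=> s0 s1 mphi phi1.
have D := env_sol_sum; have D0 := env_C0 D.
have nL n : L1 (fun x => tilt sg (convn n a) x * phi x).
  by apply: (@L1_M _ 1) => //; exact: (tilt_L1b (env_convn n aE) s0 s1).1.
have E N : Int (fun x => tilt sg (sol_partial t a N) x * phi x) =
    series (fun n => t ^+ n / n`!%:R * Int (fun x => tilt sg (convn n a) x * phi x)) N
    /\ L1 (fun x => tilt sg (sol_partial t a N) x * phi x).
  elim: N => [|N [IH IL]].
    have Z : (fun x => tilt sg (sol_partial t a 0) x * phi x) = (fun=> 0).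
      apply/funext => x; rewrite /tilt /sol_partial /series/= big_nil.
      by rewrite !mul0r.
    by rewrite Z; split; [rewrite Int_0 /series/= big_nil|exact: L1_0].
  have S : (fun x => tilt sg (sol_partial t a N.+1) x * phi x) =
    (fun x => tilt sg (sol_partial t a N) x * phi x +
        t ^+ N / N`!%:R * (tilt sg (convn N a) x * phi x)).
    apply/funext => x; rewrite /tilt /sol_partial seriesSr; ring.
  rewrite S; split; last by apply: L1_D => //; exact: L1_Z.
  by rewrite Int_D//; [rewrite Int_Z// seriesSr IH|exact: L1_Z].
rewrite (_ : series _ = (fun N => Int (fun x => tilt sg (sol_partial t a N) x * phi x))); last first.
  by apply/funext => N; rewrite (E N).1.
have wE := env_envelope.
apply: (Int_dom_cvg (g := fun x => C * expR (t * conv_gain) * tilt sg envelope x) _ _ _ _ _).2.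
- by move=> N; exact: L1_meas (E N).2.
- by apply: measurable_funM => //; apply: measurable_tilt; exact: D.1.
- by apply: L1_Z; exact: (tilt_L1b wE s0 s1).1.
- apply: aeW => x; apply: cvgM; last exact: cvg_cst.
  by apply: cvgM; [exact: sol_partial_cvg|exact: cvg_cst].
- move=> N x; rewrite normrM -[leRHS]mulr1; apply: ler_pM => //.
  rewrite /tilt normrM (ger0_norm (expR_ge0 _)) mulrA ler_wpM2r ?expR_ge0//.
  exact: (env_sol_partial N).2.
Qed.

Lemma sol_env : enveloped (sol t a) (expR (t * gamma) * (C * expR (t * conv_gain))).
Proof.
have [m h] := env_sol_sum; split; first exact: measurable_funM.
move=> x; rewrite /sol normrM (ger0_norm (expR_ge0 _)) -mulrA.
by rewrite ler_wpM2l ?expR_ge0.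
Qed.

(** The pair of transforms of $K^{*n}*a$ satisfies the recursion of
    [egf_spiral] with $c+is$ the conjugate of $\hat K(u+i\sigma)$; the series
    sums to multiplication by an exponential. *)
Theorem sol_transform sg u : 0 <= sg -> sg <= 3 / 4 ->
  cosT (tilt sg (sol t a)) u = expR (t * (gamma + cosT (tilt sg K) u)) *
    (cos (t * sinT (tilt sg K) u) * cosT (tilt sg a) u
     - sin (t * sinT (tilt sg K) u) * sinT (tilt sg a) u) /\
  sinT (tilt sg (sol t a)) u = expR (t * (gamma + cosT (tilt sg K) u)) *
    (sin (t * sinT (tilt sg K) u) * cosT (tilt sg a) u
     + cos (t * sinT (tilt sg K) u) * sinT (tilt sg a) u).
Proof.
move=> s0 s1.
have [] := @egf_spiral R (fun n => cosT (tilt sg (convn n a)) u)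
  (fun n => sinT (tilt sg (convn n a)) u)
  (cosT (tilt sg K) u) (sinT (tilt sg K) u) _ _ t.
- by move=> n; exact: cosT_conv (env_convn n aE) s0 s1.
- by move=> n; exact: sinT_conv (env_convn n aE) s0 s1.
move=> cc cs.
have c1 := Int_sol_sum_cvg s0 s1 (@measurable_cosM R u) (fun x => cos_max _).
have c2 := Int_sol_sum_cvg s0 s1 (@measurable_sinM R u) (fun x => sin_max _).
have e1 : expR (t * cosT (tilt sg K) u) *
    (cos (t * sinT (tilt sg K) u) * cosT (tilt sg a) u
     - sin (t * sinT (tilt sg K) u) * sinT (tilt sg a) u) =
    Int (fun x => tilt sg (sol_sum t a) x * cos (x * u)) by exact: cvg_unique cc c1.
have e2 : expR (t * cosT (tilt sg K) u) *
    (sin (t * sinT (tilt sg K) u) * cosT (tilt sg a) u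
     + cos (t * sinT (tilt sg K) u) * sinT (tilt sg a) u) =
    Int (fun x => tilt sg (sol_sum t a) x * sin (x * u)) by exact: cvg_unique cs c2.
have [sL _] := tilt_L1b env_sol_sum s0 s1.
have eE : expR (t * (gamma + cosT (tilt sg K) u)) = expR (t * gamma) * expR (t * cosT (tilt sg K) u).
  by rewrite mulrDr expRD.
rewrite eE; split; rewrite -[RHS]mulrA ?e1 ?e2.
  by rewrite /cosT -(Int_Z _ (L1_Mcos u sL)); apply: eq_Int => x; rewrite /tilt /sol !mulrA.
by rewrite /sinT -(Int_Z _ (L1_Msin u sL)); apply: eq_Int => x; rewrite /tilt /sol !mulrA.
Qed.

(** Summing [Int_abs_conv] over the series. The bound has the sharp rate
    because $K\ge 0$: there is no loss in the absolute values. *)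
Theorem sol_L1_bound : Int (fun x => `|tilt (3 / 4) (sol t a) x|) <=
  expR (t * rate) * Int (fun x => `|tilt (3 / 4) a x|).
Proof.
have s0 : (0 : R) <= 3 / 4 by lra.
have s1 : (3 / 4 : R) <= 3 / 4 by [].
have k0 : 0 <= Kint (3 / 4) by apply: Int_ge0 => y; rewrite mulr_ge0 ?K_ge0 ?expR_ge0.
pose M n := Int (fun x => `|tilt (3 / 4) (convn n a) x|).
have Mn n : M n <= Kint (3 / 4) ^+ n * M 0%N.
  elim: n => [|n IH]; first by rewrite expr0 mul1r.
  apply: (le_trans (Int_abs_conv (env_convn n aE) s0 s1)).
  by rewrite exprS -mulrA ler_wpM2l.
have M0 : 0 <= M 0%N by apply: Int_ge0.
have PN N : Int (fun x => `|tilt (3 / 4) (sol_partial t a N) x|) <= expR (t * Kint (3 / 4)) * M 0%N.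
  apply: (@le_trans _ _ (series (fun n => t ^+ n / n`!%:R * Kint (3 / 4) ^+ n) N * M 0%N)); last first.
    by rewrite ler_wpM2r// partial_exp_le.
  elim: N => [|N IH].
    rewrite (_ : (fun x => _) = (fun=> 0)) ?Int_0; last first.
      by apply/funext => x; rewrite /tilt /sol_partial /series/= big_nil mul0r normr0.
    by rewrite /series/= big_nil mul0r.
  have [pL _] := tilt_L1b (env_sol_partial N) s0 s1.
  have [qL _] := tilt_L1b (env_sol_partial N.+1) s0 s1.
  have [nL _] := tilt_L1b (env_convn N aE) s0 s1.
  have c0 : 0 <= t ^+ N / N`!%:R by rewrite divr_ge0// exprn_ge0.
  rewrite seriesSr [leRHS]mulrDl.
  apply: (@le_trans _ _ (Int (fun x => `|tilt (3 / 4) (sol_partial t a N) x| +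
      t ^+ N / N`!%:R * `|tilt (3 / 4) (convn N a) x|))).
    apply: Int_le; [exact: L1_abs qL|by apply: L1_D; [exact: L1_abs pL|apply: L1_Z; exact: L1_abs nL]|].
    move=> x; rewrite -[X in _ + X * _](ger0_norm c0) -normrM.
    apply: le_trans (ler_normD _ _); rewrite le_eqVlt; apply/orP; left; apply/eqP.
    by congr (`| _ |); rewrite /tilt /sol_partial seriesSr; ring.
  rewrite Int_D; [|exact: L1_abs|by apply: L1_Z; exact: L1_abs].
  rewrite Int_Z; last exact: L1_abs.
  by apply: lerD => //; rewrite -[leRHS]mulrA; apply: ler_wpM2l => //; exact: Mn.
have wE := env_envelope.
have cN : Int (fun x => `|tilt (3 / 4) (sol_partial t a N) x|) @[N --> \oo] -->
    Int (fun x => `|tilt (3 / 4) (sol_sum t a) x|).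
  apply: (Int_dom_cvg (g := fun x => C * expR (t * conv_gain) * tilt (3 / 4) envelope x) _ _ _ _ _).2.
  - by move=> N; apply: measurableT_comp => //; apply: measurable_tilt; exact: (env_sol_partial N).1.
  - by apply: measurableT_comp => //; apply: measurable_tilt; exact: env_sol_sum.1.
  - by apply: L1_Z; exact: (tilt_L1b wE s0 s1).1.
  - apply: aeW => x; apply: cvg_norm.
    by apply: cvgM; [exact: sol_partial_cvg|exact: cvg_cst].
  - move=> N x; rewrite normr_id /tilt normrM (ger0_norm (expR_ge0 _)) mulrA ler_wpM2r ?expR_ge0//.
    exact: (env_sol_partial N).2.
have B : Int (fun x => `|tilt (3 / 4) (sol_sum t a) x|) <= expR (t * Kint (3 / 4)) * M 0%N.
  rewrite -(cvg_lim _ cN)//; apply: limr_le; first by apply/cvg_ex; eexists; exact: cN.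
  by apply: nearW.
have [sL _] := tilt_L1b env_sol_sum s0 s1.
have -> : Int (fun x => `|tilt (3 / 4) (sol t a) x|) =
    expR (t * gamma) * Int (fun x => `|tilt (3 / 4) (sol_sum t a) x|).
  rewrite -Int_Z; last exact: L1_abs.
  apply: eq_Int => x; rewrite /tilt /sol -mulrA normrM.
  by rewrite (ger0_norm (expR_ge0 _)).
apply: (@le_trans _ _ (expR (t * gamma) * (expR (t * Kint (3 / 4)) * M 0%N))).
  by rewrite ler_wpM2l ?expR_ge0.
by rewrite mulrA -expRD -mulrDr.
Qed.

End solution.
End Convolution.

(** * The transform of an exponential on a half-line *)
Section HalfLine.
Context {R : realType}.
Local Notation mu := (@lebesgue_measure R).
Implicit Types (x u L d : R).

Definition decay d L x : R := expR (- d * x) * \1_(`]L, +oo[%classic : set R) x.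

Lemma measurable_expR_scale d : measurable_fun setT (fun x : R => expR (d * x)).
Proof. by apply: (measurableT_comp (@measurable_expR R)); exact: mulrl_measurable. Qed.

Lemma indic_gt L x : \1_(`]L, +oo[%classic : set R) x = (L < x)%R%:R :> R.
Proof.
rewrite indicE; congr (nat_of_bool _)%:R; apply/idP/idP => [/set_mem|Lx].
  by rewrite /= in_itv/= andbT.
by apply/mem_set; rewrite /= in_itv/= Lx.
Qed.

Lemma Int_halfline_FTC (f F : R -> R) (l : R) L : continuous f -> (forall x, 0 <= f x) ->
    (forall x, is_derive x 1 F (f x)) -> F x @[x --> +oo] --> l ->
  L1 (fun x => f x * \1_(`]L, +oo[%classic : set R) x) /\
  Int (fun x => f x * \1_(`]L, +oo[%classic : set R) x) = l - F L.
Proof.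
move=> cf f0 dF Fl.
have mf : measurable_fun setT f by exact: continuous_measurable_fun.
pose I : R -> R := \1_(`]L, +oo[%classic : set R).
have E : (\int[mu]_x (f x * I x)%:E = l%:E - (F L)%:E)%E.
  rewrite -(@ge0_continuous_FTC2y R f F L l) //.
  - rewrite -integral_itv_obnd_cbnd; last first.
      by apply/measurable_EFinP; exact: measurable_funTS.
    rewrite [RHS]integral_mkcond; apply: eq_integral => x _.
    by rewrite /I patchE indicE; case: ifP => _; rewrite ?mulr1 ?mulr0.
  - exact: continuous_subspaceT.
  - apply: cvg_at_right_filter; have h := dF L.
    by apply: differentiable_continuous; apply/derivable1_diffP; exact: ex_derive.
  - by move=> x _; have h := dF x; rewrite derive1E derive_val.
split; last by rewrite -[LHS]/(Rintegral mu setT _) /Rintegral E -EFinB.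
apply: ge0_L1.
- by apply: measurable_funM => //; apply: measurable_indic; exact: measurable_itv.
- by move=> x; rewrite mulr_ge0.
- by rewrite E -EFinB ltry.
Qed.

Section fixed_d.
Variables (d u L : R).
Hypothesis d0 : 0 < d.

Let D0 : d ^+ 2 + u ^+ 2 != 0.
Proof. by rewrite gt_eqF// ltr_pwDl ?sqr_ge0// exprn_gt0. Qed.

Let d1 : d != 0. Proof. by rewrite gt_eqF. Qed.

Let dE x : is_derive x 1 (fun x => expR (- d * x)) (- d * expR (- d * x)).
Proof. exact: is_derive_comp_scale. Qed.

Let dC x : is_derive x 1 (fun x => cos (u * x)) (u * - sin (u * x)).
Proof. exact: is_derive_comp_scale. Qed.

Let dS x : is_derive x 1 (fun x => sin (u * x)) (u * cos (u * x)).
Proof. exact: is_derive_comp_scale. Qed.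

(* Primitives and integrands are all of this form. For the integrands r = 1
   and |p| + |q| <= 1, which makes them nonnegative; the case p = q = 0
   subtracts the constant again. *)
Let G (p q r x : R) : R := expR (- d * x) * (p * cos (u * x) + q * sin (u * x) + r).

Let dG p q r x : is_derive x 1 (G p q r)
  (expR (- d * x) * ((- d * p + u * q) * cos (u * x) + (- d * q - u * p) * sin (u * x) - d * r)).
Proof.
have h := is_deriveM (dE x) (is_deriveD (is_deriveD (is_deriveZ p (dC x))
  (is_deriveZ q (dS x))) (is_derive_cst r x 1)).
by apply: is_derive_eq; rewrite !fctE /= /GRing.scale/=; ring.
Qed.

Let Gy p q r : G p q r x @[x --> +oo] --> (0 : R).
Proof.
pose C := `|p| + `|q| + `|r|.
have hC x : `|G p q r x| <= expR (- d * x) * C.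
  rewrite /G normrM (ger0_norm (expR_ge0 _)) ler_wpM2l ?expR_ge0// /C.
  apply: (le_trans (ler_normD _ _)); rewrite lerD2r.
  apply: (le_trans (ler_normD _ _)); rewrite !normrM.
  by apply: lerD; rewrite ler_piMr// ?cos_max ?sin_max.
have hE : expR (- d * x) * C @[x --> +oo] --> (0 : R).
  by rewrite -[X in _ --> X](mul0r C); apply: cvgM; [exact: cvg_expRNM|exact: cvg_cst].
apply/norm_cvg0P; apply: (@squeeze_cvgr _ _ _ _ (fun=> 0) (fun x => expR (- d * x) * C)).
- by apply: nearW => x; rewrite normr_ge0 hC.
- exact: cvg_cst.
- exact: hE.
Qed.

Let cG (p q r : R) : continuous (G p q r).
Proof.
move=> x; have h := dG p q r x.
by apply: differentiable_continuous; apply/derivable1_diffP; exact: ex_derive.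
Qed.

Let half (p q : R) : `|p| + `|q| <= 1 ->
  L1 (fun x => G p q 1 x * \1_(`]L, +oo[%classic : set R) x) /\
  Int (fun x => G p q 1 x * \1_(`]L, +oo[%classic : set R) x) =
    - G ((- d * p - u * q) / (d ^+ 2 + u ^+ 2)) ((u * p - d * q) / (d ^+ 2 + u ^+ 2)) (- d^-1) L.
Proof.
move=> pq.
have [||||h1 h2] := @Int_halfline_FTC (G p q 1)
   (G ((- d * p - u * q) / (d ^+ 2 + u ^+ 2)) ((u * p - d * q) / (d ^+ 2 + u ^+ 2)) (- d^-1)) 0 L.
- exact: cG.
- move=> x; rewrite mulr_ge0 ?expR_ge0//.
  have h1 : `|p * cos (u * x)| <= `|p| by rewrite normrM ler_piMr// cos_max.
  have h2 : `|q * sin (u * x)| <= `|q| by rewrite normrM ler_piMr// sin_max.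
  by move: h1 h2; rewrite !ler_norml => /andP[h1 _] /andP[h2 _]; lra.
- move=> x; have h := dG ((- d * p - u * q) / (d ^+ 2 + u ^+ 2))
    ((u * p - d * q) / (d ^+ 2 + u ^+ 2)) (- d^-1) x.
  apply: is_derive_eq; rewrite /G; congr (_ * _).
  by field; rewrite D0 d1.
- exact: Gy.
by split=> //; rewrite h2 sub0r.
Qed.

Lemma decay_L1b : L1b (decay d L).
Proof.
have [h _] := @half 0 0 ltac:(by rewrite normr0 addr0 ler01).
split.
  apply: eq_L1 h => x; rewrite /G /decay !mul0r !add0r mulr1//.
exists (expR (- d * L)) => x; rewrite /decay indic_gt normrM (ger0_norm (expR_ge0 _)).
have [Lx|_] := boolP (L < x); last by rewrite normr0 mulr0 expR_ge0.
by rewrite normr1 mulr1 ler_expR !mulNr lerN2 ler_wpM2l// ltW.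
Qed.

Lemma cosT_decay : cosT (decay d L) u =
  expR (- d * L) * (d * cos (u * L) - u * sin (u * L)) / (d ^+ 2 + u ^+ 2).
Proof.
have [h0 e0] := @half 0 0 ltac:(by rewrite normr0 addr0 ler01).
have [h1 e1] := @half 1 0 ltac:(by rewrite normr0 addr0 normr1).
have -> : cosT (decay d L) u = Int (fun x => G 1 0 1 x * \1_(`]L, +oo[%classic : set R) x
   - G 0 0 1 x * \1_(`]L, +oo[%classic : set R) x).
  by apply: eq_Int => x; rewrite /G /decay [x * u]mulrC; ring.
rewrite Int_B// e0 e1 /G; field.
by rewrite D0 d1.
Qed.

Lemma sinT_decay : sinT (decay d L) u =
  expR (- d * L) * (d * sin (u * L) + u * cos (u * L)) / (d ^+ 2 + u ^+ 2).
Proof.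
have [h0 e0] := @half 0 0 ltac:(by rewrite normr0 addr0 ler01).
have [h1 e1] := @half 0 1 ltac:(by rewrite normr0 add0r normr1).
have -> : sinT (decay d L) u = Int (fun x => G 0 1 1 x * \1_(`]L, +oo[%classic : set R) x
   - G 0 0 1 x * \1_(`]L, +oo[%classic : set R) x).
  by apply: eq_Int => x; rewrite /G /decay [x * u]mulrC; ring.
rewrite Int_B// e0 e1 /G; field.
by rewrite D0 d1.
Qed.

End fixed_d.
End HalfLine.

Local Open Scope complex_scope.

(** * Complex transforms through real and imaginary parts *)
Section ComplexTransforms.
Context {R : realType}.
Local Notation mu := (@lebesgue_measure R).
Local Notation Re := complex.Re.
Local Notation Im := complex.Im.
Implicit Types (a b : R -> R) (x u sg t L d : R) (f g : R -> R[i]).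

Definition rpart f x : R := Re (f x).

Definition ipart f x : R := Im (f x).

Lemma cmulE (a b c d : R) : (a +i* b) * (c +i* d) = (a * c - b * d) +i* (a * d + b * c).
Proof. by []. Qed.

Lemma caddE (a b c d : R) : (a +i* b) + (c +i* d) = (a + c) +i* (b + d).
Proof. by []. Qed.

Lemma cinvE (a b : R) :
  (a +i* b)^-1 = (a / (a ^+ 2 + b ^+ 2)) +i* (- (b / (a ^+ 2 + b ^+ 2))).
Proof. by []. Qed.

Lemma cabsE (z : R[i]) : cabs z = Num.sqrt (Re z ^+ 2 + Im z ^+ 2).
Proof. by case: z. Qed.

Lemma cabs_ge0 (z : R[i]) : 0 <= cabs z.
Proof. by rewrite cabsE sqrtr_ge0. Qed.

Lemma cabs_sqr (z : R[i]) : cabs z ^+ 2 = Re z ^+ 2 + Im z ^+ 2.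
Proof. by rewrite cabsE sqr_sqrtr// addr_ge0 ?sqr_ge0. Qed.

Lemma Re_le_cabs (z : R[i]) : `|Re z| <= cabs z.
Proof.
rewrite -(@ler_pXn2r _ 2)// ?nnegrE ?cabs_ge0// cabs_sqr real_normK ?num_real//.
by rewrite lerDl sqr_ge0.
Qed.

Lemma Im_le_cabs (z : R[i]) : `|Im z| <= cabs z.
Proof.
rewrite -(@ler_pXn2r _ 2)// ?nnegrE ?cabs_ge0// cabs_sqr real_normK ?num_real//.
by rewrite lerDr sqr_ge0.
Qed.

Lemma cabs_le (z : R[i]) : cabs z <= `|Re z| + `|Im z|.
Proof.
rewrite -(@ler_pXn2r _ 2)// ?nnegrE ?cabs_ge0 ?addr_ge0// cabs_sqr sqrrD.
rewrite !real_normK ?num_real// -addrA [X in _ <= _ + X]addrC addrA lerDl.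
by rewrite mulrn_wge0// mulr_ge0.
Qed.

Lemma measurable_cabs f : cmeasurable setT f -> measurable_fun setT (fun x : R => cabs (f x)).
Proof.
move=> [m1 m2]; have -> : (fun x : R => cabs (f x)) = Num.sqrt \o (fun x : R => Re (f x) ^+ 2 + Im (f x) ^+ 2).
  by apply/funext => x; rewrite cabsE.
apply: measurableT_comp; first by apply: continuous_measurable_fun; exact: sqrt_continuous.
by apply: measurable_funD; exact: measurable_funX.
Qed.

Lemma cintegralE g : cintegral setT g = Int (fun x => Re (g x)) +i* Int (fun x => Im (g x)).
Proof. by []. Qed.

Lemma abs_convergentE g : L1 (fun x => Re (g x)) -> L1 (fun x => Im (g x)) ->
  abs_convergent setT g.
Proof.
move=> r i; have m : cmeasurable setT g by split; exact: L1_meas.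
split => //; rewrite -Int_EFin ?ltry//.
apply: (L1_dom (measurable_cabs m) (L1_D (L1_abs r) (L1_abs i))) => x.
by rewrite ger0_norm ?cabs_ge0// cabs_le.
Qed.

Lemma kernelE x u sg : cexp (- Num.imaginary * x%:C * (u +i* sg)) =
  (expR (sg * x) * cos (x * u)) +i* (- (expR (sg * x) * sin (x * u))).
Proof.
have -> : - Num.imaginary * x%:C * (u +i* sg) = (sg * x) +i* (- (x * u)) :> R[i].
  by apply/eqP; rewrite eq_complex /=; apply/andP; split; apply/eqP; ring.
by rewrite /cexp /= cosN sinN cmulE; apply/eqP; rewrite eq_complex /=;
  apply/andP; split; apply/eqP; ring.
Qed.

Lemma fourierE f sg u : L1 (tilt sg (rpart f)) -> L1 (tilt sg (ipart f)) ->
  fourier f (u +i* sg) =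
   (cosT (tilt sg (rpart f)) u + sinT (tilt sg (ipart f)) u) +i*
   (cosT (tilt sg (ipart f)) u - sinT (tilt sg (rpart f)) u).
Proof.
move=> rL iL; rewrite /fourier cintegralE.
have rc := L1_Mcos u rL; have rs := L1_Msin u rL.
have ic := L1_Mcos u iL; have is_ := L1_Msin u iL.
rewrite /cosT /sinT -(Int_D rc is_) -(Int_B ic rs); congr (_ +i* _).
  apply: eq_Int => x; rewrite kernelE /tilt /rpart /ipart /=.
  by case: (f x) => p q; rewrite cmulE /=; ring.
apply: eq_Int => x; rewrite kernelE /tilt /rpart /ipart /=.
by case: (f x) => p q; rewrite cmulE /=; ring.
Qed.

Lemma KhatE u sg : 0 <= sg -> sg <= 3 / 4 ->
  Khat (u +i* sg) = cosT (tilt sg K) u +i* (- sinT (tilt sg K) u).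
Proof.
move=> s0 s1; have kL : L1 (tilt sg (@K R)) by apply: tilt_K_L1.
have Z : tilt sg (ipart (fun x : R => (K x)%:C)) = fun=> 0.
  by apply/funext => x; rewrite /tilt /= mul0r.
have c0 : cosT (fun=> 0 : R) u = 0.
  by rewrite /cosT -[RHS]Int_0; apply: eq_Int => x; rewrite mul0r.
have s0' : sinT (fun=> 0 : R) u = 0.
  by rewrite /sinT -[RHS]Int_0; apply: eq_Int => x; rewrite mul0r.
rewrite /Khat fourierE; last by rewrite Z; exact: L1_0.
  by rewrite Z c0 s0' addr0 add0r.
exact: kL.
Qed.

End ComplexTransforms.

(** * Functions equal almost everywhere *)
Section AlmostEverywhere.
Context {R : realType}.
Local Notation mu := (@lebesgue_measure R).
Implicit Types (f g : R -> R).

Lemma Int_ae f g : measurable_fun setT f -> measurable_fun setT g ->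
  {ae mu, forall x : R, f x = g x} -> Int f = Int g.
Proof.
move=> mf mg fg; rewrite -[LHS]/(Rintegral mu setT f) -[RHS]/(Rintegral mu setT g).
rewrite /Rintegral; congr fine; apply: ae_eq_integral => //.
- exact/measurable_EFinP.
- exact/measurable_EFinP.
- by apply: ae_imp fg => x /= -> _.
Qed.

Lemma L1_ae f g : measurable_fun setT g -> {ae mu, forall x : R, f x = g x} ->
  L1 f -> L1 g.
Proof.
move=> mg fg fi; have mf := L1_meas fi.
apply/integrableP; split; first exact/measurable_EFinP.
rewrite -(@ge0_ae_eq_integral _ _ _ mu setT (fun x => `|(f x)%:E|%E)) //.
- by case/integrableP : fi.
- by apply: measurableT_comp => //; exact/measurable_EFinP.
- by apply: measurableT_comp => //; exact/measurable_EFinP.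
- by apply: ae_imp fg => x /= -> _.
Qed.

Lemma cosT_ae f g u : measurable_fun setT f -> measurable_fun setT g ->
  {ae mu, forall x : R, f x = g x} -> cosT f u = cosT g u.
Proof.
move=> mf mg fg; apply: Int_ae.
- by apply: measurable_funM => //; exact: measurable_cosM.
- by apply: measurable_funM => //; exact: measurable_cosM.
- by apply: ae_imp fg => x ->.
Qed.

Lemma sinT_ae f g u : measurable_fun setT f -> measurable_fun setT g ->
  {ae mu, forall x : R, f x = g x} -> sinT f u = sinT g u.
Proof.
move=> mf mg fg; apply: Int_ae.
- by apply: measurable_funM => //; exact: measurable_sinM.
- by apply: measurable_funM => //; exact: measurable_sinM.
- by apply: ae_imp fg => x ->.
Qed.

End AlmostEverywhere.

(** * The inverse transform in the mean *)
Section InverseTransform.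
Context {R : realType}.
Local Notation mu := (@lebesgue_measure R).
Local Notation Re := complex.Re.
Local Notation Im := complex.Im.
Implicit Types (a b : R -> R) (x u r : R) (f g h : R -> R[i]).

(** The Fourier transform of $a+ib$. *)
Definition ftrans a b u : R[i] := (cosT a u + sinT b u) +i* (cosT b u - sinT a u).

Lemma cmeasurable_ftrans a b : L1 a -> L1 b -> cmeasurable setT (ftrans a b).
Proof.
move=> ai bi; split.
  by apply: measurable_funD; [exact: measurable_cosT|exact: measurable_sinT].
by apply: measurable_funB; [exact: measurable_cosT|exact: measurable_sinT].
Qed.

Lemma square_integrableE h : cmeasurable setT h ->
  L1 (fun x => Re (h x) ^+ 2 + Im (h x) ^+ 2) -> square_integrable h.
Proof.
move=> mh hi; split=> //.
under eq_integral do rewrite cabs_sqr.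
by rewrite -Int_EFin ?ltry.
Qed.

Lemma square_integrable_ftrans a b : L1b a -> L1b b ->
  square_integrable (ftrans a b).
Proof.
move=> ab bb; apply: square_integrableE.
  by apply: cmeasurable_ftrans; [exact: ab.1|exact: bb.1].
have [Pa _] := plancherel ab; have [Pb _] := plancherel bb.
have [_ _ p1 _] := parseval ab bb; have [_ _ p2 _] := parseval bb ab.
have h := L1_D (L1_D Pa Pb) (L1_B (L1_Z 2 p1) (L1_Z 2 p2)).
by apply: eq_L1 h => u; rewrite /ftrans /=; ring.
Qed.

Lemma Int_window r (f : R -> R) : Int (window r f) = Rintegral mu (`[- r, r]%classic : set R) f.
Proof.
rewrite Rintegral_mkcond -[RHS]/(Int _); apply: eq_Int => x.
by rewrite patchE /window indicE; case: ifP => _; rewrite ?mulr1 ?mulr0.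
Qed.

Lemma waveE x u : cexp (Num.imaginary * x%:C * u%:C) = cos (u * x) +i* sin (u * x).
Proof.
have -> : Num.imaginary * x%:C * u%:C = 0 +i* (u * x) :> R[i].
  by apply/eqP; rewrite eq_complex /=; apply/andP; split; apply/eqP; ring.
rewrite /cexp /= expR0 cmulE.
by apply/eqP; rewrite eq_complex /=; apply/andP; split; apply/eqP; ring.
Qed.

Lemma inv_fourier_truncE a b r x : L1b a -> L1b b ->
  inv_fourier_trunc (ftrans a b) r x = invT a r x +i* invT b r x.
Proof.
move=> [ai _] [bi _].
have bdc (c : R -> R) : L1 c -> exists M, forall u, `|cosT c u| <= M.
  by move=> ci; exists (Int (fun x => `|c x|)) => u; exact: cosT_le.
have bds (c : R -> R) : L1 c -> exists M, forall u, `|sinT c u| <= M.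
  by move=> ci; exists (Int (fun x => `|c x|)) => u; exact: sinT_le.
have [Ca _] := L1_window r (measurable_cosT ai) (bdc _ ai).
have [Sa _] := L1_window r (measurable_sinT ai) (bds _ ai).
have [Cb _] := L1_window r (measurable_cosT bi) (bdc _ bi).
have [Sb _] := L1_window r (measurable_sinT bi) (bds _ bi).
have odd1 (c : R -> R) : L1 c -> L1 (window r (cosT c)) ->
    Int (fun u => window r (cosT c) u * sin (u * x)) = 0.
  move=> ci Lc; apply: Int_odd; first exact: L1_Msin.
  by move=> u; rewrite /window cosT_even indic_sym mulNr sinN mulrN.
have odd2 (c : R -> R) : L1 c -> L1 (window r (sinT c)) ->
    Int (fun u => window r (sinT c) u * cos (u * x)) = 0.
  move=> ci Lc; apply: Int_odd; first exact: L1_Mcos.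
  by move=> u; rewrite /window sinT_odd// indic_sym !mulNr cosN.
rewrite /inv_fourier_trunc /cintegral -!Int_window.
have -> : Int (window r (fun u => Re (cexp (Num.imaginary * x%:C * u%:C) * ftrans a b u))) =
    cosT (window r (cosT a)) x + sinT (window r (sinT a)) x.
  transitivity (Int (fun u => window r (cosT a) u * cos (u * x) + window r (sinT a) u * sin (u * x)
     + (window r (sinT b) u * cos (u * x) - window r (cosT b) u * sin (u * x)))).
    by apply: eq_Int => u; rewrite /window waveE /ftrans cmulE /=; ring.
  rewrite Int_D; [|exact: L1_D (L1_Mcos x Ca) (L1_Msin x Sa)
                  |exact: L1_B (L1_Mcos x Sb) (L1_Msin x Cb)].
  rewrite (Int_D (L1_Mcos x Ca) (L1_Msin x Sa)) (Int_B (L1_Mcos x Sb) (L1_Msin x Cb)).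
  by rewrite odd1// odd2// subr0 addr0.
have -> : Int (window r (fun u => Im (cexp (Num.imaginary * x%:C * u%:C) * ftrans a b u))) =
    cosT (window r (cosT b)) x + sinT (window r (sinT b)) x.
  transitivity (Int (fun u => window r (cosT b) u * cos (u * x) + window r (sinT b) u * sin (u * x)
     + (window r (cosT a) u * sin (u * x) - window r (sinT a) u * cos (u * x)))).
    by apply: eq_Int => u; rewrite /window waveE /ftrans cmulE /=; ring.
  rewrite Int_D; [|exact: L1_D (L1_Mcos x Cb) (L1_Msin x Sb)
                  |exact: L1_B (L1_Msin x Ca) (L1_Mcos x Sa)].
  rewrite (Int_D (L1_Mcos x Cb) (L1_Msin x Sb)) (Int_B (L1_Msin x Ca) (L1_Mcos x Sa)).
  by rewrite odd1// odd2// subr0 addr0.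
rewrite /invT; move: (_^-1) (_ + _) (_ + _) => p y z.
by rewrite cmulE !mul0r subr0 addr0.
Qed.

Lemma is_inv_fourier_ftrans f : L1b (rpart f) -> L1b (ipart f) ->
  is_inv_fourier (ftrans (rpart f) (ipart f)) f.
Proof.
move=> rb ib; split.
- exact: square_integrable_ftrans.
- apply: square_integrableE; first by split; [exact: L1_meas rb.1|exact: L1_meas ib.1].
  exact: L1_D (L1b_sqr rb) (L1b_sqr ib).
pose E r := Int (fun x => (rpart f x - invT (rpart f) r x) ^+ 2) +
            Int (fun x => (ipart f x - invT (ipart f) r x) ^+ 2).
rewrite (_ : (fun r : R => _) = EFin \o E); last first.
  apply/funext => r /=; have [_ L1r _] := invT_error r rb; have [_ L1i _] := invT_error r ib.
  rewrite /E -Int_D// Int_EFin; last exact: L1_D.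
  apply: eq_integral => x _; rewrite inv_fourier_truncE// cabs_sqr /rpart /ipart.
  by case: (f x).
apply: cvg_EFin; first exact: nearW.
apply/cvgrPdist_le => eps eps0.
have eps2 : 0 < eps / 2 by rewrite divr_gt0.
have [r1 h1] := invT_cvg rb eps2; have [r2 h2] := invT_cvg ib eps2.
near=> r; rewrite sub0r normrN ger0_norm; last first.
  by rewrite addr_ge0//; apply: Int_ge0 => x; rewrite sqr_ge0.
rewrite (splitr eps) lerD//.
  by apply: h1; near: r; apply: nbhs_pinfty_ge; exact: num_real.
by apply: h2; near: r; apply: nbhs_pinfty_ge; exact: num_real.
Unshelve. all: end_near.
Qed.

(** Both functions are limits in $L^2$ of the same truncations; the
    inequality $|f-g|^2\le 2(|f-S|^2+|g-S|^2)$ makes their distance 0. *)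
Lemma is_inv_fourier_unique h f g :
  (forall r, cmeasurable setT (inv_fourier_trunc h r)) ->
  is_inv_fourier h f -> is_inv_fourier h g -> {ae mu, forall x : R, f x = g x}.
Proof.
move=> mS [_ [mf _] cf] [_ [mg _] cg].
pose N2 (p q : R -> R[i]) : R -> R := fun x => cabs (p x - q x) ^+ 2.
have csub (z w : R[i]) : Re (z - w) = Re z - Re w /\ Im (z - w) = Im z - Im w.
  by case: z; case: w.
have mN2 p q : cmeasurable setT p -> cmeasurable setT q -> measurable_fun setT (N2 p q).
  move=> [p1 p2] [q1 q2]; apply: measurable_funX; apply: measurable_cabs; split.
    rewrite (_ : (fun x => _) = (fun x : R => Re (p x) - Re (q x))).
      exact: measurable_funB.
    by apply/funext => x; exact: (csub _ _).1.
  rewrite (_ : (fun x => _) = (fun x : R => Im (p x) - Im (q x))).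
    exact: measurable_funB.
  by apply/funext => x; exact: (csub _ _).2.
have N20 p q x : 0 <= N2 p q x by exact: sqr_ge0.
have tri (S : R -> R[i]) x : N2 f g x <= 2 * (N2 f S x + N2 g S x).
  rewrite /N2 !cabs_sqr !(csub _ _).1 !(csub _ _).2.
  have h1 (p q s : R) : (p - q) ^+ 2 <= 2 * ((p - s) ^+ 2 + (q - s) ^+ 2).
    have := sqr_ge0 (p + q - 2 * s); rewrite !expr2; nra.
  have := h1 (Re (f x)) (Re (g x)) (Re (S x)); have := h1 (Im (f x)) (Im (g x)) (Im (S x)).
  by lra.
have I0 : (\int[mu]_x (N2 f g x)%:E <= 0)%E.
  have c0 : (2%:E * (\int[mu]_x (N2 f (inv_fourier_trunc h r) x)%:E +
     \int[mu]_x (N2 g (inv_fourier_trunc h r) x)%:E))%E @[r --> +oo] --> (2%:E * (0 + 0))%E.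
    by apply: cvgeZl => //; apply: cvgeD.
  rewrite adde0 mule0 in c0.
  apply: (cvge_ge _ c0); apply: nearW => r.
  have mS1 := mN2 _ _ mf (mS r); have mS2 := mN2 _ _ mg (mS r).
  rewrite -ge0_integralD//; last 4 first.
  - by move=> x _; rewrite lee_fin.
  - exact/measurable_EFinP.
  - by move=> x _; rewrite lee_fin.
  - exact/measurable_EFinP.
  rewrite -ge0_integralZl_EFin//; last 2 first.
  - by move=> x _; rewrite -EFinD lee_fin addr_ge0.
  - by apply: emeasurable_funD; exact/measurable_EFinP.
  apply: ge0_le_integral => //.
  - by move=> x _; rewrite lee_fin.
  - by apply/measurable_EFinP; exact: mN2.
  - by apply/measurable_EFinP; apply: measurable_funM => //; exact: measurable_funD.
  - by move=> x _; rewrite -EFinD -EFinM lee_fin.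
have I1 : (\int[mu]_(x in setT) `|(EFin \o N2 f g) x| = 0)%E.
  apply/eqP; rewrite eq_le integral_ge0// andbT.
  by under eq_integral do rewrite /= ger0_norm//.
have ae0 := (ae_eq_integral_abs mu measurableT ((measurable_EFinP _ _).2 (mN2 _ _ mf mg))).1 I1.
apply: ae_imp ae0 => x /= /(_ I) [] /eqP; rewrite /N2 cabs_sqr.
rewrite paddr_eq0 ?sqr_ge0// !sqrf_eq0 (csub _ _).1 (csub _ _).2 !subr_eq0.
by move=> /andP[/eqP e1 /eqP e2]; move: e1 e2; case: (f x) (g x) => p q [p' q'] /= -> ->.
Qed.

End InverseTransform.

(** * Data of the weighted space *)
Section Representative.
Context {R : realType}.
Local Notation mu := (@lebesgue_measure R).
Local Notation Re := complex.Re.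
Local Notation Im := complex.Im.
Variables (A B : R).
Hypotheses (hB' : B < - (3 / 4)) (hA : 1 / 2 < A).

Let beta : R := Num.min (- B) (7 / 4).

Lemma ess_sup_halfline (g : R -> R) (D : set R) : measurable D ->
  (forall x, 0 <= g x) ->
  (0 <= ess_sup mu ((fun x : R => (g x)%:E) \_ D))%E.
Proof.
move=> mD g0; apply: ess_sup_gee.
  apply: (@lt_le_trans _ _ (mu (`[0%R, 1%R]%classic : set R))).
    by rewrite lebesgue_measure_itv/= lte_fin ltr01 oppr0 adde0 lte_fin ltr01.
  by apply: le_measure; rewrite ?inE.
by apply: aeW => x; apply: erestrict_ge0 => y _; rewrite lee_fin.
Qed.

Lemma ess_sup_fin_bound (g : R -> R) (D : set R) : measurable D -> (forall x, 0 <= g x) ->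
  (ess_sup mu ((fun x : R => (g x)%:E) \_ D) < +oo)%E ->
  exists2 C : R, 0 <= C & {ae mu, forall x : R, D x -> g x <= C}.
Proof.
move=> mD g0 fin; have p := ess_sup_halfline mD g0.
have := ess_sup_ge mu ((fun x : R => (g x)%:E) \_ D).
move: p fin; case: (ess_sup _ _) => [C| |] //= C0 _ h.
exists C; first by rewrite lee_fin in C0.
by apply: ae_imp h => x; rewrite patchE => + Dx; rewrite mem_set// lee_fin.
Qed.

(** On $x<0$ the bound $e^{Ax}$ with $A>1/2$ is stronger than $e^{x/4}$, and on
    $x>0$ the bound $e^{Bx}$ is at least as strong as $e^{-\beta x}$, where
    $\beta=\min(-B,7/4)$ stays in the range of integrability of the kernel. *)
Lemma inX_envelope f0 : inX A B f0 -> exists2 C : R, 0 <= C &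
  {ae mu, forall x : R, cabs (f0 x) <= C * envelope beta x}.
Proof.
move=> [[mf0 _] nX]; have b3 := hB'; have a1 := hA.
pose g1 x : R := expR (- A * x) * cabs (f0 x); pose g2 x : R := expR (- B * x) * cabs (f0 x).
have g10 x : 0 <= g1 x by rewrite mulr_ge0 ?expR_ge0 ?cabs_ge0.
have g20 x : 0 <= g2 x by rewrite mulr_ge0 ?expR_ge0 ?cabs_ge0.
have m1 : measurable (`]-oo, 0%R[%classic : set R) by exact: measurable_itv.
have m2 : measurable (`]0%R, +oo[%classic : set R) by exact: measurable_itv.
have p1 := ess_sup_halfline m1 g10; have p2 := ess_sup_halfline m2 g20.
move: nX; rewrite /normX => nX.
have f1 : (ess_sup mu ((fun x : R => (g1 x)%:E) \_ `]-oo, 0%R[) < +oo)%E.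
  exact: le_lt_trans (leeDl _ p2) nX.
have f2 : (ess_sup mu ((fun x : R => (g2 x)%:E) \_ `]0%R, +oo[) < +oo)%E.
  exact: le_lt_trans (leeDr _ p1) nX.
have [C1 C10 h1] := ess_sup_fin_bound m1 g10 f1.
have [C2 C20 h2] := ess_sup_fin_bound m2 g20 f2.
exists (C1 + C2); first exact: addr_ge0.
have h12 := ae_imp2 (fun x (a : _ x) (b : _ x) => conj a b) h1 h2.
apply: ae_imp2 h12 (ae_neq2 0 0) => x [b1 b2] [x0 _].
have bB : beta <= - B by rewrite ge_min lexx.
have b34 : 3 / 4 < beta by rewrite lt_min; apply/andP; split; lra.
rewrite minr_pMr ?addr_ge0// le_min; have [x1|x1|//] := ltgtP x 0.
  have : g1 x <= C1 by apply: b1; rewrite /= in_itv.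
  rewrite /g1 mulrC mulNr expRN ler_pdivrMr ?expR_gt0// => b.
  apply/andP; split; apply: (le_trans b); apply: ler_pM; rewrite ?expR_ge0 ?lerDl//.
    by rewrite opprK ler_expR; nra.
  by rewrite ler_expR; nra.
have : g2 x <= C2 by apply: b2; rewrite /= in_itv/= andbT.
rewrite /g2 mulrC mulNr expRN ler_pdivrMr ?expR_gt0// => b.
apply/andP; split; apply: (le_trans b); apply: ler_pM; rewrite ?expR_ge0 ?lerDr//.
  by rewrite opprK ler_expR; nra.
by rewrite ler_expR; nra.
Qed.

(** The datum is set to 0 where the envelope fails, a null set; the result is
    bounded at every point. *)
Lemma inX_representative f0 : inX A B f0 -> exists a0 b0 C,
  [/\ enveloped beta a0 C, enveloped beta b0 C,
      {ae mu, forall x : R, rpart f0 x = a0 x /\ ipart f0 x = b0 x},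
      (forall x, `|a0 x| <= cabs (f0 x)) & (forall x, `|b0 x| <= cabs (f0 x))].
Proof.
move=> f0X; have [C C0 hC] := inX_envelope f0X; have [[mf0 _] _] := f0X.
have [mr mi] := mf0.
pose P x := cabs (f0 x) <= C * envelope beta x.
have mP : measurable_fun setT P.
  apply: measurable_fun_ler; first exact: measurable_cabs.
  apply: measurable_funM => //; apply: measurable_minr;
    by apply: (measurableT_comp (@measurable_expR R)); exact: mulrl_measurable.
pose a0 x := if P x then rpart f0 x else 0.
pose b0 x := if P x then ipart f0 x else 0.
have w0 x : 0 <= C * envelope beta x by rewrite mulr_ge0// envelope_ge0.
exists a0, b0, C; split.
- split; first exact: measurable_fun_ifT.
  move=> x; rewrite /a0; case: ifPn => [Px|_]; last by rewrite normr0.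
  exact: le_trans (Re_le_cabs _) Px.
- split; first exact: measurable_fun_ifT.
  move=> x; rewrite /b0; case: ifPn => [Px|_]; last by rewrite normr0.
  exact: le_trans (Im_le_cabs _) Px.
- by apply: ae_imp hC => x Px; rewrite /a0 /b0 ifT ?ifT.
- move=> x; rewrite /a0; case: ifP => _; first exact: Re_le_cabs.
  by rewrite normr0 cabs_ge0.
- move=> x; rewrite /b0; case: ifP => _; first exact: Im_le_cabs.
  by rewrite normr0 cabs_ge0.
Qed.

End Representative.

(** * The contour formula for a datum of the weighted space *)
Section EvolvedDatum.
Context {R : realType}.
Local Notation mu := (@lebesgue_measure R).
Local Notation Re := complex.Re.
Local Notation Im := complex.Im.
Variable beta : R.
Hypothesis beta1 : 3 / 4 < beta.
Hypothesis beta2 : beta <= 7 / 4.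
Variables (f0 : R -> R[i]) (a0 b0 : R -> R) (C : R).
Hypothesis mf0 : cmeasurable setT f0.
Hypothesis aE : enveloped beta a0 C.
Hypothesis bE : enveloped beta b0 C.
Hypothesis f0ab : {ae mu, forall x : R, rpart f0 x = a0 x /\ ipart f0 x = b0 x}.

Let ra : {ae mu, forall x : R, rpart f0 x = a0 x}.
Proof. by apply: ae_imp f0ab => x []. Qed.

Let ib : {ae mu, forall x : R, ipart f0 x = b0 x}.
Proof. by apply: ae_imp f0ab => x []. Qed.

Lemma fourier_f0 sg u : 0 <= sg -> sg <= 3 / 4 ->
  fourier f0 (u +i* sg) = ftrans (tilt sg a0) (tilt sg b0) u.
Proof.
move=> s0 s1; have [ma _] := aE; have [mb _] := bE; have [mr mi] := mf0.
have ta : {ae mu, forall x : R, tilt sg a0 x = tilt sg (rpart f0) x}.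
  by apply: ae_imp ra => x h; rewrite /tilt h.
have tb : {ae mu, forall x : R, tilt sg b0 x = tilt sg (ipart f0) x}.
  by apply: ae_imp ib => x h; rewrite /tilt h.
have mta := measurable_tilt sg ma; have mtb := measurable_tilt sg mb.
have mtr : measurable_fun setT (tilt sg (rpart f0)) by exact: measurable_tilt.
have mti : measurable_fun setT (tilt sg (ipart f0)) by exact: measurable_tilt.
have [aL _] := tilt_L1b beta1 aE s0 s1; have [bL _] := tilt_L1b beta1 bE s0 s1.
rewrite fourierE; [|exact: L1_ae aL|exact: L1_ae bL].
by rewrite /ftrans -!(cosT_ae _ _ _ ta)// -!(sinT_ae _ _ _ ta)// -!(cosT_ae _ _ _ tb)// -!(sinT_ae _ _ _ tb).
Qed.

Variable t : R.
Hypothesis t0 : 0 < t.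

Let a := sol t a0.
Let b := sol t b0.
Let f x : R[i] := a x +i* b x.
Let C' := expR (t * gamma) * (C * expR (t * conv_gain beta)).

Let aE' : enveloped beta a C'. Proof. by apply: sol_env => //; exact: ltW. Qed.
Let bE' : enveloped beta b C'. Proof. by apply: sol_env => //; exact: ltW. Qed.

(** This identifies the integrand of the line integral: on each line
    $\mathrm{Im}\,\xi=\sigma$ the evolved transform is the transform of the
    weighted series. *)
Lemma evolved_transform sg u : 0 <= sg -> sg <= 3 / 4 ->
  cexp ((gamma%:C + Khat (u +i* sg)) * t%:C) * fourier f0 (u +i* sg) =
  ftrans (tilt sg a) (tilt sg b) u.
Proof.
move=> s0 s1; rewrite fourier_f0// KhatE//.
have [ca sa] := sol_transform beta1 beta2 (ltW t0) aE u s0 s1.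
have [cb sb] := sol_transform beta1 beta2 (ltW t0) bE u s0 s1.
rewrite /ftrans ca sa cb sb.
move: (cosT (tilt sg K) u) (sinT (tilt sg K) u) => c s.
have -> : (gamma%:C + c +i* (- s)) * t%:C = (t * (gamma + c)) +i* (- (t * s)) :> R[i].
  by apply/eqP; rewrite eq_complex /=; apply/andP; split; apply/eqP; ring.
rewrite /cexp /= cosN sinN !cmulE.
by apply/eqP; rewrite eq_complex /=; apply/andP; split; apply/eqP; ring.
Qed.

Let tilt0 (g : R -> R) : tilt 0 g = g.
Proof. by apply/funext => x; rewrite /tilt mul0r expR0 mulr1. Qed.

(** The solution is some function whose transform in the $L^2$ sense is the
    evolved one, and the series is another; uniqueness identifies them off a
    null set. *)
Lemma solution_ae : cmeasurable setT (solution f0 t) /\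
  {ae mu, forall x : R, solution f0 t x = f x}.
Proof.
have l0 : (0 : R) <= 3 / 4 by lra.
have aL : L1b a by have := tilt_L1b beta1 aE' (lexx 0) l0; rewrite tilt0.
have bL : L1b b by have := tilt_L1b beta1 bE' (lexx 0) l0; rewrite tilt0.
pose h (xi : R) : R[i] := cexp (t%:C * (gamma%:C + Khat xi%:C)) * fourier f0 xi%:C.
have hE : h = ftrans a b.
  apply/funext => u; have := evolved_transform u (lexx 0) l0.
  by rewrite !tilt0 => <-; rewrite /h [t%:C * _]mulrC.
have hf : is_inv_fourier h f.
  by rewrite hE; apply: (@is_inv_fourier_ftrans _ f).
have hs : is_inv_fourier h (solution f0 t).
  rewrite /solution /inv_fourier -/h.
  by apply: (@xgetPex _ (fun=> 0) [set g | is_inv_fourier h g]); exists f.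
split; first by case: hs => _ [].
apply: (is_inv_fourier_unique _ hs hf) => r; rewrite hE; split.
  rewrite (_ : (fun x => _) = invT a r); last first.
    by apply/funext => x; rewrite inv_fourier_truncE.
  by have [] := invT_error r aL.
rewrite (_ : (fun x => _) = invT b r); last first.
  by apply/funext => x; rewrite inv_fourier_truncE.
by have [] := invT_error r bL.
Qed.

Lemma cmul_real (z : R[i]) (c : R) : z * c%:C = (Re z * c) +i* (Im z * c).
Proof.
case: z => p q; apply/eqP; rewrite eq_complex /=.
by apply/andP; split; apply/eqP; ring.
Qed.

Let w (x : R) : R[i] := solution f0 t x * (expR (x / 2))%:C.

Let rw : {ae mu, forall x : R, tilt (1 / 2) a x = Re (w x)}.
Proof.
apply: ae_imp solution_ae.2 => x hx.
by rewrite /w cmul_real hx /= /tilt (_ : 1 / 2 * x = x / 2)//; ring.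
Qed.

Let iw : {ae mu, forall x : R, tilt (1 / 2) b x = Im (w x)}.
Proof.
apply: ae_imp solution_ae.2 => x hx.
by rewrite /w cmul_real hx /= /tilt (_ : 1 / 2 * x = x / 2)//; ring.
Qed.

Let half0 : (0 : R) <= 1 / 2. Proof. by lra. Qed.
Let half1 : (1 / 2 : R) <= 3 / 4. Proof. by lra. Qed.

Let taL : L1 (tilt (1 / 2) a). Proof. exact: (tilt_L1b beta1 aE' half0 half1).1. Qed.
Let tbL : L1 (tilt (1 / 2) b). Proof. exact: (tilt_L1b beta1 bE' half0 half1).1. Qed.

Let mw : cmeasurable setT w.
Proof.
have [[m1 m2] _] := solution_ae.
have me : measurable_fun setT (fun x : R => expR (x / 2)).
  by apply: (measurableT_comp (@measurable_expR R)); exact: mulrr_measurable.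
split.
  rewrite (_ : (fun x => _) = (fun x : R => Re (solution f0 t x) * expR (x / 2))).
    exact: measurable_funM.
  by apply/funext => x; rewrite /w cmul_real.
rewrite (_ : (fun x => _) = (fun x : R => Im (solution f0 t x) * expR (x / 2))).
  exact: measurable_funM.
by apply/funext => x; rewrite /w cmul_real.
Qed.

Let rwL : L1 (fun x => Re (w x)). Proof. exact: L1_ae mw.1 rw taL. Qed.
Let iwL : L1 (fun x => Im (w x)). Proof. exact: L1_ae mw.2 iw tbL. Qed.

Lemma weighted_solution_abs : abs_convergent setT w.
Proof. exact: abs_convergentE. Qed.

Lemma weighted_solution_abs_half L : abs_convergent `]-oo, L] w.
Proof.
have [m fin] := weighted_solution_abs; split.
  by split; apply: measurable_funTS; [exact: m.1|exact: m.2].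
apply: le_lt_trans fin; apply: ge0_subset_integral => //.
- by apply/measurable_EFinP; exact: measurable_cabs.
- by move=> x _; rewrite lee_fin cabs_ge0.
Qed.

Definition tail (L : R) (g : R -> R) : R :=
  Int (fun x => tilt (1 / 2) g x * \1_(`]L, +oo[%classic : set R) x).

Let mI (L : R) : measurable_fun setT (\1_(`]L, +oo[%classic : set R) : R -> R).
Proof. by apply: measurable_indic; exact: measurable_itv. Qed.

Let tailL (L : R) (g : R -> R) : L1 g -> L1 (fun x => g x * \1_(`]L, +oo[%classic : set R) x).
Proof.
move=> gL; apply: (L1_M (c := 1)) => // x.
by rewrite indicE; case: (_ \in _); rewrite ?normr1 ?normr0.
Qed.

Lemma half_integral L : cintegral `]-oo, L] w =
  (Int (tilt (1 / 2) a) - tail L a) +i* (Int (tilt (1 / 2) b) - tail L b).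
Proof.
have main (g : R -> R) (v : R -> R) : L1 g -> L1 v -> {ae mu, forall x : R, g x = v x} ->
    Rintegral mu `]-oo, L] v = Int g - Int (fun x => g x * \1_(`]L, +oo[%classic : set R) x).
  move=> gL vL gv; rewrite (Int_ae (L1_meas gL) (L1_meas vL) gv).
  rewrite (@Int_ae _ (fun x => g x * \1_(`]L, +oo[%classic : set R) x)
    (fun x => v x * \1_(`]L, +oo[%classic : set R) x)); last first.
  - by apply: ae_imp gv => x ->.
  - by apply: L1_meas; exact: tailL.
  - by apply: L1_meas; exact: tailL.
  rewrite Rintegral_mkcond -[LHS]/(Int _) -Int_B//; last exact: tailL.
  apply: eq_Int => x; rewrite indic_gt patchE mem_setE in_itv/=.
  by case: leP => _; rewrite ?mulr0 ?mulr1 ?subr0 ?subrr.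
by rewrite /cintegral (main _ _ taL rwL rw) (main _ _ tbL iwL iw).
Qed.

Lemma full_integral : cintegral setT w = Int (tilt (1 / 2) a) +i* Int (tilt (1 / 2) b).
Proof.
rewrite cintegralE; congr (_ +i* _); apply/esym; apply: Int_ae.
- exact: L1_meas taL.
- exact: L1_meas rwL.
- exact: rw.
- exact: L1_meas tbL.
- exact: L1_meas iwL.
- exact: iw.
Qed.

Section line.
Variables (L sigma : R).
Hypothesis sg1 : 1 / 2 < sigma.
Hypothesis sg2 : sigma < 3 / 4.

Let d := sigma - 1 / 2.
Let d0 : 0 < d. Proof. by rewrite subr_gt0. Qed.
Let s0 : 0 <= sigma. Proof. by apply: le_trans (ltW sg1). Qed.
Let s1 : sigma <= 3 / 4. Proof. exact: ltW. Qed.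

Let ga := tilt sigma a.
Let gb := tilt sigma b.
Let h := decay d L.
Let gaL : L1b ga. Proof. by have := tilt_L1b beta1 aE' s0 s1. Qed.
Let gbL : L1b gb. Proof. by have := tilt_L1b beta1 bE' s0 s1. Qed.
Let hL : L1b h. Proof. exact: decay_L1b. Qed.

(** With $\delta=\sigma-1/2>0$ one has $i\xi+1/2=-\delta+iu$, and
    $e^{L(-\delta+iu)}/(\delta-iu)=\int_L^\infty e^{-\delta x}e^{iux}dx$. *)
Lemma line_kernelE u : cexp (L%:C * (Num.imaginary * (u +i* sigma) + (1 / 2)%:C))
   / (Num.imaginary * (u +i* sigma) + (1 / 2)%:C) =
  (- cosT h u) +i* (- sinT h u).
Proof.
have -> : Num.imaginary * (u +i* sigma) + (1 / 2)%:C = (- d) +i* u :> R[i].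
  by apply/eqP; rewrite eq_complex /=; apply/andP; split; apply/eqP; rewrite /d; ring.
have -> : L%:C * ((- d) +i* u) = (- d * L) +i* (u * L) :> R[i].
  by apply/eqP; rewrite eq_complex /=; apply/andP; split; apply/eqP; ring.
rewrite (cosT_decay u L d0) (sinT_decay u L d0) cinvE /cexp /= sqrrN !cmulE.
by apply/eqP; rewrite eq_complex /=; apply/andP; split; apply/eqP; ring.
Qed.

Lemma remainderE u : remainder_integrand f0 t L (u +i* sigma) =
  (- ((cosT ga u * cosT h u + sinT ga u * sinT h u)
     - (cosT gb u * sinT h u - cosT h u * sinT gb u))) +i*
  (- ((cosT gb u * cosT h u + sinT gb u * sinT h u)
     + (cosT ga u * sinT h u - cosT h u * sinT ga u))).
Proof.
rewrite /remainder_integrand line_kernelE [fourier _ _ * _]mulrC evolved_transform//.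
rewrite /ftrans cmulE -/ga -/gb.
move: (cosT ga u) (sinT ga u) (cosT gb u) (sinT gb u) (cosT h u) (sinT h u) => p q p' q' r s.
by apply/eqP; rewrite eq_complex /=; apply/andP; split; apply/eqP; ring.
Qed.

Let pair_L1 (g1 g2 : R -> R) : L1b g1 -> L1b g2 ->
  L1 (fun u => cosT g1 u * cosT h u + sinT g1 u * sinT h u) /\
  L1 (fun u => cosT g2 u * sinT h u - cosT h u * sinT g2 u).
Proof.
move=> g1L g2L.
have [c1 c2 _ _] := parseval g1L hL; have [_ _ c3 _] := parseval g2L hL.
have [_ _ c4 _] := parseval hL g2L.
by split; [exact: L1_D|exact: L1_B].
Qed.

Let pair_Int (g1 g2 : R -> R) : L1b g1 -> L1b g2 ->
  Int (fun u => cosT g1 u * cosT h u + sinT g1 u * sinT h u) =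
    2 * pi * Int (fun x => g1 x * h x) /\
  Int (fun u => cosT g2 u * sinT h u - cosT h u * sinT g2 u) = 0.
Proof.
move=> g1L g2L.
have [c1 c2 _ E] := parseval g1L hL; have [_ _ c3 _] := parseval g2L hL.
have [_ _ c4 _] := parseval hL g2L.
by rewrite (Int_D c1 c2) (Int_B c3 c4) E (parseval_odd g2L hL) (parseval_odd hL g2L) subrr.
Qed.

(* The weights exp(sigma x) and exp(-(sigma - 1/2) x) combine to exp(x/2),
   whence the independence of sigma. *)
Let tail_pairing (g : R -> R) : Int (fun x => tilt sigma g x * h x) = tail L g.
Proof.
apply: eq_Int => x; rewrite /tilt /h /decay -!mulrA; congr (_ * _).
rewrite mulrA -expRD; congr (expR _ * _); rewrite /d; ring.
Qed.

Lemma remainder_abs : line_abs_convergent sigma (remainder_integrand f0 t L).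
Proof.
have [p1 p2] := pair_L1 gaL gbL; have [p3 p4] := pair_L1 gbL gaL.
apply: abs_convergentE.
  by apply: eq_L1 (L1_N (L1_B p1 p2)) => u; rewrite remainderE.
by apply: eq_L1 (L1_N (L1_D p3 p4)) => u; rewrite remainderE.
Qed.

(** [parseval] evaluates the products of like parts, and the mixed products
    vanish by [parseval_odd]. *)
Lemma remainder_integral : line_integral sigma (remainder_integrand f0 t L) =
  (- (2 * pi * tail L a)) +i* (- (2 * pi * tail L b)).
Proof.
have [p1 p2] := pair_L1 gaL gbL; have [p3 p4] := pair_L1 gbL gaL.
have [e1 e2] := pair_Int gaL gbL; have [e3 e4] := pair_Int gbL gaL.
rewrite /line_integral cintegralE; congr (_ +i* _).
  transitivity (Int (fun u => - ((cosT ga u * cosT h u + sinT ga u * sinT h u)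
     - (cosT gb u * sinT h u - cosT h u * sinT gb u)))).
    by apply: eq_Int => u; rewrite remainderE.
  by rewrite (Int_N (L1_B p1 p2)) (Int_B p1 p2) e1 e2 subr0 tail_pairing.
transitivity (Int (fun u => - ((cosT gb u * cosT h u + sinT gb u * sinT h u)
     + (cosT ga u * sinT h u - cosT h u * sinT ga u)))).
  by apply: eq_Int => u; rewrite remainderE.
by rewrite (Int_N (L1_D p3 p4)) (Int_D p3 p4) e3 e4 addr0 tail_pairing.
Qed.

Lemma contour_identity : cintegral `]-oo, L] w = cintegral setT w
  + (1 / (2 * pi))%:C * line_integral sigma (remainder_integrand f0 t L).
Proof.
rewrite half_integral full_integral remainder_integral.
have p0 : 2 * (pi : R) != 0 by rewrite gt_eqF// mulr_gt0// pi_gt0.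
move: (2 * pi) p0 => p p0; apply/eqP; rewrite eq_complex /=.
by apply/andP; split; apply/eqP; field.
Qed.

Lemma weighted_data_L1 : L1 (fun x => cabs (f0 x) * expR (3 * x / 4)).
Proof.
have q0 : (0 : R) <= 3 / 4 by lra.
have q1 : (3 / 4 : R) <= 3 / 4 by [].
have [aL _] := tilt_L1b beta1 aE q0 q1; have [bL _] := tilt_L1b beta1 bE q0 q1.
have me : measurable_fun setT (fun x : R => expR (3 * x / 4)).
  rewrite (_ : (fun x => _) = (fun x : R => expR (3 / 4 * x))).
    exact: measurable_expR_scale.
  by apply/funext => x; congr expR; ring.
have mc : measurable_fun setT (fun x : R => cabs (f0 x) * expR (3 * x / 4)).
  by apply: measurable_funM => //; exact: measurable_cabs.
apply: (@L1_ae _ (fun x => cabs (a0 x +i* b0 x) * expR (3 * x / 4))) => //.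
  apply: ae_imp f0ab => x; rewrite /rpart /ipart.
  by case: (f0 x) => p q /= [-> ->].
apply: (L1_dom _ (L1_D (L1_abs aL) (L1_abs bL))).
  apply: measurable_funM => //; apply: measurable_cabs.
  by split; [exact: aE.1|exact: bE.1].
move=> x; rewrite normrM !(ger0_norm (expR_ge0 _)) ger0_norm ?cabs_ge0//.
rewrite /tilt !normrM !(ger0_norm (expR_ge0 _)) -mulrDl (_ : 3 / 4 * x = 3 * x / 4); last by ring.
by rewrite ler_wpM2r ?expR_ge0// cabs_le.
Qed.

(** For $x>L$ one has $e^{x/2}\le e^{-L/4}e^{3x/4}$, so the tail is controlled
    by the weighted norm of [sol_L1_bound]. The constant $4\pi$ is $2\pi$ for
    each of the real and imaginary parts. *)
Lemma remainder_bound :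
  (forall x, `|a0 x| <= cabs (f0 x)) -> (forall x, `|b0 x| <= cabs (f0 x)) ->
  cabs (line_integral sigma (remainder_integrand f0 t L)) <=
  4 * pi * expR (- (L / 4)) * expR (rate * t) *
    Int (fun x => cabs (f0 x) * expR (3 * x / 4)).
Proof.
move=> ha hb; have ML := weighted_data_L1; pose J := Int (fun x => cabs (f0 x) * expR (3 * x / 4)).
have q0 : (0 : R) <= 3 / 4 by lra.
have q1 : (3 / 4 : R) <= 3 / 4 by [].
have part (c0 : R -> R) : enveloped beta c0 C -> (forall x, `|c0 x| <= cabs (f0 x)) ->
    `|tail L (sol t c0)| <= expR (- (L / 4)) * (expR (t * rate) * J).
  move=> cE hc.
  have cE' := sol_env beta1 beta2 (ltW t0) cE.
  have [tL _] := tilt_L1b beta1 cE' half0 half1.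
  have [t3L _] := tilt_L1b beta1 cE' q0 q1.
  have [t3L0 _] := tilt_L1b beta1 cE q0 q1.
  apply: (@le_trans _ _ (Int (fun x => expR (- (L / 4)) * `|tilt (3 / 4) (sol t c0) x|))).
    apply: Int_abs_le; [exact: tailL|by apply: L1_Z; exact: L1_abs|].
    move=> x; rewrite indic_gt normrM /tilt !normrM !(ger0_norm (expR_ge0 _)).
    rewrite [leRHS]mulrCA -[leLHS]mulrA ler_wpM2l// -expRD normr_nat.
    have [Lx|_] := boolP (L < x); last by rewrite mulr0 expR_ge0.
    by rewrite mulr1 ler_expR; lra.
  rewrite Int_Z; last exact: L1_abs.
  rewrite ler_wpM2l ?expR_ge0//.
  apply: (le_trans (sol_L1_bound beta1 beta2 (ltW t0) cE)).
  rewrite ler_wpM2l ?expR_ge0//; apply: Int_le => //; first exact: L1_abs.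
  move=> x; rewrite /tilt normrM (ger0_norm (expR_ge0 _)).
  by rewrite (_ : 3 / 4 * x = 3 * x / 4) ?ler_wpM2r ?expR_ge0//; ring.
rewrite remainder_integral; apply: (le_trans (cabs_le _)) => /=.
rewrite !normrN !normrM; have p0 := pi_gt0 R.
rewrite (ger0_norm (ltW p0)) normr_nat -mulrDr [t * rate]mulrC in part *.
have := part _ aE ha; have := part _ bE hb; rewrite -/a -/b -/J => h1 h2.
rewrite (_ : 4 * pi * expR (- (L / 4)) * expR (rate * t) * J =
  2 * pi * (expR (- (L / 4)) * (expR (rate * t) * J) + expR (- (L / 4)) * (expR (rate * t) * J))); last by ring.
by rewrite ler_wpM2l ?mulr_ge0 ?(ltW p0)//; apply: lerD.
Qed.

End line.
End EvolvedDatum.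

Unset Implicit Arguments.

Theorem theorem3p16 (R : realType) (A B : R)
    (hB : - (5 / 2) < B) (hB' : B < - (3 / 4))
    (hA : 1 / 2 < A) (hA' : A < 1) :
  exists sigma0 nu : R,
  [/\ 1 / 2 < sigma0,
      (- nu)%:C = gamma%:C + Khat (0 +i* (3 / 4)) :> R[i],
      - nu < 0,
      (forall f0 : R -> R[i], inX A B f0 ->
       forall L t sigma : R, 0 < t -> 1 / 2 < sigma < sigma0 ->
       [/\ abs_convergent `]-oo, L]
             (fun x => solution f0 t x * (expR (x / 2))%:C),
           abs_convergent setT
             (fun x => solution f0 t x * (expR (x / 2))%:C),
           line_abs_convergent sigma (remainder_integrand f0 t L) &
           cintegral `]-oo, L] (fun x => solution f0 t x * (expR (x / 2))%:C)
           = cintegral setT (fun x => solution f0 t x * (expR (x / 2))%:C)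
             + (1 / (2 * pi))%:C
               * line_integral sigma (remainder_integrand f0 t L)]) &
      (forall L : R, exists2 C : R, 0 < C &
       forall f0 : R -> R[i], inX A B f0 ->
       \forall t \near +oo,
       forall sigma : R, 1 / 2 < sigma < sigma0 ->
       cabs (line_integral sigma (remainder_integrand f0 t L))
       <= C * expR (- nu * t)
          * Rintegral (@lebesgue_measure R) setT
              (fun x => cabs (f0 x) * expR (3 * x / 4)))].
Proof.
pose beta : R := Num.min (- B) (7 / 4).
have beta1 : 3 / 4 < beta by rewrite lt_min; apply/andP; split; lra.
have beta2 : beta <= 7 / 4 by rewrite ge_min lexx orbT.
(* The weighted datum is integrable on every line up to Im xi = 3/4. *)
exists (3 / 4), (- rate); split.
- by lra.
- have q0 : (0 : R) <= 3 / 4 by lra.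
  rewrite opprK (KhatE 0 q0 (lexx _)).
  have -> : cosT (tilt (3 / 4) K) 0 = Int (fun x : R => K x * expR (3 / 4 * x)).
    by apply: eq_Int => x; rewrite mulr0 cos0 mulr1.
  have -> : sinT (tilt (3 / 4) K) 0 = 0 :> R.
    by rewrite /sinT -[RHS]Int_0; apply: eq_Int => x; rewrite mulr0 sin0 mulr0.
  by rewrite /rate caddE oppr0 addr0.
- by rewrite opprK; exact: rate_lt0.
- move=> f0 f0X L t sigma t0 /andP[s1 s2].
  have [[mf0 _] _] := f0X.
  have [a0 [b0 [C [aE bE ab _ _]]]] := inX_representative hB' hA f0X.
  split.
  + exact: (weighted_solution_abs_half beta1 beta2 mf0 aE bE ab t0).
  + exact: (weighted_solution_abs beta1 beta2 mf0 aE bE ab t0).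
  + exact: (remainder_abs beta1 beta2 mf0 aE bE ab t0).
  + exact: (contour_identity beta1 beta2 mf0 aE bE ab t0).
- move=> L; exists (4 * pi * expR (- (L / 4))).
    by rewrite !mulr_gt0 ?pi_gt0 ?expR_gt0.
  move=> f0 f0X; have [[mf0 _] _] := f0X.
  have [a0 [b0 [C [aE bE ab ha hb]]]] := inX_representative hB' hA f0X.
  near=> t => sigma /andP[s1 s2]; rewrite opprK.
  have t0 : 0 < t by near: t; apply: nbhs_pinfty_gt; exact: num_real.
  apply: (remainder_bound beta1 beta2 mf0 aE bE ab t0) => //.
Unshelve. all: end_near.
Qed.
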